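(* Let $\alpha_+\in A_{SB}(E)$ with dual data $\alpha_-$. Let $f^+\in L^2_{\alpha_+}\ominus\check H^2_{\alpha_+}$ and let $f^-\in L^2_{\alpha_-}$ be its image under the duality map. Then $f^-\in\hat H^2_{\alpha_-}$. In short, $$(\hat H^2_{\alpha_-})^+=L^2_{\alpha_+}\ominus\check H^2_{\alpha_+},$$ where $(\hat H^2_{\alpha_-})^+$ denotes the set of all $f^+\in L^2_{\alpha_+}$ whose image $f^-$ under the duality map lies in $\hat H^2_{\alpha_-}$.
   Context: $\mathbb D$ is the unit disk, $\mathbb T$ the unit circle, $m$ normalized Lebesgue measure on $\mathbb T$, $H^2,H^\infty$ Hardy spaces of $\mathbb D$. Data. $\mathcal Z=\{\zeta_k\}\subset(-1,1)$ with $\sum(1-|\zeta_k|)<\infty$; $B(\zeta)=\prod_{\mathcal Z}\frac{|\zeta_k|}{\zeta_k}\frac{\zeta_k-\zeta}{1-\zeta\bar\zeta_k}$ (factor $\zeta$ if $0\in\mathcal Z$). $\alpha_+=\{R_+,\nu_+\}\in A_{SB}(E)$ means: $R_+$ is a measurable function on $\mathbb T$ with $|R_+|\le1$, $R_+(\tau)=\overline{R_+(\bar\tau)}$, $\int_{\mathbb T}\log(1-|R_+|^2)dm>-\infty$; $\nu_+$ is a positive discrete measure on $\mathcal Z$ with $\nu_+(\zeta_k)>0$ (not assumed finite). Dual data. Let $O$ be an outer function in $\mathbb D$ with $|O|^2+|R_+|^2=1$ a.e. on $\mathbb T$ (any fixed choice of unimodular factor), $T_-=O/B$, $T_+(\zeta)=\overline{T_-(\bar\zeta)}$,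 $R_-=-\frac{T_-}{\overline{T_+}}\overline{R_+}$ on $\mathbb T$, $\frac1{\nu_-(\zeta_k)}=\nu_+(\zeta_k)\left|(1/T_\pm)'(\zeta_k)\right|^2$, $\alpha_-=\{R_-,\nu_-\}$. Faddeev–Marchenko space. For $\alpha=\{R,\nu\}$, $L^2_{\alpha}$ is the Hilbert space of functions $f$ on $\mathbb T\cup\mathcal Z$ with finite norm $$\|f\|^2_{\alpha}=\sum_{\mathcal Z}|f(\zeta_k)|^2\nu(\zeta_k)+\frac12\int_{\mathbb T}\begin{bmatrix}\overline{f(\tau)}&\tau\overline{f(\bar\tau)}\end{bmatrix}\begin{bmatrix}1&\overline{R(\tau)}\\R(\tau)&1\end{bmatrix}\begin{bmatrix}f(\tau)\\\bar\tau f(\bar\tau)\end{bmatrix}dm(\tau).$$ Duality map $f^+\mapsto f^-$: the unitary map $L^2_{\alpha_+}\to L^2_{\alpha_-}$ given by $T_-(\tau)f^-(\tau)=\bar\tau f^+(\bar\tau)+R_+(\tau)f^+(\tau)$, $\tau\in\mathbb T$ (equivalently $T_+(\tau)f^+(\tau)=\bar\tau f^-(\bar\tau)+R_-(\tau)f^-(\tau)$), and $f^-(\zeta_k)=-\left(\frac1{T_-}\right)'(\zeta_k)\nu_+(\zeta_k)f^+(\zeta_k)$, $\zeta_k\in\mathcal Z$. Hardy subspaces. $\check H^2_{\alpha_+}$ is the closure in $L^2_{\alpha_+}$ of the set of functions $f=B_Ng$, $g\in H^\infty$, where $B_N$ is a divisor of $B$ such that $B/B_N$ is a finite Blaschke product.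 $\hat H^2_{\alpha_-}$ is the set of $f\in L^2_{\alpha_-}$ such that $g(\tau):=(BT_-f)(\tau)$, $\tau\in\mathbb T$, belongs to $H^2$ and $f(\zeta_k)=\left(\frac g{BT_-}\right)(\zeta_k)$ for all $\zeta_k\in\mathcal Z$, where $g$ and $BT_-$ are defined in $\mathbb D$ by analytic continuation. *)

(* Defs.v *)
From HB Require Import structures.
From mathcomp Require Import all_boot all_order all_algebra finmap.
From mathcomp Require Import all_classical all_reals all_analysis.
From mathcomp Require Import complex.
From mathcomp Require summability.

Set Implicit Arguments.
Unset Strict Implicit.
Unset Printing Implicit Defensive.

Import Order.TTheory GRing.Theory Num.Theory.
Import numFieldNormedType.Exports.
Import ComplexField ComplexField.Normc.

Local Open Scope classical_set_scope.
Local Open Scope ring_scope.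
Local Open Scope complex_scope.

(* Conjugation is conjc everywhere (ring_scope also has Num.conj as _ ^* ). *)
Local Notation "x ^*" := (conjc x) : ring_scope.

(* Functions on the disk, on the circle and on Z are total functions on R[i],
   and only their values on the relevant set matter.  R[i] gets its topology
   from R[i]^o, the one-dimensional normed module over itself. *)

Section Circle.
Variable R : realType.
Notation C := R[i].
Notation mu := (@lebesgue_measure R).
Notation I01 := (`[0%R, 1%R]%classic : set R).

(* t |-> circ t maps Lebesgue measure on [0, 1] to the normalized measure m on
   the unit circle, so integrals and null sets for m are expressed through t. *)
Definition circ (t : R) : C := cos (2 * pi * t) +i* sin (2 * pi * t).

Definition ae_circle (P : C -> Prop) : Prop :=
  {ae mu, forall t, I01 t -> P (circ t)}.

Definition eint_circle (u : C -> \bar R) : \bar R :=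
  (\int[mu]_(t in I01) u (circ t))%E.

Definition cint_circle (u : C -> C) : C :=
  Rintegral mu I01 (fun t => complex.Re (u (circ t))) +i*
  Rintegral mu I01 (fun t => complex.Im (u (circ t))).

(* Borel measurability; every class of functions modulo m has such
   representatives. *)
Definition measurable_circle (f : C -> C) : Prop :=
  measurable_fun I01 (fun t => complex.Re (f (circ t))) /\
  measurable_fun I01 (fun t => complex.Im (f (circ t))).

End Circle.

Section Hardy.
Variable R : realType.
Notation C := R[i].
Notation mu := (@lebesgue_measure R).
Notation I01 := (`[0%R, 1%R]%classic : set R).

Definition cexp (z : C) : C :=
  (expR (complex.Re z) * cos (complex.Im z)) +i*
  (expR (complex.Re z) * sin (complex.Im z)).

Definition in_disk (z : C) : Prop := normc z < 1.

Definition holo_disk (F : C -> C) : Prop :=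
  forall z, in_disk z -> derivable (F : C^o -> C^o) z 1.

Definition radial (F : C -> C) (tau : C) : R -> C^o :=
  fun r => F (r%:C * tau).

Definition bv (F : C -> C) (tau : C) : C := lim (radial F tau @ 1^'-).

(* A function on the disk, extended to the closed disk by boundary values. *)
Definition with_bv (F : C -> C) (z : C) : C :=
  if normc z < 1 then F z else bv F z.

Definition hardy2 (F : C -> C) : Prop :=
  holo_disk F /\
  exists M : R, forall r : R, 0 <= r < 1 ->
    (eint_circle (fun tau => (normc (F (r%:C * tau)) ^+ 2)%:E) <= M%:E)%E.

Definition hardyoo (F : C -> C) : Prop :=
  holo_disk F /\ exists M : R, forall z, in_disk z -> normc (F z) <= M.

(* O = c exp (int (tau + z) / (tau - z) k(tau) dm(tau)) on the disk, with
   |c| = 1 and k real and integrable (then |O| = exp k a.e. on the circle). *)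
Definition outer (O : C -> C) : Prop :=
  exists (c : C) (k : C -> R),
    [/\ normc c = 1,
        mu.-integrable I01 (fun t => (k (circ t))%:E)
      & forall z, in_disk z ->
          O z = c * cexp (cint_circle
                  (fun tau => (tau + z) / (tau - z) * (k tau)%:C))].

Definition blaschke_factor (x : R) (z : C) : C :=
  if x == 0 then z else (`|x| / x)%:C * ((x%:C - z) / (1 - z * x%:C)).

(* The product over a possibly infinite set of zeros is the limit of the
   products over its finite subsets. *)
Definition blaschke (N : set R) (z : C) : C :=
  lim ((fun A : {fset R} =>
          (\prod_(x <- A | x \in N) blaschke_factor x z : C^o))
       @ summability.totally).

End Hardy.

Section Scattering.
Variable R : realType.
Notation C := R[i].

Record scattering := Scattering { refl : C -> C ; wgt : R -> R }.
Implicit Types (Z : set R) (a : scattering) (O f h : C -> C).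

Definition blaschke_zeros Z : Prop :=
  Z `<=` `]-1, 1[%classic /\ (\esum_(x in Z) (1 - `|x|)%:E < +oo)%E.

(* lne 0 = -oo, unlike ln 0 = 0. *)
Definition A_SB Z a : Prop :=
  [/\ measurable_circle (refl a),
      ae_circle (fun tau => normc (refl a tau) <= 1),
      ae_circle (fun tau => refl a tau = (refl a tau^*)^*),
      (-oo < eint_circle
               (fun tau => lne (1 - normc (refl a tau) ^+ 2)%:E))%E
    & forall x, Z x -> 0 < wgt a x].

(* The integrand [conj h(tau), tau conj h(conj tau)] W [f(tau); conj tau
   f(conj tau)] with W = [1, conj R; R, 1]. *)
Definition FM_form (r : C -> C) f h (tau : C) : C :=
  (h tau)^* * (f tau + (r tau)^* * (tau^* * f tau^*)) +
  tau * (h tau^*)^* * (r tau * f tau + tau^* * f tau^*).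

Definition FM_inner Z a f h : C :=
  summability.sum (fun x : R =>
    (if x \in Z then f x%:C * (h x%:C)^* * (wgt a x)%:C else 0) : C^o)
  + 2^-1 * cint_circle (FM_form (refl a) f h).

(* FM_form r f f is real, and nonnegative where |r| <= 1. *)
Definition FM_normsq Z a f : \bar R :=
  (\esum_(x in Z) (normc (f x%:C) ^+ 2 * wgt a x)%:E
  + (2^-1)%:E * eint_circle
      (fun tau => (complex.Re (FM_form (refl a) f f tau))%:E))%E.

Definition FM_L2 Z a : set (C -> C) :=
  [set f | measurable_circle f /\ (FM_normsq Z a f < +oo)%E].

Definition FM_closure Z a (S : set (C -> C)) : set (C -> C) :=
  [set f | FM_L2 Z a f /\
    forall eps : R, 0 < eps ->
      exists2 s, S s & (FM_normsq Z a (f \- s)%R < eps%:E)%E].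

Definition FM_orth Z a (S : set (C -> C)) : set (C -> C) :=
  [set f | FM_L2 Z a f /\ forall h, S h -> FM_inner Z a f h = 0].

Definition Tminus Z O (z : C) : C := O z / blaschke Z z.

Definition Tplus Z O (z : C) : C := (Tminus Z O z^*)^*.

(* (1/T_-)' ; T_- has simple poles on Z, where the convention 0^-1 = 0 gives
   1/T_- the value 0, so that 1/T_- is B/O on the whole disk. *)
Definition dinvT Z O : C -> C :=
  derive1 (fun z : C => (Tminus Z O z)^-1 : C^o).

(* |(1/T_+)'| = |(1/T_-)'| on the real line. *)
Definition dual_data Z O a : scattering :=
  Scattering
    (fun tau => - (bv (Tminus Z O) tau / (bv (Tplus Z O) tau)^*)
                * (refl a tau)^*)
    (fun x => (wgt a x * normc (dinvT Z O x%:C) ^+ 2)^-1).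

Definition duality Z O a f (z : C) : C :=
  if normc z == 1 then
    (z^* * f z^* + refl a z * f z) / bv (Tminus Z O) z
  else - dinvT Z O z * (wgt a (complex.Re z))%:C * f z.

(* The divisors B_N of B with B / B_N a finite Blaschke product are the
   products over the cofinite subsets N of Z. *)
Definition checkH Z a : set (C -> C) :=
  FM_closure Z a
    [set f | exists (N : set R) (g : C -> C),
      [/\ N `<=` Z, finite_set (Z `\` N), hardyoo g
        & f = with_bv (fun z => blaschke N z * g z)]].

(* G is the analytic continuation of g to the disk, and that of B T_- is O. *)
Definition hatH Z O a : set (C -> C) :=
  [set f | FM_L2 Z a f /\
    exists G : C -> C,
      [/\ hardy2 G,
          ae_circle (fun tau => radial G tau @ 1^'- -->
            (bv (blaschke Z) tau * bv (Tminus Z O) tau * f tau : C^o))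
        & forall x, Z x -> f x%:C = G x%:C / O x%:C]].

End Scattering.

(* Main.v *)
Require Import Defs.
From mathcomp Require Import all_boot all_order all_algebra finmap.
From mathcomp Require Import all_classical all_reals all_analysis measurable_realfun.
From mathcomp Require Import complex ring lra zify.
From mathcomp Require summability.
Import Order.TTheory GRing.Theory Num.Theory.
Import numFieldNormedType.Exports.
Import ComplexField ComplexField.Normc.

(** For a point tau of the circle put phi(tau) = conj tau f(conj tau) + R(tau) f(tau),
    which is T_- f^- there.  Completing the square in the form ([form_polar]) shows
    that phi is square integrable for every f in L^2_alpha, and the substitution
    tau -> conj tau, which exchanges the two terms of the form, turns the circle part
    of the inner product of f and h into the integral of tau conj(h(conj tau)) phi(tau)
    ([circle_half]).  Let N be a subset of Z with Z \ N = A finite and write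
    g~(z) = conj g(conj z).  The zeros being real, conj B_N(conj tau) = B_N(tau), so
    orthogonality of f to the generator B_N g of the Hardy subspace reads

      sum_(x in A) f(x) B_N(x) g~(x) nu(x) + int tau B_N g~ phi dm = 0

    ([inner_test]).  Both inclusions are read off from this formula.

    Orthogonality implies interpolation ([orth_hat]).  With N = Z and g = z^n the
    condition says that B phi has no Fourier coefficients of negative index; hence
    B phi = B T_- f^- is the boundary function of its Cauchy integral G, which belongs
    to H^2.  With N = Z \ {x} and g = 1 the integral is that of tau B phi / b_x, where
    b_x is the Blaschke factor of x; since tau / b_x(tau) is, up to a multiple of tau,
    the kernel 1 / (1 - x conj tau) divided by b_x'(x), the condition becomes
    G(x) = - b_x'(x) B_(Z \ x)(x) nu(x) f(x).  This is f^-(x) = G(x) / O(x), because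
    (1/T_-)'(x) = b_x'(x) B_(Z \ x)(x) / O(x) ([dinvT_val]).

    Interpolation implies orthogonality ([hat_orth]).  If B T_- f^- is the boundary
    function of G in H^2, the integral above is that of tau g~ G / prod_(x in A) b_x.
    Expanding the reciprocal of the finite product into simple fractions
    ([partial_fractions], [int_partial_fractions]) evaluates it as a sum of residues
    at the points of A, and the values prescribed for G make each residue cancel the
    corresponding term of the sum.  Orthogonality extends from the generators to their
    closure by a weighted Cauchy-Schwarz inequality ([orth_closure]).

    That f^- lies in the dual space at all is a pointwise identity between the two
    energy densities ([dual_energy]), valid where |T_-|^2 = 1 - |R|^2 is positive; the
    logarithmic integrability of 1 - |R|^2 makes this happen almost everywhere.

    The function theory behind this is the description of H^2 by boundary functions
    ([hardy2_boundary]): every F in H^2 is the Cauchy integral of a square-integrable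
    function without coefficients of negative index, to which it converges radially
    almost everywhere.  It rests on Goursat's theorem in the coordinates
    z = exp(s + 2 pi i t), from which circle means of functions holomorphic in the
    punctured disk are independent of the radius ([mean_const]), on the Riesz-Fischer
    theorem, and on Fatou's theorem, proved at Lebesgue points with a dyadic majorant
    of the Poisson kernel ([fatou_radial]).  Products of elements of H^2 and bounded
    holomorphic functions stay in H^2 and radial limits multiply, so no convergence of
    products of Fourier series is involved.  Infinite Blaschke products are studied on
    the closed disk without +-1, where they converge locally uniformly. *)

Set Implicit Arguments.
Unset Strict Implicit.
Unset Printing Implicit Defensive.
Local Open Scope classical_set_scope.
Local Open Scope ring_scope.
Local Open Scope complex_scope.
(* In [ring_scope] this symbol also denotes the conjugation of a numeric closed field;
   the definitions use [conjc]. *)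
Local Notation "x ^*" := (conjc x) : ring_scope.

(** * Complex numbers: modulus, limits, derivatives *)

Section ComplexBasics.
Variable R : realType.
Notation C := R[i].
Implicit Types (x y z w : C).

Lemma nc_ge0 z : 0 <= normc z.
Proof. by case: z => a b; exact: sqrtr_ge0. Qed.

Lemma ncE z : `|z| = (normc z)%:C.
Proof. by []. Qed.

Lemma ncD x y : normc (x + y) <= normc x + normc y.
Proof. exact: le_normcD. Qed.

Lemma ncN x : normc (- x) = normc x.
Proof. exact: normcN. Qed.

Lemma ncB x y : normc (x - y) <= normc x + normc y.
Proof. by rewrite -(ncN y); exact: ncD. Qed.

Lemma ncdist x y : normc (x - y) = normc (y - x).
Proof. by rewrite -ncN opprB. Qed.

Lemma ncR (r : R) : normc r%:C = `|r|.
Proof. by rewrite /= expr0n /= addr0 sqrtr_sqr. Qed.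

Lemma nc0 : normc (0 : C) = 0. Proof. exact: normc0. Qed.
Lemma nc1 : normc (1 : C) = 1. Proof. exact: normc1. Qed.

Lemma nc_eq0 z : (normc z == 0) = (z == 0).
Proof. by apply/eqP/eqP => [/eq0_normc //|->]; rewrite nc0. Qed.

Lemma nc_gt0 z : (0 < normc z) = (z != 0).
Proof. by rewrite lt_neqAle nc_ge0 andbT eq_sym nc_eq0. Qed.

Lemma ncM x y : normc (x * y) = normc x * normc y.
Proof. exact: normcM. Qed.

Lemma ncV x : normc x^-1 = (normc x)^-1.
Proof. exact: normcV. Qed.

Lemma ncX x n : normc (x ^+ n) = normc x ^+ n.
Proof. by elim: n => [|n ih]; rewrite ?expr0 ?nc1 // !exprS ncM ih. Qed.

Lemma ncJ x : normc x^* = normc x.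
Proof. by case: x => a b /=; rewrite sqrrN. Qed.

Lemma nc_sqr z : normc z ^+ 2 = complex.Re z ^+ 2 + complex.Im z ^+ 2.
Proof. by case: z => a b /=; rewrite sqr_sqrtr // addr_ge0 ?sqr_ge0. Qed.

Lemma nc_mulJ z : z * z^* = (normc z ^+ 2)%:C.
Proof. by rewrite -sqr_normc ncE rmorphXn. Qed.

Lemma Re_nc z : `|complex.Re z| <= normc z.
Proof. by case: z => a b /=; rewrite -sqrtr_sqr ler_wsqrtr // lerDl sqr_ge0. Qed.

Lemma Im_nc z : `|complex.Im z| <= normc z.
Proof. by case: z => a b /=; rewrite -sqrtr_sqr ler_wsqrtr // lerDr sqr_ge0. Qed.

Lemma nc_ReIm z : normc z <= `|complex.Re z| + `|complex.Im z|.
Proof.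
case: z => a b /=; rewrite -(@ler_pXn2r _ 2) ?nnegrE ?sqrtr_ge0 ?addr_ge0 //.
rewrite sqr_sqrtr ?addr_ge0 ?sqr_ge0 // sqrrD !real_normK ?num_real //.
by rewrite -addrA [X in _ <= _ + X]addrC addrA lerDl mulrn_wge0 // mulr_ge0.
Qed.

Lemma ReD x y : complex.Re (x + y) = complex.Re x + complex.Re y.
Proof. by case: x y => [a b] [c d]. Qed.
Lemma ImD x y : complex.Im (x + y) = complex.Im x + complex.Im y.
Proof. by case: x y => [a b] [c d]. Qed.
Lemma ReN x : complex.Re (- x) = - complex.Re x.
Proof. by case: x. Qed.
Lemma ImN x : complex.Im (- x) = - complex.Im x.
Proof. by case: x. Qed.
Lemma ReM x y : complex.Re (x * y) = complex.Re x * complex.Re y - complex.Im x * complex.Im y.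
Proof. by case: x y => [a b] [c d]. Qed.
Lemma ImM x y : complex.Im (x * y) = complex.Re x * complex.Im y + complex.Im x * complex.Re y.
Proof. by case: x y => [a b] [c d]. Qed.
Lemma ReJ x : complex.Re x^* = complex.Re x. Proof. by case: x. Qed.
Lemma ImJ x : complex.Im x^* = - complex.Im x. Proof. by case: x. Qed.

Lemma eq_ReIm x y : complex.Re x = complex.Re y -> complex.Im x = complex.Im y -> x = y.
Proof. by case: x y => [a b] [c d] /= -> ->. Qed.

Lemma conjcD x y : (x + y)^* = x^* + y^*. Proof. exact: rmorphD. Qed.
Lemma conjcB x y : (x - y)^* = x^* - y^*. Proof. exact: rmorphB. Qed.
Lemma conjcM x y : (x * y)^* = x^* * y^*. Proof. exact: rmorphM. Qed.
Lemma conjcX x n : (x ^+ n)^* = x^* ^+ n. Proof. exact: rmorphXn. Qed.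

Lemma nc_sum (I : Type) (r : seq I) (P : pred I) (F : I -> C) :
  normc (\sum_(i <- r | P i) F i) <= \sum_(i <- r | P i) normc (F i).
Proof.
elim/big_rec2: _ => [|i y z _ h]; first by rewrite nc0.
by apply: (le_trans (ncD _ _)); rewrite lerD2l.
Qed.

Lemma nc_prod (I : Type) (r : seq I) (P : pred I) (F : I -> C) :
  normc (\prod_(i <- r | P i) F i) = \prod_(i <- r | P i) normc (F i).
Proof.
by elim/big_rec2: _ => [|i y z _ h]; rewrite ?nc1 // ncM h.
Qed.

Lemma nc_triangle x y z : normc (x - z) <= normc (x - y) + normc (y - z).
Proof. by rewrite -[x - z](subrKA y); exact: ncD. Qed.

Lemma nc_rev x y : normc x - normc y <= normc (x - y).
Proof. by rewrite lerBlDr -{1}[x](subrK y); exact: ncD. Qed.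

Lemma nc_dist x y : `|normc x - normc y| <= normc (x - y).
Proof. by rewrite ler_norml nc_rev andbT lerNl opprB ncdist; exact: nc_rev. Qed.

Lemma unimod_conj z : normc z = 1 -> z^* = z^-1.
Proof.
move=> z1; have z0 : z != 0 by rewrite -nc_eq0 z1 oner_eq0.
by apply: (mulfI z0); rewrite divff // nc_mulJ z1 expr1n.
Qed.

Lemma cvgC (T : Type) (F : set_system T) {FF : Filter F} (f : T -> C^o) (l : C^o) :
  f @ F --> l <-> forall e : R, 0 < e -> \forall x \near F, normc (f x - l) < e.
Proof.
split.
- move=> /cvgrPdist_lt h e e0; have := h e%:C; rewrite ltcR => /(_ e0).
  by apply: filterS => x; rewrite distrC -ltcR.
move=> h; apply/cvgrPdist_lt => e; rewrite ltcE /= => /andP[/eqP e0 e1].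
have -> : e = (complex.Re e)%:C by apply: eq_ReIm.
by apply: filterS (h _ e1) => x; rewrite distrC ltcR.
Qed.

Lemma nbhsC (z : C^o) (P : C -> Prop) :
  (\forall w \near z, P w) <-> exists2 d : R, 0 < d & forall w, normc (w - z) < d -> P w.
Proof.
split.
- case/nbhs_ballP => e /=; rewrite ltcE /= => /andP[/eqP e0 e1] h.
  exists (complex.Re e) => // w zw; apply: h; rewrite /ball /=.
  rewrite distrC ltcE /= -e0 eqxx /=; exact: zw.
move=> [d d0 h]; apply/nbhs_ballP; exists d%:C => /=; first by rewrite ltcR.
by move=> w; rewrite /ball /= distrC => zw; apply: h; rewrite -ltcR.
Qed.

Lemma cvgC_ReIm (T : Type) (F : set_system T) {FF : Filter F} (f : T -> C^o) (l : C^o) :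
  f @ F --> l <-> (complex.Re (f x) @[x --> F] --> complex.Re l) /\
                  (complex.Im (f x) @[x --> F] --> complex.Im l).
Proof.
split.
- move=> /cvgC h; split; apply/cvgrPdist_lt => e e0; apply: filterS (h e e0) => x.
    by apply: le_lt_trans; rewrite distrC -ReN -ReD; exact: Re_nc.
  by apply: le_lt_trans; rewrite distrC -ImN -ImD; exact: Im_nc.
case=> /cvgrPdist_lt h1 /cvgrPdist_lt h2; apply/cvgC => e e0.
have e2 : 0 < e / 2 by rewrite divr_gt0.
apply: filterS2 (h1 _ e2) (h2 _ e2) => x a b.
rewrite (le_lt_trans (nc_ReIm _)) // ReD ReN ImD ImN [e]splitr.
by apply: ltrD; rewrite distrC.
Qed.

End ComplexBasics.

(** Convergence measured by the real-valued modulus, so that real estimates apply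
    directly; [ctoP] relates it to the topology of [C^o]. *)
Definition cto (R : realType) (T : Type) (F : set_system T) (f : T -> R[i]) (l : R[i]) : Prop :=
  forall e : R, 0 < e -> \forall s \near F, normc (f s - l) < e.

Section cto_theory.
Variable R : realType.
Notation C := R[i].
Context (T : Type) (F : set_system T) {FF : Filter F}.
Implicit Types (f g : T -> C) (a b : C).

Lemma ctoP f a : (f : T -> C^o) @ F --> (a : C^o) <-> cto F f a.
Proof. exact: cvgC. Qed.

Lemma cto_ReIm f a : cto F f a <->
  (complex.Re (f s) @[s --> F] --> complex.Re a) /\ (complex.Im (f s) @[s --> F] --> complex.Im a).
Proof. by rewrite -ctoP; exact: cvgC_ReIm. Qed.

Lemma cto_cst a : cto F (fun=> a) a.
Proof. by move=> e e0; apply: nearW => s; rewrite subrr nc0. Qed.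

Lemma eq_cto f g a : (forall s, f s = g s) -> cto F f a -> cto F g a.
Proof. by move=> /funext ->. Qed.

Lemma near_eq_cto f g a : (\forall s \near F, f s = g s) -> cto F f a -> cto F g a.
Proof. by move=> fg h e e0; apply: filterS2 fg (h e e0) => s ->. Qed.

Lemma ctoD f g a b : cto F f a -> cto F g b -> cto F (fun s => f s + g s) (a + b).
Proof.
move=> hf hg e e0; have e2 : 0 < e / 2 by rewrite divr_gt0.
apply: filterS2 (hf _ e2) (hg _ e2) => s h1 h2.
have -> : f s + g s - (a + b) = (f s - a) + (g s - b) by ring.
by rewrite [e]splitr; apply: (le_lt_trans (ncD _ _)); exact: ltrD.
Qed.

Lemma ctoM f g a b : cto F f a -> cto F g b -> cto F (fun s => f s * g s) (a * b).
Proof.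
move=> /cto_ReIm[h1 h2] /cto_ReIm[h3 h4]; apply/cto_ReIm; split.
  under eq_cvg do rewrite ReM; rewrite ReM; apply: (@cvgB R R); exact: (@cvgM R).
under eq_cvg do rewrite ImM; rewrite ImM; apply: (@cvgD R R); exact: (@cvgM R).
Qed.

Lemma ctoN f a : cto F f a -> cto F (fun s => - f s) (- a).
Proof. by move=> h e e0; apply: filterS (h e e0) => s; rewrite -opprD ncN. Qed.

Lemma ctoB f g a b : cto F f a -> cto F g b -> cto F (fun s => f s - g s) (a - b).
Proof. by move=> hf hg; apply: ctoD hf (ctoN hg). Qed.

Lemma ctoJ f a : cto F f a -> cto F (fun s => (f s)^*) a^*.
Proof. by move=> h e e0; apply: filterS (h e e0) => s; rewrite -conjcB ncJ. Qed.

Lemma cto_nc f a : cto F f a -> (fun s => normc (f s)) @ F --> normc a.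
Proof.
move=> h; apply/cvgrPdist_lt => e e0; apply: filterS (h e e0) => s.
by apply: le_lt_trans; rewrite ncdist; exact: nc_dist.
Qed.

Lemma cto_real (h : T -> R) (r : R) : h @ F --> r -> cto F (fun s => (h s)%:C) r%:C.
Proof. by move=> hh; apply/cto_ReIm; split => //=; exact: cvg_cst. Qed.

Lemma invcE (z : C) : z^-1 = (normc z ^- 2)%:C * z^*.
Proof.
have [->|u0] := eqVneq z 0; first by rewrite rmorph0 mulr0 invr0.
apply: (mulIf u0); rewrite mulVf // -mulrA [_^* * _]mulrC nc_mulJ -rmorphM mulVf //.
by rewrite expf_neq0 // nc_eq0.
Qed.

Lemma ctoV f a : a != 0 -> cto F f a -> cto F (fun s => (f s)^-1) a^-1.
Proof.
move=> a0 hf; have n0 : normc a ^+ 2 != 0 by rewrite expf_neq0 // nc_eq0.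
have hn : (fun s => normc (f s) ^- 2) @ F --> normc a ^- 2.
  by apply: cvgV => //; apply: (@cvgM R); exact: cto_nc.
rewrite invcE; apply: (@eq_cto (fun s => (normc (f s) ^- 2)%:C * (f s)^*)).
  by move=> s; rewrite invcE.
by apply: ctoM; [exact: cto_real|exact: ctoJ].
Qed.

Lemma ctoX f a n : cto F f a -> cto F (fun s => f s ^+ n) (a ^+ n).
Proof.
move=> hf; elim: n => [|n ih]; first by rewrite expr0; exact: cto_cst.
rewrite exprS; apply: (@eq_cto (fun s => f s * f s ^+ n)) => [s|]; first by rewrite exprS.
exact: ctoM.
Qed.

Lemma cto_prod (I : Type) (r : seq I) (f : I -> T -> C) (a : I -> C) :
  (forall i, cto F (f i) (a i)) -> cto F (fun s => \prod_(i <- r) f i s) (\prod_(i <- r) a i).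
Proof.
move=> h; elim: r => [|i r ih].
  by rewrite big_nil; apply: (@eq_cto (fun=> 1)) (cto_cst _) => s; rewrite big_nil.
rewrite big_cons; apply: (@eq_cto (fun s => f i s * \prod_(i <- r) f i s)) => [s|].
  by rewrite big_cons.
exact: ctoM.
Qed.

Lemma cto_squeeze f a (h : T -> R) : h @ F --> 0 -> (\forall s \near F, normc (f s - a) <= h s) ->
  cto F f a.
Proof.
move=> /cvgrPdist_lt hh fh e e0; apply: filterS2 (hh e e0) fh => s.
rewrite sub0r normrN => h1 h2; apply: le_lt_trans h1; exact: le_trans h2 (ler_norm _).
Qed.

End cto_theory.

Lemma cto_unique (R : realType) (T : Type) (F : set_system T) {FF : ProperFilter F}
  (f : T -> R[i]) a b : cto F f a -> cto F f b -> a = b.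
Proof.
move=> ha hb; apply/eqP; rewrite -subr_eq0 -nc_eq0; apply: contraT => n0.
have p : 0 < normc (a - b) / 2 by rewrite divr_gt0 // lt_neqAle eq_sym n0 nc_ge0.
have [s [h1 h2]] : exists s, normc (f s - a) < normc (a - b) / 2 /\ normc (f s - b) < normc (a - b) / 2.
  by apply: (@filter_ex _ F); apply: filterS2 (ha _ p) (hb _ p).
have h3 := nc_triangle a (f s) b; rewrite (ncdist a (f s)) in h3.
by move: (le_lt_trans h3 (ltrD h1 h2)); rewrite -splitr ltxx.
Qed.

Lemma cto_lim (R : realType) (T : Type) (F : set_system T) {FF : ProperFilter F}
  (f : T -> R[i]) a : cto F f a -> lim ((f : T -> R[i]^o) @ F) = a.
Proof. by move=> /ctoP h; apply/cvg_lim. Qed.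

Section ComplexDerivative.
Variable R : realType.
Notation C := R[i].

(** Clearing the denominator of the difference quotient: in this form
    differentiability composes with exponentials and passes through integrals by
    plain estimates. *)
Lemma derivableC (f : C -> C) (z : C) :
  derivable (f : C^o -> C^o) z 1 <->
  exists l : C, forall e : R, 0 < e -> exists2 d : R, 0 < d &
    forall h, normc h < d -> normc (f (z + h) - f z - l * h) <= e * normc h.
Proof.
split.
- move=> /cvg_ex [l /= hl]; exists l => e e0; move/cvgC: hl => /(_ e e0).
  rewrite near_withinE => /nbhsC[d d0 hd]; exists d => // h hh.
  have [->|h0] := eqVneq h 0; first by rewrite addr0 subrr mulr0 subrr nc0 mulr0.
  have := hd h; rewrite subr0 => /(_ hh h0) /ltW.
  rewrite /= [h *: _]mulr1 [h + z]addrC => hx.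
  have -> : f (z + h) - f z - l * h = (h^-1 *: ((f (z + h) - f z) : C^o) - l) * h.
    by rewrite mulrBl [_ *: _ ]mulrC mulfVK.
  by rewrite ncM ler_wpM2r // nc_ge0.
move=> [l hl]; apply/cvg_ex; exists l; apply/cvgC => e e0.
have e2 : 0 < e / 2 by rewrite divr_gt0.
have [d d0 hd] := hl _ e2; rewrite near_withinE; apply/nbhsC; exists d => // h.
rewrite subr0 => hh h0; rewrite /= [h *: _]mulr1 [h + z]addrC.
have := hd h hh; have -> : f (z + h) - f z - l * h = (h^-1 *: ((f (z + h) - f z) : C^o) - l) * h.
  by rewrite mulrBl [_ *: _ ]mulrC mulfVK.
rewrite ncM ler_pM2r ?nc_gt0 // => /le_lt_trans; apply.
by rewrite ltr_pdivrMr // ltr_pMr // ltr1n.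
Qed.

Lemma derive1C (f : C -> C) (z l : C) :
  (forall e : R, 0 < e -> exists2 d : R, 0 < d &
    forall h, normc h < d -> normc (f (z + h) - f z - l * h) <= e * normc h) ->
  derive1 (f : C^o -> C^o) z = l.
Proof.
move=> hl; apply/cvg_lim => //; apply/cvgC => e e0.
have e2 : 0 < e / 2 by rewrite divr_gt0.
have [d d0 hd] := hl _ e2; rewrite near_withinE; apply/nbhsC; exists d => // h.
rewrite subr0 => hh h0; rewrite /= [h + z]addrC.
have := hd h hh; have -> : f (z + h) - f z - l * h = (h^-1 *: ((f (z + h) - f z) : C^o) - l) * h.
  by rewrite mulrBl [_ *: _ ]mulrC mulfVK.
rewrite ncM ler_pM2r ?nc_gt0 // => /le_lt_trans; apply.
by rewrite ltr_pdivrMr // ltr_pMr // ltr1n.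
Qed.

End ComplexDerivative.

(** * Complex-valued integrals *)

Section ComplexIntegral.
Variable R : realType.
Notation C := R[i].
Notation mu := (@lebesgue_measure R).
Notation TR := (measurableTypeR R).

Definition cmeas (D : set TR) (u : TR -> C) : Prop :=
  measurable_fun D (fun t : TR => complex.Re (u t)) /\
  measurable_fun D (fun t : TR => complex.Im (u t)).

Definition cint (D : set TR) (u : TR -> C) : C :=
  Rintegral mu D (fun t : TR => complex.Re (u t)) +i*
  Rintegral mu D (fun t : TR => complex.Im (u t)).

Definition cintg (D : set TR) (u : TR -> C) : Prop :=
  mu.-integrable D (fun t : TR => (complex.Re (u t))%:E) /\
  mu.-integrable D (fun t : TR => (complex.Im (u t))%:E).

Section measurability.
Variable D : set TR.
Hypothesis mD : measurable D.
Implicit Types u v : TR -> C.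

Lemma eq_cmeas u v : (forall t, D t -> u t = v t) -> cmeas D u -> cmeas D v.
Proof.
move=> uv [h1 h2]; split.
  by apply: eq_measurable_fun h1 => t /set_mem Dt; rewrite uv.
by apply: eq_measurable_fun h2 => t /set_mem Dt; rewrite uv.
Qed.

Lemma cmeas_cst (c : C) : cmeas D (fun=> c).
Proof. by split; exact: measurable_cst. Qed.

Lemma cmeasD u v : cmeas D u -> cmeas D v -> cmeas D (fun t => u t + v t).
Proof.
move=> [a b] [c d]; split.
  by under eq_fun do rewrite ReD; exact: measurable_funD.
by under eq_fun do rewrite ImD; exact: measurable_funD.
Qed.

Lemma cmeasM u v : cmeas D u -> cmeas D v -> cmeas D (fun t => u t * v t).
Proof.
move=> [a b] [c d]; split.
  under eq_fun do rewrite ReM.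
  by apply: measurable_funB; exact: measurable_funM.
under eq_fun do rewrite ImM.
by apply: measurable_funD; exact: measurable_funM.
Qed.

Lemma cmeasN u : cmeas D u -> cmeas D (fun t => - u t).
Proof.
move=> hu; apply: (@eq_cmeas (fun t => (-1) * u t)); last exact: cmeasM (cmeas_cst _) hu.
by move=> t _; rewrite mulN1r.
Qed.

Lemma cmeasB u v : cmeas D u -> cmeas D v -> cmeas D (fun t => u t - v t).
Proof. by move=> hu hv; exact: cmeasD hu (cmeasN hv). Qed.

Lemma cmeasJ u : cmeas D u -> cmeas D (fun t => (u t)^*).
Proof.
move=> [a b]; split; first by under eq_fun do rewrite ReJ.
under eq_fun do rewrite ImJ; exact: measurableT_comp.
Qed.

Lemma cmeasX u n : cmeas D u -> cmeas D (fun t => u t ^+ n).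
Proof.
move=> hu; elim: n => [|n ih]; first by apply: eq_cmeas (cmeas_cst 1) => t _; rewrite expr0.
by apply: eq_cmeas (cmeasM hu ih) => t _; rewrite exprS.
Qed.

Lemma cmeas_real (f : TR -> R) : measurable_fun D f -> cmeas D (fun t => (f t)%:C).
Proof. by move=> hf; split => //=; exact: measurable_cst. Qed.

Lemma measurable_nc2 u : cmeas D u -> measurable_fun D (fun t : TR => normc (u t) ^+ 2).
Proof.
move=> [a b]; under eq_fun do rewrite nc_sqr.
by apply: measurable_funD; exact: measurable_funX.
Qed.

Lemma measurable_nc u : cmeas D u -> measurable_fun D (fun t : TR => normc (u t)).
Proof.
move=> hu; have -> : (fun t : TR => normc (u t)) = Num.sqrt \o (fun t : TR => normc (u t) ^+ 2).
  by apply/funext => t /=; rewrite sqrtr_sqr ger0_norm // nc_ge0.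
apply: (@measurableT_comp _ _ _ _ _ _ (Num.sqrt : R -> R)); last exact: measurable_nc2.
by apply: continuous_measurable_fun; exact: sqrt_continuous.
Qed.

Lemma measurable_invr : measurable_fun [set: R] (fun x : R => x^-1).
Proof.
have -> : [set: R] = [set x | x != 0] `|` [set 0].
  apply/seteqP; split => // x _; have [->|x0] := eqVneq x 0; [by right|by left].
have oo : open [set x : R | x != 0] by exact: open_neq.
apply/measurable_funU => //; first exact: open_measurable.
split; last exact: measurable_fun_set1.
apply: open_continuous_measurable_fun => // x.
by rewrite inE /= => x0; exact: inv_continuous.
Qed.

Lemma cmeasV u : cmeas D u -> cmeas D (fun t => (u t)^-1).
Proof.
move=> hu; apply: (@eq_cmeas (fun t => ((normc (u t) ^+ 2)^-1)%:C * (u t)^*)).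
  move=> t _; have [->|u0] := eqVneq (u t) 0; first by rewrite rmorph0 mulr0 invr0.
  apply: (mulIf u0); rewrite mulVf // -mulrA [_^* * _]mulrC nc_mulJ -rmorphM mulVf //.
  by rewrite expf_neq0 // nc_eq0.
apply: cmeasM; last exact: cmeasJ.
by apply: cmeas_real; apply: measurableT_comp measurable_invr _; exact: measurable_nc2.
Qed.

Lemma cmeas_prod (I : Type) (r : seq I) (F : I -> TR -> C) :
  (forall i, cmeas D (F i)) -> cmeas D (fun t => \prod_(i <- r) F i t).
Proof.
move=> hF; elim: r => [|i r ih].
  by apply: eq_cmeas (cmeas_cst 1) => t _; rewrite big_nil.
by apply: eq_cmeas (cmeasM (hF i) ih) => t _; rewrite big_cons.
Qed.

Lemma cmeas_continuous u : (forall t : R, cto (nbhs t) (u : R -> C) (u t)) -> cmeas D u.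
Proof.
move=> cu; split; apply: (@measurable_funS _ _ _ _ setT) => //;
  by apply: (continuous_measurable_fun (R := R)) => x; have /cto_ReIm[] := cu x.
Qed.

Lemma cmeas_lim (u_ : nat -> TR -> C) u : (forall n, cmeas D (u_ n)) ->
  (forall t, D t -> cto \oo (u_ ^~ t) (u t)) -> cmeas D u.
Proof.
move=> mu_ h; split.
- apply: (@measurable_fun_cvg _ TR R D (fun n t => complex.Re (u_ n t))).
    by move=> n; case: (mu_ n).
  by move=> t Dt; have /cto_ReIm[] := h t Dt.
- apply: (@measurable_fun_cvg _ TR R D (fun n t => complex.Im (u_ n t))).
    by move=> n; case: (mu_ n).
  by move=> t Dt; have /cto_ReIm[] := h t Dt.
Qed.

End measurability.

Section integration.
Variable D : set TR.
Hypothesis mD : measurable D.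
Implicit Types u v : TR -> C.

Lemma cintgP u : cintg D u <->
  cmeas D u /\ (\int[mu]_(t in D) (normc (u t))%:E < +oo)%E.
Proof.
split.
- move=> [iR iI]; have mu_ : cmeas D u.
    by split; apply/measurable_EFinP; [case/integrableP: iR|case/integrableP: iI].
  split => //.
  have /integrableP[_] := integrableD mD (integrable_abse iR) (integrable_abse iI).
  apply: le_lt_trans; apply: ge0_le_integral => //=.
  - by move=> t _; rewrite lee_fin nc_ge0.
  - by apply/measurable_EFinP; exact: measurable_nc.
  - apply/measurable_EFinP; apply: measurableT_comp => //.
    by apply: measurable_funD; apply: measurableT_comp => //; case: mu_.
  - by move=> t _; rewrite lee_fin ger0_norm ?addr_ge0 // nc_ReIm.
move=> [[mR mI] h]; have mn := measurable_nc (conj mR mI).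
have i0 : mu.-integrable D (fun t : TR => (normc (u t))%:E).
  apply/integrableP; split; first exact/measurable_EFinP.
  by under eq_integral do rewrite abse_EFin ger0_norm ?nc_ge0 //.
split; apply: (le_integrable mD _ _ i0); try exact/measurable_EFinP.
  by move=> t _; rewrite !abse_EFin lee_fin [leRHS]ger0_norm ?nc_ge0 ?Re_nc.
by move=> t _; rewrite !abse_EFin lee_fin [leRHS]ger0_norm ?nc_ge0 ?Im_nc.
Qed.

Lemma cintg_meas u : cintg D u -> cmeas D u.
Proof. by case/cintgP. Qed.

Lemma cintg_nc u : cintg D u -> mu.-integrable D (fun t : TR => (normc (u t))%:E).
Proof.
case/cintgP => m h; apply/integrableP; split; first by apply/measurable_EFinP; exact: measurable_nc.
by under eq_integral do rewrite abse_EFin ger0_norm ?nc_ge0 //.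
Qed.

Lemma cintg_le u (g : TR -> R) : cmeas D u -> mu.-integrable D (EFin \o g) ->
  (forall t, D t -> normc (u t) <= g t) -> cintg D u.
Proof.
move=> mu_ ig h; apply/cintgP; split => //.
have /integrableP[mg fg] := ig; apply: le_lt_trans fg; apply: ge0_le_integral => //=.
- by move=> t _; rewrite lee_fin nc_ge0.
- by apply/measurable_EFinP; exact: measurable_nc.
- by apply/measurable_EFinP; apply: measurableT_comp => //; exact/measurable_EFinP.
- by move=> t Dt; rewrite lee_fin (le_trans (h t Dt)) // ler_norm.
Qed.

Lemma cintgD u v : cintg D u -> cintg D v -> cintg D (fun t => u t + v t).
Proof.
move=> [a b] [c d]; split.
  by under eq_fun do rewrite ReD EFinD; exact: integrableD.
by under eq_fun do rewrite ImD EFinD; exact: integrableD.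
Qed.

Lemma cintD u v : cintg D u -> cintg D v ->
  cint D (fun t => u t + v t) = cint D u + cint D v.
Proof.
move=> [a b] [c d]; apply: eq_ReIm => /=.
  by under eq_Rintegral do rewrite ReD; rewrite RintegralD.
by under eq_Rintegral do rewrite ImD; rewrite RintegralD.
Qed.

Lemma cintgZ (k : C) u : cintg D u -> cintg D (fun t => k * u t).
Proof.
move=> [a b]; case: k => k l; split.
  under eq_fun do rewrite ReM /= EFinB !EFinM.
  by apply: integrableB => //; exact: integrableZl.
under eq_fun do rewrite ImM /= EFinD !EFinM.
by apply: integrableD => //; exact: integrableZl.
Qed.

Lemma integrableZlR (k : R) (f : TR -> R) : mu.-integrable D (EFin \o f) ->
  mu.-integrable D (EFin \o (fun t => k * f t)).
Proof. exact: integrableZl. Qed.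

Lemma cintZ (k : C) u : cintg D u -> cint D (fun t => k * u t) = k * cint D u.
Proof.
move=> [a b]; case: k => k l; apply: eq_ReIm.
  rewrite ReM /=; under eq_Rintegral do rewrite ReM /=.
  by rewrite RintegralB ?RintegralZl //; exact: integrableZlR.
rewrite ImM /=; under eq_Rintegral do rewrite ImM /=.
by rewrite RintegralD ?RintegralZl //; exact: integrableZlR.
Qed.

Lemma eq_cint u v : (forall t, D t -> u t = v t) -> cint D u = cint D v.
Proof.
by move=> uv; congr (_ +i* _); apply: eq_Rintegral => t /set_mem Dt; rewrite uv.
Qed.

Lemma eq_cintg u v : (forall t, D t -> u t = v t) -> cintg D u -> cintg D v.
Proof.
move=> uv [a b]; split.
  by apply: eq_integrable a => // t /set_mem Dt; rewrite uv.
by apply: eq_integrable b => // t /set_mem Dt; rewrite uv.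
Qed.

Lemma cintgN u : cintg D u -> cintg D (fun t => - u t).
Proof.
by move=> hu; apply: eq_cintg (cintgZ (-1) hu) => t _; rewrite mulN1r.
Qed.

Lemma cintN u : cintg D u -> cint D (fun t => - u t) = - cint D u.
Proof.
move=> hu; rewrite -mulN1r -cintZ //; apply: eq_cint => t _; by rewrite mulN1r.
Qed.

Lemma cintgB u v : cintg D u -> cintg D v -> cintg D (fun t => u t - v t).
Proof. by move=> hu hv; exact: cintgD hu (cintgN hv). Qed.

Lemma cintB u v : cintg D u -> cintg D v ->
  cint D (fun t => u t - v t) = cint D u - cint D v.
Proof. by move=> hu hv; rewrite cintD ?cintN //; exact: cintgN. Qed.

Lemma cintg0 : cintg D (fun=> 0).
Proof. by split; exact: integrable0. Qed.

Lemma cint0 : cint D (fun=> 0) = 0.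
Proof. by rewrite /cint /Rintegral !integral0. Qed.

Lemma cintg_sum (I : Type) (r : seq I) (F : I -> TR -> C) :
  (forall i, cintg D (F i)) -> cintg D (fun t => \sum_(i <- r) F i t).
Proof.
move=> hF; elim: r => [|i r ih].
  by apply: eq_cintg cintg0 => t _; rewrite big_nil.
by apply: eq_cintg (cintgD (hF i) ih) => t _; rewrite big_cons.
Qed.

Lemma cint_sum (I : Type) (r : seq I) (F : I -> TR -> C) :
  (forall i, cintg D (F i)) ->
  cint D (fun t => \sum_(i <- r) F i t) = \sum_(i <- r) cint D (F i).
Proof.
move=> hF; elim: r => [|i r ih].
  by rewrite big_nil (@eq_cint _ (fun=> 0)) ?cint0 // => t _; rewrite big_nil.
rewrite big_cons -ih -cintD //; last exact: cintg_sum.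
by apply: eq_cint => t _; rewrite big_cons.
Qed.

Lemma cint_cst (c : C) : (mu D < +oo)%E -> cint D (fun=> c) = c * (fine (mu D))%:C.
Proof.
move=> fD; case: c => a b; apply: eq_ReIm; rewrite ?ReM ?ImM /= Rintegral_cst // mulr0.
  by rewrite subr0.
by rewrite add0r.
Qed.

(** Rotating the integral to the positive real axis reduces the bound to the real
    part of the integrand. *)
Lemma nc_cint u : cintg D u ->
  normc (cint D u) <= Rintegral mu D (fun t : TR => normc (u t)).
Proof.
move=> hu; set I := cint D u.
have [->|I0] := eqVneq I 0; first by rewrite nc0 Rintegral_ge0 // => t _; exact: nc_ge0.
pose c := I^* / (normc I)%:C.
have nI : (normc I)%:C != 0 by rewrite -nc_eq0 ncR normr_eq0 nc_eq0.
have c1 : normc c = 1.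
  by rewrite ncM ncJ ncV ncR ger0_norm ?nc_ge0 // divff // nc_eq0.
have cI : c * I = (normc I)%:C.
  by rewrite /c mulrAC [I^* * I]mulrC nc_mulJ rmorphXn expr2 mulfK.
have : normc I = complex.Re (cint D (fun t => c * u t)) by rewrite cintZ // cI.
move=> ->; rewrite /=.
have [hi _] := cintgZ c hu.
apply: le_Rintegral => //; first exact: cintg_nc.
by move=> t _ /=; rewrite (le_trans (ler_norm _)) // (le_trans (Re_nc _)) // ncM c1 mul1r.
Qed.

Lemma cint_ae u v : cmeas D u -> cmeas D v ->
  {ae mu, forall t, D t -> u t = v t} -> cint D u = cint D v.
Proof.
move=> [a b] [c d] uv; congr (_ +i* _); congr fine; apply: ae_eq_integral => //;
  try exact/measurable_EFinP.
  by apply: filterS uv => t h Dt; rewrite h.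
by apply: filterS uv => t h Dt; rewrite h.
Qed.

End integration.
End ComplexIntegral.

(** * Square-integrable functions *)

Section L2.
Variable R : realType.
Notation C := R[i].
Notation mu := (@lebesgue_measure R).
Notation TR := (measurableTypeR R).
Notation I01 := (`[0%R, 1%R]%classic : set TR).
Implicit Types u v w : TR -> C.

Lemma mI01 : measurable I01.
Proof. exact: measurable_itv. Qed.

Lemma muI01 : mu I01 = 1%E.
Proof. by rewrite lebesgue_measure_itv /= lte_fin ltr01 oppr0 adde0. Qed.

Lemma muI01_fin : (mu I01 < +oo)%E.
Proof. by rewrite muI01 ltry. Qed.

Hint Resolve mI01 muI01_fin : core.

Lemma integrableDR (D : set TR) (f g : TR -> R) : measurable D ->
  mu.-integrable D (EFin \o f) -> mu.-integrable D (EFin \o g) ->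
  mu.-integrable D (EFin \o (fun t => f t + g t)).
Proof. by move=> mD hf hg; exact: (integrableD mD hf hg). Qed.

Lemma integrable_cst01 (M : R) : mu.-integrable I01 (EFin \o (fun=> M)).
Proof.
apply/integrableP; split; first exact: measurable_cst.
rewrite (_ : (fun x => _) = cst `|M|%:E) // integral_cst //=.
by rewrite [X in (_ * X < _)%E](_ : _ = 1%E) ?muI01 // mule1 ltry.
Qed.

Lemma cintg_bounded u (M : R) : cmeas I01 u -> (forall t, I01 t -> normc (u t) <= M) ->
  cintg I01 u.
Proof.
move=> mu_ h; apply: (@cintg_le _ _ mI01 u (fun=> M)) => //.
exact: integrable_cst01.
Qed.

Lemma cint_cst01 (c : C) : cint I01 (fun=> c) = c.
Proof. by rewrite cint_cst // muI01 /= mulr1. Qed.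

(** The square of the L^2 norm. *)
Definition n2 u : R := Rintegral mu I01 (fun t => normc (u t) ^+ 2).

Definition L2 u : Prop :=
  cmeas I01 u /\ (\int[mu]_(t in I01) (normc (u t) ^+ 2)%:E < +oo)%E.

Lemma L2_int u : L2 u -> mu.-integrable I01 (fun t => (normc (u t) ^+ 2)%:E).
Proof.
case=> m h; apply/integrableP; split; first by apply/measurable_EFinP; exact: measurable_nc2.
by under eq_integral do rewrite abse_EFin ger0_norm ?sqr_ge0 //.
Qed.

Lemma n2_ge0 u : 0 <= n2 u.
Proof. by apply: Rintegral_ge0 => t _; exact: sqr_ge0. Qed.

Lemma n2E u : L2 u -> ((n2 u)%:E = \int[mu]_(t in I01) (normc (u t) ^+ 2)%:E)%E.
Proof. by move=> /L2_int h; rewrite fineK // integrable_fin_num. Qed.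

Lemma L2_le u (g : TR -> R) : cmeas I01 u -> mu.-integrable I01 (EFin \o g) ->
  (forall t, I01 t -> normc (u t) ^+ 2 <= g t) -> L2 u.
Proof.
move=> m ig h; split => //; have /integrableP[mg] := ig; apply: le_lt_trans.
apply: ge0_le_integral => //=.
- by move=> t _; rewrite lee_fin sqr_ge0.
- by apply/measurable_EFinP; exact: measurable_nc2.
- by apply/measurable_EFinP; apply: measurableT_comp => //; exact/measurable_EFinP.
- by move=> t Dt; rewrite lee_fin (le_trans (h t Dt)) // ler_norm.
Qed.

Lemma L2_meas u : L2 u -> cmeas I01 u. Proof. by case. Qed.

Lemma eq_L2 u v : (forall t, I01 t -> u t = v t) -> L2 u -> L2 v.
Proof.
move=> uv [m h]; split; first exact: eq_cmeas m.
by rewrite (eq_integral (fun t => (normc (u t) ^+ 2)%:E)) // => t /set_mem It; rewrite uv.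
Qed.

Lemma eq_n2 u v : (forall t, I01 t -> u t = v t) -> n2 u = n2 v.
Proof. by move=> uv; apply: eq_Rintegral => t /set_mem It; rewrite uv. Qed.

Lemma L2D u v : L2 u -> L2 v -> L2 (fun t => u t + v t).
Proof.
move=> hu hv; apply: (@L2_le _ (fun t => 2 * (normc (u t) ^+ 2 + normc (v t) ^+ 2))).
- exact: cmeasD (L2_meas hu) (L2_meas hv).
- apply: (@integrableZlR _ _ _ 2) => //; apply: integrableDR => //; exact: L2_int.
- move=> t _; apply: (@le_trans _ _ ((normc (u t) + normc (v t)) ^+ 2)).
    by rewrite ler_pXn2r ?nnegrE ?addr_ge0 ?nc_ge0 // ncD.
  by have := sqr_ge0 (normc (u t) - normc (v t)); nra.
Qed.

Lemma n2D u v : L2 u -> L2 v -> n2 (fun t => u t + v t) <= 2 * (n2 u + n2 v).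
Proof.
move=> hu hv; rewrite /n2 -RintegralD //; try exact: L2_int.
rewrite -RintegralZl //; last first.
  by apply: integrableDR => //; exact: L2_int.
apply: le_Rintegral => //.
- exact: (L2_int (L2D hu hv)).
- apply: (@integrableZlR _ _ _ 2) => //; apply: integrableDR => //; exact: L2_int.
- move=> t _; apply: (@le_trans _ _ ((normc (u t) + normc (v t)) ^+ 2)).
    by rewrite ler_pXn2r ?nnegrE ?addr_ge0 ?nc_ge0 // ncD.
  by have := sqr_ge0 (normc (u t) - normc (v t)); nra.
Qed.

Lemma L2_bounded u (M : R) : cmeas I01 u -> (forall t, I01 t -> normc (u t) <= M) -> L2 u.
Proof.
move=> m h; apply: (@L2_le _ (fun=> M ^+ 2)) => //.
  exact: integrable_cst01.
move=> t It; rewrite ler_pXn2r ?nnegrE ?nc_ge0 // ?h //.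
exact: le_trans (nc_ge0 _) (h _ It).
Qed.

Lemma L2M_bounded u v (M : R) : cmeas I01 v -> (forall t, I01 t -> normc (v t) <= M) ->
  L2 u -> L2 (fun t => v t * u t) /\ n2 (fun t => v t * u t) <= M ^+ 2 * n2 u.
Proof.
move=> m h hu; have hle t : I01 t -> normc (v t * u t) ^+ 2 <= M ^+ 2 * normc (u t) ^+ 2.
  move=> It; rewrite ncM exprMn ler_wpM2r ?sqr_ge0 // ler_pXn2r ?nnegrE ?nc_ge0 // ?h //.
  exact: le_trans (nc_ge0 _) (h _ It).
have hi := @integrableZlR R I01 mI01 (M ^+ 2) _ (L2_int hu).
have hL : L2 (fun t => v t * u t).
  by apply: (L2_le _ hi) => //; apply: cmeasM => //; exact: L2_meas.
split => //; rewrite /n2 -RintegralZl //; last exact: L2_int.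
by apply: le_Rintegral => //; exact: L2_int.
Qed.

Lemma L2Z (c : C) u : L2 u -> L2 (fun t => c * u t).
Proof.
by move=> hu; apply: (L2M_bounded (M := normc c) _ _ hu).1 => //; exact: cmeas_cst.
Qed.

Lemma L2N u : L2 u -> L2 (fun t => - u t).
Proof. by move=> hu; apply: eq_L2 (L2Z (-1) hu) => t _; rewrite mulN1r. Qed.

Lemma L2B u v : L2 u -> L2 v -> L2 (fun t => u t - v t).
Proof. by move=> hu hv; exact: L2D hu (L2N hv). Qed.

Lemma L2J u : L2 u -> L2 (fun t => (u t)^*).
Proof.
case=> m h; split; first exact: cmeasJ.
by under eq_integral do rewrite ncJ.
Qed.

Lemma n2J u : n2 (fun t => (u t)^*) = n2 u.
Proof. by apply: eq_Rintegral => t _; rewrite ncJ. Qed.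

Lemma L2_sum (I : Type) (r : seq I) (F : I -> TR -> C) :
  (forall i, L2 (F i)) -> L2 (fun t => \sum_(i <- r) F i t).
Proof.
move=> hF; elim: r => [|i r ih].
  apply: (@eq_L2 (fun=> 0)) => [t _|]; first by rewrite big_nil.
  by apply: (@L2_bounded _ 0) => [|t _]; [exact: cmeas_cst|rewrite nc0].
by apply: eq_L2 (L2D (hF i) ih) => t _; rewrite big_cons.
Qed.

Lemma L2_cintgM u v : L2 u -> L2 v -> cintg I01 (fun t => u t * v t).
Proof.
move=> hu hv; apply: (@cintg_le _ _ mI01 _ (fun t => normc (u t) ^+ 2 + normc (v t) ^+ 2)).
- exact: cmeasM (L2_meas hu) (L2_meas hv).
- by apply: integrableDR => //; exact: L2_int.
- move=> t _; rewrite ncM; have := sqr_ge0 (normc (u t) - normc (v t)).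
  by have := nc_ge0 (u t); have := nc_ge0 (v t); nra.
Qed.

Lemma L2_cintg u : L2 u -> cintg I01 u.
Proof.
move=> hu; apply: (eq_cintg mI01 (u := fun t => 1 * u t)) => [t _|]; first by rewrite mul1r.
apply: L2_cintgM => //; apply: (@L2_bounded _ 1) => [|t _]; first exact: cmeas_cst.
by rewrite nc1.
Qed.

Lemma n2_cst1 : n2 (fun=> 1) = 1.
Proof.
have /(congr1 (@complex.Re R)) /= e := cint_cst01 1; rewrite /n2 -[RHS]e.
by apply: eq_Rintegral => t _; rewrite nc1 expr1n.
Qed.

(** The weighted inequality |u v| <= (l |u|^2 + |v|^2 / l) / 2, integrated. The
    free weight l replaces the normalization in the usual proof of Cauchy-Schwarz
    and survives addition of several such bounds. *)
Lemma L1_young u v (l : R) : 0 < l -> L2 u -> L2 v ->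
  Rintegral mu I01 (fun t => normc (u t * v t)) <= (l * n2 u + l^-1 * n2 v) / 2.
Proof.
move=> l0 hu hv; pose g := fun t : TR => 2^-1 * (l * normc (u t) ^+ 2 + l^-1 * normc (v t) ^+ 2).
have h1 := @integrableZlR R I01 mI01 l _ (L2_int hu).
have h2 := @integrableZlR R I01 mI01 l^-1 _ (L2_int hv).
have h3 : mu.-integrable I01 (EFin \o (fun t => l * normc (u t) ^+ 2 + l^-1 * normc (v t) ^+ 2)).
  exact: integrableDR.
have ig : mu.-integrable I01 (EFin \o g) by exact: (@integrableZlR _ _ _ 2^-1).
apply: (@le_trans _ _ (Rintegral mu I01 g)).
  apply: le_Rintegral => //; first exact: cintg_nc (L2_cintgM hu hv).
  move=> t _; rewrite ncM /g; set a := normc (u t); set b := normc (v t).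
  have h := sqr_ge0 (l * a - b).
  have -> : l * a ^+ 2 + l^-1 * b ^+ 2 = l^-1 * ((l * a) ^+ 2 + b ^+ 2) by field; rewrite gt_eqF.
  have -> : a * b = l^-1 * (l * a * b) by field; rewrite gt_eqF.
  rewrite [leRHS]mulrCA ler_wpM2l ?invr_ge0 ?(ltW l0) //; nra.
by rewrite /g RintegralZl // RintegralD // !RintegralZl //; 
  [rewrite mulrC | exact: L2_int | exact: L2_int].
Qed.

(** Optimizing the weight, at l = N / A when A is nonzero. *)
Lemma sqr_le_mul (N A B : R) : 0 <= N -> 0 <= A -> 0 <= B ->
  (forall l, 0 < l -> N <= (l * A + l^-1 * B) / 2) -> N ^+ 2 <= A * B.
Proof.
move=> N0 A0 B0 h; have [->|N1] := eqVneq N 0; first by rewrite expr0n /= mulr_ge0.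
have Np : 0 < N by rewrite lt_neqAle eq_sym N1.
have [AE|A1] := eqVneq A 0.
  have := h ((B + 1) / N); rewrite divr_gt0 //; last by lra.
  move=> /(_ isT); rewrite AE mulr0 add0r invf_div => hN.
  have : N * (B / (B + 1)) <= N * 1.
    by rewrite ler_pM2l // ler_pdivrMr ?mul1r; lra.
  rewrite mulr1 => h2; exfalso.
  have : N / (B + 1) * B = N * (B / (B + 1)) by field; rewrite gt_eqF //; lra.
  lra.
have Ap : 0 < A by rewrite lt_neqAle eq_sym A1.
have := h (N / A) (divr_gt0 Np Ap); rewrite invf_div.
rewrite (_ : N / A * A = N); last by rewrite mulfVK.
rewrite -(ler_pM2r Np) => h2.
have : (N + A / N * B) / 2 * N = (N ^+ 2 + A * B) / 2 by field.
nra.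
Qed.

Lemma L1_le_n2 u : L2 u -> Rintegral mu I01 (fun t => normc (u t)) ^+ 2 <= n2 u.
Proof.
move=> hu; have h1 : L2 (fun=> 1).
  by apply: (@L2_bounded _ 1) => [|t _]; [exact: cmeas_cst|rewrite nc1].
have e : n2 u = n2 u * n2 (fun=> 1) by rewrite n2_cst1 mulr1.
rewrite [leRHS]e; apply: sqr_le_mul; rewrite ?n2_ge0 //.
  by apply: Rintegral_ge0 => t _; exact: nc_ge0.
move=> l l0; apply: le_trans (L1_young l0 hu h1).
by rewrite le_eqVlt; apply/orP; left; apply/eqP; apply: eq_Rintegral => t _; rewrite mulr1.
Qed.

Lemma L2_ae u v : cmeas I01 v -> {ae mu, forall t, I01 t -> u t = v t} -> L2 u -> L2 v /\ n2 u = n2 v.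
Proof.
move=> mv uv [m h].
have e : (\int[mu]_(t in I01) (normc (u t) ^+ 2)%:E = \int[mu]_(t in I01) (normc (v t) ^+ 2)%:E)%E.
  apply: ae_eq_integral => //; try (apply/measurable_EFinP; exact: measurable_nc2).
  by apply: filterS uv => t ht It; rewrite ht.
by split; [split => //; rewrite -e|rewrite /n2 /Rintegral e].
Qed.

End L2.
Arguments mI01 {R}.
Arguments muI01_fin {R}.
#[global] Hint Resolve mI01 muI01_fin : core.

(** * The Riesz-Fischer theorem *)

Section RieszFischer.
Variable R : realType.
Notation C := R[i].
Notation mu := (@lebesgue_measure R).
Notation TR := (measurableTypeR R).
Notation I01 := (`[0%R, 1%R]%classic : set TR).

Lemma nneseries_fin_cvg (x : nat -> R) : (forall n, 0 <= x n) ->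
  (\sum_(0 <= n <oo) (x n)%:E < +oo)%E -> cvgn (series x).
Proof.
move=> x0 fx; apply: nondecreasing_is_cvgn.
  by apply/nondecreasing_seqP => n; rewrite /series /= big_nat_recr //= lerDl.
exists (fine (\sum_(0 <= n <oo) (x n)%:E)%E) => _ [n _ <-].
have f0 : (0 <= \sum_(0 <= n <oo) (x n)%:E)%E by apply: nneseries_ge0 => k _ _; rewrite lee_fin.
rewrite -lee_fin fineK ?ge0_fin_numE // /series /= -sumEFin.
by apply: nneseries_lim_ge => k _ _; rewrite lee_fin.
Qed.

Lemma nneseries_le_bound (x : nat -> \bar R) (M : \bar R) : (forall n, 0 <= x n)%E ->
  (forall n, \sum_(0 <= i < n) x i <= M)%E -> (\sum_(0 <= n <oo) x n <= M)%E.
Proof.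
move=> x0 h; apply: lime_le; first by apply: is_cvg_nneseries => n _ _.
by near=> n; exact: h.
Unshelve. all: by end_near. Qed.

Lemma cvg_ReIm_series (d : nat -> C) : cvgn (series (fun n => normc (d n))) ->
  exists l : C, cto \oo (series d) l.
Proof.
move=> h; have aux (f : C -> R) : (forall z, `|f z| <= normc z) ->
    cvgn (series (fun n => f (d n))).
  move=> fz; apply: normed_cvg; apply: (series_le_cvg _ _ _ h) => n //=.
  exact: nc_ge0.
have hR := aux _ (@Re_nc R); have hI := aux _ (@Im_nc R).
have sR n : complex.Re (series d n) = series (fun n => complex.Re (d n)) n.
  rewrite /series /=; elim: n => [|n ih]; first by rewrite !big_geq.
  by rewrite !big_nat_recr //= ReD ih.
have sI n : complex.Im (series d n) = series (fun n => complex.Im (d n)) n.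
  rewrite /series /=; elim: n => [|n ih]; first by rewrite !big_geq.
  by rewrite !big_nat_recr //= ImD ih.
exists (limn (series (fun n => complex.Re (d n))) +i* limn (series (fun n => complex.Im (d n)))).
apply/cto_ReIm; split => /=.
  by under eq_cvg do rewrite sR.
by under eq_cvg do rewrite sI.
Qed.

Lemma limn_einf_le (x : nat -> \bar R) (M : \bar R) N :
  (forall n, (N <= n)%N -> (x n <= M)%E) -> (limn_einf x <= M)%E.
Proof.
move=> h; rewrite limn_einf_lim; apply: lime_le; first exact: is_cvg_einfs.
near=> k; apply: (@le_trans _ _ (x k)).
  by apply: ereal_inf_lbound; exists k => //=.
by apply: h; near: k; exact: nbhs_infty_ge.
Unshelve. all: by end_near. Qed.

(** Along a subsequence whose increments have squared norm at most 4^-k, the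
    increments are summable in L^1, hence the functions converge almost everywhere;
    Fatou's lemma carries the bounds [e m] over to the limit. *)
Lemma riesz_fischer (S : nat -> TR -> C) (e : nat -> R) :
  (forall n, L2 (S n)) ->
  (forall m n, (m <= n)%N -> n2 (fun t => S n t - S m t) <= e m) ->
  e @ \oo --> 0 ->
  exists2 u : TR -> C, L2 u & forall m, n2 (fun t => u t - S m t) <= e m.
Proof.
move=> hS hSe e0.
have /choice[N hN] : forall k, exists N, forall n, (N <= n)%N -> e n <= 4^-1 ^+ k.
  move=> k; have p0 : 0 < 4^-1 ^+ k :> R by rewrite exprn_gt0.
  have /cvgrPdist_lt/(_ _ p0)[N _ hN] := e0.
  exists N => n /hN; rewrite sub0r normrN => /ltW; apply: le_trans; exact: ler_norm.
(* strictly increasing and beyond every threshold N k *)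
pose n_ k := (k + \sum_(j < k.+1) N j)%N.
have n_lt k : (n_ k < n_ k.+1)%N.
  by rewrite /n_ -addSn leq_add2l [leqRHS]big_ord_recr /= leq_addr.
have n_mono k : (n_ k <= n_ k.+1)%N by exact: ltnW.
have n_ge k : (N k <= n_ k)%N by rewrite /n_ big_ord_recr /= addnA leq_addl.
pose d k t := S (n_ k.+1) t - S (n_ k) t.
have hd k : L2 (d k) by exact: L2B.
have d1 k : Rintegral mu I01 (fun t => normc (d k t)) <= 2^-1 ^+ k.
  have h : Rintegral mu I01 (fun t => normc (d k t)) ^+ 2 <= (2^-1 ^+ k) ^+ 2.
    apply: le_trans (L1_le_n2 (hd k)) _; apply: le_trans (hSe _ _ (n_mono k)) _.
    apply: le_trans (hN _ _ (n_ge k)) _.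
    by rewrite -exprM mulnC exprM expr2 -invfM -natrM.
  move: h; rewrite ler_pXn2r ?nnegrE ?exprn_ge0 //.
  by apply: Rintegral_ge0 => t _; exact: nc_ge0.
pose g (t : TR) := (\sum_(0 <= k <oo) (normc (d k t))%:E)%E.
have mdE k : measurable_fun I01 (fun t => (normc (d k t))%:E).
  by apply/measurable_EFinP; apply: measurable_nc => //; exact: L2_meas.
have gE : (\int[mu]_(t in I01) g t <= 2%:E)%E.
  rewrite /g integral_nneseries //; last by move=> n t _; rewrite lee_fin nc_ge0.
  apply: nneseries_le_bound => [n|n]; first by apply: integral_ge0 => t _; rewrite lee_fin nc_ge0.
  have bE k : (\int[mu]_(t in I01) (normc (d k t))%:E <= (2^-1 ^+ k)%:E)%E.
    rewrite -[leLHS]fineK ?lee_fin ?d1 //.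
    by apply: integrable_fin_num => //; exact: cintg_nc (L2_cintg (hd k)).
  apply: (@le_trans _ _ (\sum_(0 <= i < n) (2^-1 ^+ i)%:E)%E); first by apply: lee_sum => i _.
  rewrite sumEFin lee_fin.
  have -> : \sum_(0 <= i < n) 2^-1 ^+ i = 2 - 2 * 2^-1 ^+ n :> R.
    elim: n => [|n ih]; first by rewrite big_geq // expr0 mulr1 subrr.
    by rewrite big_nat_recr //= ih exprS; field.
  by rewrite gerBl mulr_ge0 // exprn_ge0.
have mg : measurable_fun I01 g.
  apply: ge0_emeasurable_sum => //; by move=> k t _ _; rewrite lee_fin nc_ge0.
have g0 t : (0 <= g t)%E by apply: nneseries_ge0 => k _ _; rewrite lee_fin nc_ge0.
have ig : mu.-integrable I01 g.
  apply/integrableP; split => //; under eq_integral do rewrite gee0_abs //.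
  by apply: le_lt_trans gE _; exact: ltry.
pose A := I01 `&` [set t | g t \is a fin_num].
have mA : measurable A by exact: emeasurable_fin_num.
(* replacing the functions by 0 off the convergence set makes the limit exist
   everywhere and measurable *)
pose T k (t : TR) : C := (\1_A t)%:C * S (n_ k) t.
have mT k : cmeas I01 (T k).
  apply: cmeasM => //; last exact: L2_meas.
  by apply: cmeas_real; exact: measurable_indic.
have aeA : {ae mu, forall t, I01 t -> A t}.
  have := integrable_ae mI01 ig; apply: filterS => t h It; split => //; exact: h.
have aeT k : {ae mu, forall t, I01 t -> T k t = S (n_ k) t}.
  by apply: filterS aeA => t h It; rewrite /T indicE mem_set ?mul1r //; exact: h.
have /choice[u hu] : forall t, exists l : C, cto \oo (T ^~ t) l.
  move=> t; have [At|nAt] := pselect (A t); last first.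
    exists 0; rewrite (_ : T^~ t = fun=> 0); first exact: cto_cst.
    by apply/funext => k; rewrite /T indicE memNset // mul0r.
  have [l hl] : exists l : C, cto \oo (series (fun k => d k t)) l.
    apply: cvg_ReIm_series; apply: nneseries_fin_cvg => [n|]; first exact: nc_ge0.
    by case: At => _ /=; rewrite ge0_fin_numE.
  exists (S (n_ 0) t + l).
  have -> : T^~ t = (fun k => S (n_ 0) t + series (fun k => d k t) k).
    apply/funext => k; rewrite /T indicE mem_set // mul1r.
    rewrite /series /=; elim: k => [|k ih]; first by rewrite big_geq // addr0.
    by rewrite big_nat_recr //= addrA -ih /d subrKC.
  by apply: ctoD => //; exact: cto_cst.
have mu_ : cmeas I01 u by apply: (@cmeas_lim _ _ T) => // t _; exact: hu.
have fat m : (\int[mu]_(t in I01) (normc (u t - S m t) ^+ 2)%:E <= (e m)%:E)%E.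
  have mf k : measurable_fun I01 (fun t => (normc (T k t - S m t) ^+ 2)%:E).
    by apply/measurable_EFinP; apply: measurable_nc2; apply: cmeasB => //; exact: L2_meas.
  have f0 k t : I01 t -> (0 <= (normc (T k t - S m t) ^+ 2)%:E)%E by rewrite lee_fin sqr_ge0.
  have := fatou mu mI01 mf f0.
  rewrite (eq_integral (fun t => (normc (u t - S m t) ^+ 2)%:E)); last first.
    move=> t _; apply: (cvg_limn_einf_sup _).1; apply/fine_cvgP; split; first by near=> k.
    rewrite /=; have h : (fun k => normc (T k t - S m t)) @ \oo --> normc (u t - S m t).
      by apply: cto_nc; apply: ctoB; [exact: hu|exact: cto_cst].
    by apply: cvgM; exact: h.
  move=> h; apply: le_trans h _; apply: (@limn_einf_le _ _ m) => k mk.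
  have mnk : (m <= n_ k)%N.
    exact: leq_trans mk (leq_addr _ _).
  have aek : {ae mu, forall t, I01 t -> S (n_ k) t - S m t = T k t - S m t}.
    by apply: filterS (aeT k) => t ht It; rewrite ht.
  have [hL hn] := L2_ae (cmeasB (mT k) (L2_meas (hS m))) aek (L2B (hS _) (hS _)).
  by rewrite -(n2E hL) lee_fin -hn; exact: hSe.
have hu2 : L2 u.
  have h0 : L2 (fun t => u t - S 0 t).
    split; first by apply: cmeasB => //; exact: L2_meas.
    by apply: le_lt_trans (fat 0) _; exact: ltry.
  by apply: eq_L2 (L2D h0 (hS 0)) => t _; rewrite subrK.
exists u => // m; rewrite -lee_fin n2E; [exact: fat|exact: L2B].
Unshelve. all: by end_near. Qed.

End RieszFischer.

(** * Goursat's theorem on rectangles *)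

Section Goursat.
Variable R : realType.
Notation C := R[i].
Notation mu := (@lebesgue_measure R).
Notation TR := (measurableTypeR R).
Notation seg a b := (`[a, b]%classic : set TR).

Lemma mseg (a b : R) : measurable (seg a b).
Proof. exact: measurable_itv. Qed.

Lemma mu_seg (a b : R) : a <= b -> mu (seg a b) = (b - a)%:E.
Proof.
move=> ab; rewrite lebesgue_measure_itv /= lte_fin.
have [//|ba] := ltP a b; have -> : a = b by apply/eqP; rewrite eq_le ab ba.
by rewrite subrr.
Qed.

Lemma cintg_cont (a b : R) (u : TR -> C) :
  (forall t : R, a <= t <= b -> cto (nbhs t) (u : R -> C) (u t)) -> cintg (seg a b) u.
Proof.
have h (f : C -> R) : (forall z w, `|f z - f w| <= normc (z - w)) ->
    (forall t : R, a <= t <= b -> cto (nbhs t) (u : R -> C) (u t)) ->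
    mu.-integrable (seg a b) (EFin \o (fun t => f (u t))).
  move=> hf hu; apply: continuous_compact_integrable; first exact: segment_compact.
  apply: continuous_in_subspaceT => t; rewrite inE /= in_itv /= => tab.
  apply/cvgrPdist_lt => e e0; apply: filterS (hu t tab e e0) => s.
  by apply: le_lt_trans; rewrite ncdist; exact: hf.
move=> hu; split; apply: h => // z w.
  by rewrite -ReN -ReD; exact: Re_nc.
by rewrite -ImN -ImD; exact: Im_nc.
Qed.

Lemma nc_cint_le (D : set TR) (u : TR -> C) (K w : R) : measurable D -> mu D = w%:E ->
  cintg D u -> (forall t, D t -> normc (u t) <= K) -> normc (cint D u) <= K * w.
Proof.
move=> mD muD hu hK; apply: le_trans (nc_cint mD hu) _.
have -> : K * w = Rintegral mu D (fun=> K).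
  have h := congr1 fine muD; rewrite Rintegral_cst //; congr (K * _); exact: esym h.
apply: le_Rintegral => //; first exact: cintg_nc.
apply/integrableP; split; first exact: measurable_cst.
by rewrite (_ : (fun x => _) = cst `|K|%:E) // integral_cst //= muD -EFinM ltry.
Qed.

Lemma cint_split (a m b : R) (u : TR -> C) : a <= m <= b -> cintg (seg a b) u ->
  cint (seg a b) u = cint (seg a m) u + cint (seg m b) u.
Proof.
move=> /andP[am mb] [hR hI].
have aux (f : TR -> R) : mu.-integrable (seg a b) (EFin \o f) ->
    Rintegral mu (seg a b) f = Rintegral mu (seg a m) f + Rintegral mu (seg m b) f.
  move=> hf; have := @Rintegral_itvB R f (BLeft a) (BRight b) m hf.
  rewrite !bnd_simp => /(_ am mb) h.
  have h2 : Rintegral mu [set` Interval (BRight m) (BRight b)] f = Rintegral mu (seg m b) f.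
    apply: Rintegral_itv_obnd_cbnd; apply: integrableS hf => //.
    by apply: subset_itvr; rewrite bnd_simp.
  by rewrite -h2 -h addrC subrK.
by apply: eq_ReIm; rewrite ?ReD ?ImD /=; exact: aux.
Qed.

(** The function k is complex differentiable in the variable s + q t. For q = 2 pi
    i and k(s, t) = H(e^s circ t) this is holomorphy of H in logarithmic polar
    coordinates. *)
Variables (q : C) (k : R -> R -> C) (U : R -> Prop).
Hypothesis kD : forall s t, U s -> exists l : C, forall e : R, 0 < e -> exists2 d : R, 0 < d &
  forall s' t', `|s' - s| < d -> `|t' - t| < d ->
    normc (k s' t' - k s t - l * ((s' - s)%:C + q * (t' - t)%:C)) <= e * (`|s' - s| + `|t' - t|).

Lemma kcont1 s t : U s -> cto (nbhs s) (k ^~ t) (k s t).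
Proof.
move=> Us e e0; have [l /(_ 1 ltr01)[d d0 hd]] := kD t Us.
pose K := 1 + normc l.
have K0 : 0 < K by rewrite ltr_pwDl // nc_ge0.
exists (Num.min d (e / K)) => /=; first by rewrite lt_min d0 divr_gt0.
move=> s' /=; rewrite distrC lt_min => /andP[h1 h2].
have := hd s' t h1; rewrite subrr normr0 => /(_ d0) h3.
rewrite mul1r !addr0 mulr0 addr0 in h3.
have -> : k s' t - k s t = (k s' t - k s t - l * (s' - s)%:C) + l * (s' - s)%:C by rewrite subrK.
apply: le_lt_trans (ncD _ _) _; rewrite ncM ncR.
apply: (@le_lt_trans _ _ (K * `|s' - s|)); first by rewrite /K mulrDl mul1r lerD2r.
by rewrite mulrC -ltr_pdivlMr.
Qed.

Lemma kcont2 s t : U s -> cto (nbhs t) (k s) (k s t).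
Proof.
move=> Us e e0; have [l /(_ 1 ltr01)[d d0 hd]] := kD t Us.
pose K := 1 + normc l * normc q.
have K0 : 0 < K by rewrite ltr_pwDl // mulr_ge0 ?nc_ge0.
exists (Num.min d (e / K)) => /=; first by rewrite lt_min d0 divr_gt0.
move=> t' /=; rewrite distrC lt_min => /andP[h1 h2].
have := hd s t'; rewrite subrr normr0 => /(_ d0 h1) h3.
rewrite mul1r !add0r in h3.
have -> : k s t' - k s t = (k s t' - k s t - l * (q * (t' - t)%:C)) + l * (q * (t' - t)%:C) by rewrite subrK.
apply: le_lt_trans (ncD _ _) _; rewrite [X in _ + X]ncM [X in _ + _ * X]ncM ncR (mulrA (normc l)).
apply: (@le_lt_trans _ _ (K * `|t' - t|)); first by rewrite /K mulrDl mul1r lerD2r.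
by rewrite mulrC -ltr_pdivlMr.
Qed.

(** The integral of k d(s + q t) along the boundary of the rectangle [a, b] x [c,
    d]. *)
Definition bdry (a b c d : R) : C :=
  cint (seg a b) (fun s => k s c - k s d) + q * cint (seg c d) (fun t => k b t - k a t).

Lemma cintg_k1 a b c d : (forall s, a <= s <= b -> U s) ->
  cintg (seg a b) (fun s => k s c - k s d).
Proof.
by move=> hU; apply: cintg_cont => s /hU Us; apply: ctoB; exact: kcont1.
Qed.

Lemma cintg_k2 a b c d : U a -> U b -> cintg (seg c d) (fun t => k b t - k a t).
Proof. by move=> Ua Ub; apply: cintg_cont => t _; apply: ctoB; exact: kcont2. Qed.

Lemma bdry_splitx a m b c d : a <= m <= b -> (forall s, a <= s <= b -> U s) ->
  bdry a b c d = bdry a m c d + bdry m b c d.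
Proof.
move=> amb hU; have /andP[am mb] := amb; rewrite /bdry (cint_split amb); last exact: cintg_k1.
have Ua : U a by apply: hU; rewrite lexx (le_trans am).
have Um : U m by apply: hU; rewrite am.
have Ub : U b by apply: hU; rewrite lexx andbT (le_trans am).
have -> : cint (seg c d) (fun t => k b t - k a t) =
    cint (seg c d) (fun t => k m t - k a t) + cint (seg c d) (fun t => k b t - k m t).
  rewrite -cintD //; try exact: cintg_k2.
  by apply: eq_cint => t _; ring.
by ring.
Qed.

Lemma bdry_splity a b c m d : c <= m <= d -> a <= b -> (forall s, a <= s <= b -> U s) ->
  bdry a b c d = bdry a b c m + bdry a b m d.
Proof.
move=> cmd ab hU; have Ua : U a by apply: hU; rewrite lexx.
have Ub : U b by apply: hU; rewrite lexx andbT.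
rewrite /bdry (cint_split cmd); last exact: cintg_k2.
have -> : cint (seg a b) (fun t => k t c - k t d) =
    cint (seg a b) (fun t => k t c - k t m) + cint (seg a b) (fun t => k t m - k t d).
  rewrite -cintD //; try exact: cintg_k1.
  by apply: eq_cint => t _; ring.
by ring.
Qed.

(** An affine function of s + q t has boundary integral zero, so only the error of
    the first-order expansion at (p, r) contributes. *)
Lemma bdry_local (p r e d : R) (l : C) (a c w h : R) : U p -> 0 < e -> 0 <= w -> 0 <= h ->
  (forall s, a <= s <= a + w -> U s) ->
  (forall s' t', `|s' - p| < d -> `|t' - r| < d ->
    normc (k s' t' - k p r - l * ((s' - p)%:C + q * (t' - r)%:C)) <= e * (`|s' - p| + `|t' - r|)) ->
  a <= p <= a + w -> c <= r <= c + h -> w < d -> h < d ->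
  normc (bdry a (a + w) c (c + h)) <= 2 * e * (w + h) * (w + normc q * h).
Proof.
move=> Up e0 w0 h0 hU hd /andP[ap pb] /andP[cr rd] wd hhd.
pose er s t := k s t - k p r - l * ((s - p)%:C + q * (t - r)%:C).
have her s t : a <= s <= a + w -> c <= t <= c + h -> normc (er s t) <= e * (w + h).
  move=> /andP[s1 s2] /andP[t1 t2].
  have a1 : `|s - p| <= w by rewrite ler_norml; apply/andP; split; lra.
  have a2 : `|t - r| <= h by rewrite ler_norml; apply/andP; split; lra.
  apply: le_trans (hd _ _ (le_lt_trans a1 wd) (le_lt_trans a2 hhd)) _.
  by rewrite ler_pM2l // lerD.
have Ua : U a by apply: hU; rewrite lexx lerDl.
have Ub : U (a + w) by apply: hU; rewrite lexx lerDl w0.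
have i1 := @cintg_k1 a (a + w) c (c + h) hU.
have i2 := @cintg_k2 a (a + w) c (c + h) Ua Ub.
pose c1 : C := - (l * q * h%:C); pose c2 : C := l * w%:C.
have icst a' b' (z : C) : cintg (seg a' b') (fun=> z).
  by apply: cintg_cont => t _; exact: cto_cst.
have B1 : normc (cint (seg a (a + w)) (fun s => (k s c - k s (c + h)) - c1)) <= 2 * e * (w + h) * w.
  apply: nc_cint_le => //.
  - by rewrite mu_seg ?lerDl //; congr EFin; ring.
  - exact: cintgB.
  - move=> s /=; rewrite in_itv /= => sab.
    have -> : k s c - k s (c + h) - c1 = er s c - er s (c + h).
      rewrite /er /c1 !rmorphB rmorphD /=; ring.
    apply: le_trans (ncB _ _) _; rewrite -mulrA mulr_natl mulr2n.
    by apply: lerD; apply: her => //; rewrite ?lexx ?lerDl ?h0.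
have B2 : normc (cint (seg c (c + h)) (fun t => (k (a + w) t - k a t) - c2)) <= 2 * e * (w + h) * h.
  apply: nc_cint_le => //.
  - by rewrite mu_seg ?lerDl //; congr EFin; ring.
  - exact: cintgB.
  - move=> t /=; rewrite in_itv /= => tcd.
    have -> : k (a + w) t - k a t - c2 = er (a + w) t - er a t.
      rewrite /er /c2 !rmorphB rmorphD /=; ring.
    apply: le_trans (ncB _ _) _; rewrite -mulrA mulr_natl mulr2n.
    by apply: lerD; apply: her => //; rewrite ?lexx ?lerDl ?w0.
have E1 : cint (seg a (a + w)) (fun s => k s c - k s (c + h)) =
    cint (seg a (a + w)) (fun s => (k s c - k s (c + h)) - c1) + c1 * w%:C.
  rewrite (cintB (mseg _ _) i1 (icst _ _ c1)) cint_cst // mu_seg ?lerDl ?ltry //=.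
  by rewrite (_ : a + w - a = w) ?subrK //; ring.
have E2 : cint (seg c (c + h)) (fun t => k (a + w) t - k a t) =
    cint (seg c (c + h)) (fun t => (k (a + w) t - k a t) - c2) + c2 * h%:C.
  rewrite (cintB (mseg _ _) i2 (icst _ _ c2)) cint_cst // mu_seg ?lerDl ?ltry //=.
  by rewrite (_ : c + h - c = h) ?subrK //; ring.
rewrite /bdry E1 E2.
set x := cint _ _ in B1 *; set y := cint _ _ in B2 *.
have -> : x + c1 * w%:C + q * (y + c2 * h%:C) = x + q * y by rewrite /c1 /c2; ring.
apply: le_trans (ncD _ _) _; rewrite ncM [leRHS]mulrDr lerD //.
by rewrite mulrCA ler_wpM2l ?nc_ge0.
Qed.

(** Bisection: if the boundary integral did not vanish, one of the four quarters
    would carry at least a quarter of it, and so on; the nested rectangles shrink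
    to a point at which [bdry_local] gives a smaller value. *)
Lemma goursat (a b c d : R) : a < b -> c < d -> (forall s, a <= s <= b -> U s) ->
  bdry a b c d = 0.
Proof.
move=> ab cd hU; apply/eqP; rewrite -nc_eq0; apply: contraT => E0.
(* half of the value, so that the invariant P below can be strict *)
pose E := normc (bdry a b c d) / 2; pose L := b - a; pose M := d - c.
have Ep : 0 < E by rewrite divr_gt0 // lt_neqAle eq_sym E0 nc_ge0.
have L0 : 0 < L by rewrite subr_gt0. have M0 : 0 < M by rewrite subr_gt0.
pose w n := L * 2^-1 ^+ n; pose h n := M * 2^-1 ^+ n.
have w2 n : w n = w n.+1 + w n.+1 by rewrite /w exprS; field.
have h2 n : h n = h n.+1 + h n.+1 by rewrite /h exprS; field.
have w0 n : 0 < w n by rewrite mulr_gt0 // exprn_gt0.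
have h0 n : 0 < h n by rewrite mulr_gt0 // exprn_gt0.
pose inR n (p : R * R) := [/\ a <= p.1, p.1 + w n <= b, c <= p.2 & p.2 + h n <= d].
pose P n (p : R * R) := inR n p /\ E * 4^-1 ^+ n < normc (bdry p.1 (p.1 + w n) p.2 (p.2 + h n)).
pose nx n (p p' : R * R) := [/\ p.1 <= p'.1, p'.1 + w n.+1 <= p.1 + w n, p.2 <= p'.2 & p'.2 + h n.+1 <= p.2 + h n].
have /choice[f hf] : forall np : nat * (R * R), exists p', P np.1 np.2 -> P np.1.+1 p' /\ nx np.1 np.2 p'.
  move=> [n [x y]] /=; apply: contrapT => /forallNP hn.
  have [hP|hP] := pselect (P n (x, y)); last by apply: (hn (0, 0)) => /hP.
  have [[/= a1 a2 a3 a4] big] := hP.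
  have small x' y' : nx n (x, y) (x', y') ->
      normc (bdry x' (x' + w n.+1) y' (y' + h n.+1)) <= E * 4^-1 ^+ n.+1.
    move=> hx; rewrite leNgt; apply/negP => hlt; apply: (hn (x', y')) => _; split => //.
    case: hx => /= b1 b2 b3 b4; split => //; split => /=; lra.
  have hUx s : x <= s <= x + w n -> U s by move=> /andP[s1 s2]; apply: hU; apply/andP; split; lra.
  move: big; apply/negP; rewrite -leNgt.
  have := w2 n; have := h2 n; have := w0 n.+1; have := h0 n.+1; move=> hp wp he we.
  rewrite (@bdry_splitx x (x + w n.+1)) //; last by apply/andP; split; lra.
  rewrite (@bdry_splity x (x + w n.+1) y (y + h n.+1)) //; first last.
  - by move=> s /andP[s1 s2]; apply: hUx; apply/andP; split; lra.
  - lra.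
  - by apply/andP; split; lra.
  rewrite (@bdry_splity (x + w n.+1) (x + w n) y (y + h n.+1)) //; first last.
  - by move=> s /andP[s1 s2]; apply: hUx; apply/andP; split; lra.
  - lra.
  - by apply/andP; split; lra.
  rewrite we he (addrA x) (addrA y).
  have -> : E * 4^-1 ^+ n = E * 4^-1 ^+ n.+1 + E * 4^-1 ^+ n.+1 + (E * 4^-1 ^+ n.+1 + E * 4^-1 ^+ n.+1).
    by rewrite exprS; field.
  apply: le_trans (ncD _ _) _; apply: le_trans (lerD (ncD _ _) (ncD _ _)) _.
  by apply: lerD; apply: lerD; apply: small; split => /=; lra.
pose p := fix p n := if n is n'.+1 then f (n', p n') else (a, c).
have hP n : P n (p n).
  elim: n => [|n ih]; last by have [] := hf (n, p n) ih.
  split => /=.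
    by split => //=; rewrite /w /h expr0 mulr1 /L /M; lra.
  have -> : a + w 0%N = b by rewrite /w expr0 mulr1 /L addrC subrK.
  have -> : c + h 0%N = d by rewrite /h expr0 mulr1 /M addrC subrK.
  rewrite expr0 mulr1.
  by move: Ep; rewrite /E; lra.
have hN n : nx n (p n) (p n.+1) by have [] := hf (n, p n) (hP n).
have nest (g : nat -> R) (v : nat -> R) : (forall n, g n <= g n.+1) ->
    (forall n, g n.+1 + v n.+1 <= g n + v n) -> (forall n, 0 < v n) ->
    exists x, forall n, g n <= x <= g n + v n.
  move=> g1 g2 v0.
  have gm : {homo g : n m / (n <= m)%N >-> n <= m} by apply/nondecreasing_seqP.
  have gv n m : (n <= m)%N -> g m + v m <= g n + v n.
    by elim: m => [|m ih]; [rewrite leqn0 => /eqP ->|rewrite leq_eqVlt => /predU1P[->//|/ih]; exact: le_trans].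
  have gb n m : g m <= g n + v n.
    have [nm|/ltnW mn] := leqP n m; first by apply: le_trans (gv _ _ nm); rewrite lerDl ltW.
    by apply: le_trans (gm _ _ mn) _; rewrite lerDl ltW.
  have gc : cvgn g by apply: nondecreasing_is_cvgn => //; exists (g 0 + v 0) => _ [m _ <-].
  exists (limn g) => n; rewrite nondecreasing_cvgn_le //=.
  by apply: limr_le => //; apply: nearW.
have [px hpx] := nest (fun n => (p n).1) w (fun n => let: And4 x _ _ _ := hN n in x)
  (fun n => let: And4 _ x _ _ := hN n in x) w0.
have [py hpy] := nest (fun n => (p n).2) h (fun n => let: And4 _ _ x _ := hN n in x)
  (fun n => let: And4 _ _ _ x := hN n in x) h0.
have Upx : U px.
  by apply: hU; have [[/= a1 a2 _ _] _] := hP 0%N; have /andP[] := hpx 0%N => /= *; apply/andP; split; lra.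
have [l hl] := kD py Upx.
pose Q := 2 * (L + M) * (L + normc q * M).
have Q0 : 0 < Q.
  have qM : 0 <= normc q * M by rewrite mulr_ge0 ?nc_ge0 // ltW.
  by rewrite /Q; apply: mulr_gt0; [apply: mulr_gt0|]; lra.
pose e := E / Q; have e0 : 0 < e by rewrite divr_gt0.
have [dl dl0 hdl] := hl e e0.
have cvw (K : R) : 0 < K -> \forall n \near \oo, K * 2^-1 ^+ n < dl.
  move=> K0; have h1 : `|2^-1 : R| < 1 by rewrite ger0_norm ?invr_ge0 // invf_lt1 // ltr1n.
  have /cvgrPdist_lt/(_ _ dl0) := @cvg_geometric _ K _ h1.
  by apply: filterS => n; rewrite sub0r normrN; apply: le_lt_trans; exact: ler_norm.
have [n [wn hn]] : exists n, w n < dl /\ h n < dl.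
  apply: (@filter_ex _ \oo); apply: filterS2 (cvw _ L0) (cvw _ M0) => n; exact: conj.
have [[/= a1 a2 a3 a4] big] := hP n.
have := @bdry_local px py e dl l (p n).1 (p n).2 (w n) (h n) Upx e0 (ltW (w0 n)) (ltW (h0 n)).
move=> /(_ _ hdl (hpx n) (hpy n) wn hn) loc.
have : E * 4^-1 ^+ n < E * 4^-1 ^+ n.
  apply: lt_le_trans big (le_trans (loc _) _).
    by move=> s /andP[s1 s2]; apply: hU; apply/andP; split; lra.
  rewrite le_eqVlt; apply/orP; left; apply/eqP.
  have -> : 4^-1 ^+ n = 2^-1 ^+ n * 2^-1 ^+ n :> R.
    by rewrite -exprMn -invfM -natrM.
  have -> : E = e * Q by rewrite /e mulfVK // gt_eqF.
  by rewrite /Q /w /h; ring.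
by rewrite ltxx.
Qed.

End Goursat.

(** * Circle means of holomorphic functions *)

Section CircleMeans.
Variable R : realType.
Notation C := R[i].
Notation mu := (@lebesgue_measure R).
Notation TR := (measurableTypeR R).
Notation I01 := (`[0%R, 1%R]%classic : set TR).

Lemma nc_circ (t : R) : normc (circ t) = 1.
Proof. by rewrite /circ /= cos2Dsin2 sqrtr1. Qed.

Lemma circ0 : circ (0 : R) = 1.
Proof. by rewrite /circ mulr0 cos0 sin0. Qed.

Lemma circ1 : circ (1 : R) = 1.
Proof. by rewrite /circ mulr1 mulr_natl cos2pi sin2pi. Qed.

Lemma circ_neq0 (t : R) : circ t != 0.
Proof. by rewrite -nc_eq0 nc_circ oner_eq0. Qed.

Lemma circJV (t : R) : (circ t)^* = (circ t)^-1.
Proof. by rewrite unimod_conj // nc_circ. Qed.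

Lemma circJ (t : R) : (circ t)^* = circ (1 - t).
Proof.
rewrite /circ mulrBr mulr1; set x := 2 * pi * t.
have -> : 2 * pi - x = - x + pi *+ 2 by ring.
rewrite addrC cosB sinB cos2pi sin2pi !mul1r !mul0r addr0 sub0r //.
Qed.

Lemma circMJ (t : R) : circ t * (circ t)^* = 1.
Proof. by rewrite nc_mulJ nc_circ expr1n. Qed.

Lemma circ_cont (t : R) : cto (nbhs t) (@circ R) (circ t).
Proof.
have h : (fun s : R => 2 * pi * s) @ t --> 2 * pi * t.
  by apply: (@cvgM R) => //; exact: cvg_cst.
apply/cto_ReIm; split => /=.
  by apply: (continuous_comp h); exact: continuous_cos.
by apply: (continuous_comp h); exact: continuous_sin.
Qed.

Lemma cmeas_circ (D : set TR) : cmeas D (@circ R).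
Proof. by apply: cmeas_continuous => t; exact: circ_cont. Qed.

Lemma cexpD (z w : C) : cexp (z + w) = cexp z * cexp w.
Proof.
apply: eq_ReIm; rewrite ?ReM ?ImM /= ReD ImD expRD ?cosD ?sinD; ring.
Qed.

Lemma nc_cexp (z : C) : normc (cexp z) = expR (complex.Re z).
Proof.
rewrite /cexp /= !exprMn -mulrDr cos2Dsin2 mulr1 sqrtr_sqr ger0_norm // expR_ge0.
Qed.

Lemma is_derive_eps (f : R -> R) (x l : R) : is_derive x 1 f l ->
  forall e : R, 0 < e -> exists2 d : R, 0 < d & forall h, `|h| < d ->
    `|f (x + h) - f x - l * h| <= e * `|h|.
Proof.
move=> [df dl] e e0; have /cvgrPdist_lt/(_ e e0) := df.
rewrite near_withinE => -[d /= d0 hd]; exists d => // h hh.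
have [->|h0] := eqVneq h 0; first by rewrite addr0 subrr mulr0 subrr normr0 mulr0.
have := hd h; rewrite /= sub0r normrN => /(_ hh h0) /ltW.
rewrite distrC -/(derive f x 1) dl [h *: 1]mulr1 [h + x]addrC => hx.
have -> : f (x + h) - f x - l * h = (h^-1 *: (f (x + h) - f x) - l) * h.
  by rewrite mulrBl [_ *: _ ]mulrC mulfVK.
by rewrite normrM ler_wpM2r.
Qed.

Lemma cexp_eps (e : R) : 0 < e -> exists2 d : R, 0 < d & forall h : C, normc h < d ->
  normc (cexp h - 1 - h) <= e * normc h.
Proof.
move=> e0; pose e1 := Num.min (e / 20) 1.
have e10 : 0 < e1 by rewrite lt_min divr_gt0 ?ltr01.
have e11 : e1 <= 1 by rewrite ge_min lexx orbT.
have e12 : e1 <= e / 20 by rewrite ge_min lexx.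
clearbody e1.
have [d1 d10 h1] := is_derive_eps (is_derive_expR (0 : R)) e10.
have [d2 d20 h2] := is_derive_eps (is_derive_sin (0 : R)) e10.
have [d3 d30 h3] := is_derive_eps (is_derive_cos (0 : R)) e10.
exists (Num.min (Num.min d1 d2) (Num.min d3 e1)).
  by rewrite !lt_min d10 d20 d30 e10.
move=> h; rewrite !lt_min => /andP[/andP[n1 n2] /andP[n3 n4]].
set x := complex.Re h; set y := complex.Im h; set n := normc h in n1 n2 n3 n4 *.
have xn : `|x| <= n by exact: Re_nc.
have yn : `|y| <= n by exact: Im_nc.
have := h1 x (le_lt_trans xn n1); rewrite add0r expR0 mul1r => k1.
have := h2 y (le_lt_trans yn n2); rewrite add0r sin0 cos0 subr0 mul1r => k2.
have := h3 y (le_lt_trans yn n3); rewrite add0r cos0 sin0 oppr0 mul0r subr0 => k3.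
have n0 : 0 <= n by exact: nc_ge0.
have x0 := normr_ge0 x; have y0 := normr_ge0 y.
have E1 : `|expR x - 1| <= 2 * n.
  have -> : expR x - 1 = (expR x - 1 - x) + x by rewrite subrK.
  by apply: le_trans (ler_normD _ _) _; nra.
have E2 : `|expR x| <= 3.
  have -> : expR x = (expR x - 1) + 1 by rewrite subrK.
  by apply: le_trans (ler_normD _ _) _; rewrite normr1; nra.
have E3 : `|sin y| <= 2 * n.
  have -> : sin y = (sin y - y) + y by rewrite subrK.
  by apply: le_trans (ler_normD _ _) _; nra.
apply: le_trans (nc_ReIm _) _; rewrite !ReD !ImD !ReN !ImN /= -/x -/y oppr0 addr0.
have -> : expR x * cos y - 1 - x = (expR x - 1 - x) + expR x * (cos y - 1) by ring.
have -> : expR x * sin y - y = (sin y - y) + (expR x - 1) * sin y by ring.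
have A1 : `|expR x * (cos y - 1)| <= 3 * (e1 * n).
  by rewrite normrM; apply: ler_pM => //; nra.
have A2 : `|(expR x - 1) * sin y| <= (2 * n) * (2 * n) by rewrite normrM; apply: ler_pM.
apply: le_trans (lerD (ler_normD _ _) (ler_normD _ _)) _.
nra.
Qed.

Definition twopii : C := 0 +i* (2 * pi).

Lemma cexp_polar (s t : R) : cexp (s%:C + twopii * t%:C) = (expR s)%:C * circ t.
Proof.
have -> : s%:C + twopii * t%:C = s +i* (2 * pi * t).
  by apply: eq_ReIm; rewrite ?ReD ?ImD ?ReM ?ImM /= ?mul0r ?mulr0 ?subrr ?addr0 ?add0r.
by apply: eq_ReIm; rewrite ?ReM ?ImM /= mul0r ?subr0 ?addr0.
Qed.

(** In the coordinates z = exp(s + 2 pi i t) circles around 0 become the segments s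
    = const, 0 <= t <= 1. *)
Lemma polar_diff (H : C -> C) :
  (forall z : C, 0 < normc z < 1 -> derivable (H : C^o -> C^o) z 1) ->
  forall s t : R, s < 0 -> exists l : C, forall e : R, 0 < e -> exists2 d : R, 0 < d &
  forall s' t', `|s' - s| < d -> `|t' - t| < d ->
    normc (H ((expR s')%:C * circ t') - H ((expR s)%:C * circ t) -
      l * ((s' - s)%:C + twopii * (t' - t)%:C)) <= e * (`|s' - s| + `|t' - t|).
Proof.
move=> hH s t s0; set z0 := (expR s)%:C * circ t.
have nz0 : normc z0 = expR s by rewrite ncM ncR nc_circ mulr1 ger0_norm // expR_ge0.
have z01 : 0 < normc z0 < 1 by rewrite nz0 expR_gt0 expR_lt1.
have /derivableC[l hl] := hH _ z01.
exists (l * z0) => e e0; pose K := 1 + normc twopii.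
have K0 : 0 < K by rewrite ltr_pwDl // nc_ge0.
pose L := 1 + normc l; have L0 : 0 < L by rewrite ltr_pwDl // nc_ge0.
have e4 : 0 < e / (4 * K) by rewrite divr_gt0 // mulr_gt0.
have eL : 0 < e / (2 * K * L) by rewrite divr_gt0 // !mulr_gt0.
have [d1 d10 hd1] := hl _ e4.
have [d2 d20 hd2] := cexp_eps ltr01.
have [d3 d30 hd3] := cexp_eps eL.
pose d := Num.min (d1 / 2) (Num.min d2 d3).
have d0 : 0 < d by rewrite !lt_min d20 d30 divr_gt0.
exists (d / (2 * K)); first by rewrite divr_gt0 // mulr_gt0.
move=> s' t' hs ht; set D := (s' - s)%:C + twopii * (t' - t)%:C.
set w := `|s' - s| + `|t' - t|.
have w0 : 0 <= w by rewrite addr_ge0.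
have Dw : normc D <= K * w.
  apply: le_trans (ncD _ _) _; rewrite ncM !ncR /K /w mulrDl !mul1r.
  have := normr_ge0 (s' - s); have := normr_ge0 (t' - t); have := nc_ge0 twopii; nra.
have Dd : normc D < d.
  apply: le_lt_trans Dw _; rewrite mulrC -ltr_pdivlMr //.
  have -> : d / K = d / (2 * K) + d / (2 * K) by field; rewrite gt_eqF.
  exact: ltrD.
move: Dd; rewrite !lt_min => /andP[Dd1 /andP[Dd2 Dd3]].
pose eta := z0 * (cexp D - 1).
have E : (expR s')%:C * circ t' = z0 + eta.
  rewrite /eta mulrBr mulr1 [RHS]addrC subrK /z0 -!cexp_polar -cexpD; congr cexp.
  by rewrite /D !rmorphB /=; ring.
have eta2 : normc eta <= 2 * normc D.
  rewrite /eta ncM nz0; have := hd2 D Dd2; rewrite mul1r => h.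
  have h2 : normc (cexp D - 1) <= 2 * normc D.
    have -> : cexp D - 1 = (cexp D - 1 - D) + D by rewrite subrK.
    by apply: le_trans (ncD _ _) _; rewrite mulr_natl mulr2n lerD2r.
  have e1 : expR s <= 1 by rewrite -expR0 ler_expR ltW.
  by apply: le_trans h2; rewrite ler_piMl ?nc_ge0.
rewrite E.
have -> : H (z0 + eta) - H z0 - l * z0 * D =
  (H (z0 + eta) - H z0 - l * eta) + l * (z0 * (cexp D - 1 - D)) by rewrite /eta; ring.
apply: le_trans (ncD _ _) _.
have B1 : normc (H (z0 + eta) - H z0 - l * eta) <= e / 2 * w.
  apply: le_trans (hd1 _ _) _; first by lra.
  have -> : e / 2 * w = e / (4 * K) * (2 * (K * w)) by field; rewrite gt_eqF.
  by rewrite ler_pM2l //; lra.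
have B2 : normc (l * (z0 * (cexp D - 1 - D))) <= e / 2 * w.
  rewrite ncM (ncM z0) nz0; have e1 : expR s <= 1 by rewrite -expR0 ler_expR ltW.
  have h := hd3 D Dd3.
  have -> : e / 2 * w = L * (e / (2 * K * L) * (K * w)) by field; rewrite !gt_eqF.
  apply: ler_pM; rewrite ?nc_ge0 ?mulr_ge0 ?nc_ge0 ?expR_ge0 ?lerDr //.
  apply: le_trans (le_trans h _); last by rewrite ler_pM2l.
  by rewrite ler_piMl // nc_ge0.
lra.
Qed.

(** [goursat] on [ln r, ln r'] x [0, 1]: the sides t = 0 and t = 1 cancel by
    periodicity and the other two are the circle means. *)
Lemma mean_const (H : C -> C) :
  (forall z : C, 0 < normc z < 1 -> derivable (H : C^o -> C^o) z 1) ->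
  forall r r' : R, 0 < r < 1 -> 0 < r' < 1 ->
  cint I01 (fun t => H (r%:C * circ t)) = cint I01 (fun t => H (r'%:C * circ t)).
Proof.
move=> hH; suff main r r' : 0 < r -> r < r' -> r' < 1 ->
    cint I01 (fun t => H (r%:C * circ t)) = cint I01 (fun t => H (r'%:C * circ t)).
  move=> r r' /andP[r0 r1] /andP[r0' r1'].
  have [h|h|->//] := ltgtP r r'; first exact: main.
  by apply: esym; exact: main.
move=> r0 rr r1; have r0' : 0 < r' := lt_trans r0 rr.
pose k s t := H ((expR s)%:C * circ t).
have hU s : ln r <= s <= ln r' -> s < 0.
  by move=> /andP[_ /le_lt_trans]; apply; rewrite ln_lt0 // r0'.
have lnrr : ln r < ln r' by rewrite ltr_ln.
have := @goursat R twopii k (fun s => s < 0) (polar_diff hH) (ln r) (ln r') 0 1 lnrr ltr01 hU.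
rewrite /bdry; rewrite (@eq_cint _ _ _ (fun=> 0)); last first.
  by move=> s _; rewrite /k circ0 circ1 subrr.
rewrite cint0 add0r => /eqP; rewrite mulf_eq0 => /orP[/eqP h|].
  have : 2 * pi = 0 :> R by case: h.
  by move/eqP; rewrite mulf_eq0 pnatr_eq0 /= gt_eqF // pi_gt0.
have hk (x : R) : x < 0 -> cintg I01 (k x).
  by move=> x0; apply: cintg_cont => t _; exact: (kcont2 (polar_diff hH)).
have l1 : ln r < 0 by apply: hU; rewrite lexx ltW.
have l2 : ln r' < 0 by apply: hU; rewrite lexx ltW.
rewrite cintB //; try exact: hk.
rewrite subr_eq0 => /eqP; rewrite /k !lnK ?posrE // => ->.
Qed.

End CircleMeans.

(** * Fourier coefficients and Cauchy integrals *)

Section CauchyIntegral.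
Variable R : realType.
Notation C := R[i].
Notation mu := (@lebesgue_measure R).
Notation TR := (measurableTypeR R).
Notation I01 := (`[0%R, 1%R]%classic : set TR).
Implicit Types (u v : TR -> C).

Lemma RCX (r : R) n : (r%:C : C) ^+ n = (r ^+ n)%:C.
Proof. by rewrite -rmorphXn. Qed.

Lemma RCV (r : R) : (r^-1)%:C = (r%:C : C)^-1.
Proof. exact: (fmorphV (real_complex R)). Qed.

Lemma cintg_circM u (v : TR -> C) (K : R) : cintg I01 u -> cmeas I01 v ->
  (forall t, I01 t -> normc (v t) <= K) -> cintg I01 (fun t => u t * v t).
Proof.
move=> hu hv hK; apply: (@cintg_le _ _ mI01 _ (fun t => K * normc (u t))).
- by apply: cmeasM => //; exact: cintg_meas hu.
- exact: (@integrableZlR _ _ mI01 K _ (cintg_nc mI01 hu)).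
- by move=> t It; rewrite ncM mulrC ler_wpM2r ?nc_ge0 // hK.
Qed.

Lemma nc_circX t n : normc (@circ R t ^+ n) = 1.
Proof. by rewrite ncX nc_circ expr1n. Qed.

Lemma cmeas_circX (D : set TR) n : cmeas D (fun t => @circ R t ^+ n).
Proof. by apply: cmeasX; exact: cmeas_circ. Qed.

Lemma cmeas_circJX (D : set TR) n : cmeas D (fun t => (@circ R t)^* ^+ n).
Proof. by apply: cmeasX; apply: cmeasJ; exact: cmeas_circ. Qed.

Lemma cintg_circX u n : cintg I01 u -> cintg I01 (fun t => u t * circ t ^+ n).
Proof.
by move=> hu; apply: (@cintg_circM _ _ 1) => // [|t _]; [exact: cmeas_circX|rewrite nc_circX].
Qed.

Lemma cintg_circJX u n : cintg I01 u -> cintg I01 (fun t => u t * (circ t)^* ^+ n).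
Proof.
move=> hu; apply: (@cintg_circM _ _ 1) => // [|t _]; first exact: cmeas_circJX.
by rewrite ncX ncJ nc_circ expr1n.
Qed.

Lemma cintg_cst01 (c : C) : cintg I01 (fun=> c).
Proof. by apply: (@cintg_bounded _ _ (normc c)) => //; exact: cmeas_cst. Qed.

Lemma holo_cont (H : C -> C) (z : C) : derivable (H : C^o -> C^o) z 1 ->
  forall e : R, 0 < e -> exists2 d : R, 0 < d & forall h, normc h < d -> normc (H (z + h) - H z) < e.
Proof.
move=> /derivableC[l hl] e e0; have [d d0 hd] := hl 1 ltr01.
pose K := 1 + normc l; have K0 : 0 < K by rewrite ltr_pwDl // nc_ge0.
exists (Num.min d (e / K)); first by rewrite lt_min d0 divr_gt0.
move=> h; rewrite lt_min => /andP[h1 h2]; have := hd h h1; rewrite mul1r => h3.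
have -> : H (z + h) - H z = (H (z + h) - H z - l * h) + l * h by rewrite subrK.
apply: le_lt_trans (ncD _ _) _; rewrite ncM.
apply: (@le_lt_trans _ _ (K * normc h)); first by rewrite /K mulrDl mul1r lerD2r.
by rewrite mulrC -ltr_pdivlMr.
Qed.

Lemma in_diskM (r t : R) : 0 <= r < 1 -> in_disk (r%:C * circ t).
Proof. by move=> /andP[r0 r1]; rewrite /in_disk ncM ncR nc_circ mulr1 ger0_norm. Qed.

Lemma circle_cont (H : C -> C) (r : R) : holo_disk H -> 0 <= r < 1 -> forall t : R,
  cto (nbhs t) (fun s : R => H (r%:C * circ s)) (H (r%:C * circ t)).
Proof.
move=> hH r01 t e e0; have [d d0 hd] := holo_cont (hH _ (in_diskM t r01)) e0.
have hc : cto (nbhs t) (fun s : R => r%:C * circ s) (r%:C * circ t).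
  by apply: ctoM; [exact: cto_cst|exact: circ_cont].
apply: filterS (hc d d0) => s hs.
have -> : r%:C * circ s = r%:C * circ t + (r%:C * circ s - r%:C * circ t) by rewrite addrC subrK.
exact: hd.
Qed.

Lemma cintg_circle (H : C -> C) (r : R) : holo_disk H -> 0 <= r < 1 ->
  cintg I01 (fun t => H (r%:C * circ t)).
Proof. by move=> hH r01; apply: cintg_cont => t _; exact: circle_cont. Qed.

Lemma derivable_expC (z : C) n : derivable ((fun w : C => w ^+ n) : C^o -> C^o) z 1.
Proof. exact: (@exprn_derivable C n z 1). Qed.

Lemma derivable_mulC (F G : C -> C) (z : C) : derivable (F : C^o -> C^o) z 1 ->
  derivable (G : C^o -> C^o) z 1 -> derivable ((fun w => F w * G w) : C^o -> C^o) z 1.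
Proof. by move=> hF hG; exact: (@derivableM C C^o F G z 1 hF hG). Qed.

Lemma derivable_invC (F : C -> C) (z : C) : F z != 0 -> derivable (F : C^o -> C^o) z 1 ->
  derivable ((fun w => (F w)^-1) : C^o -> C^o) z 1.
Proof. by move=> F0 hF; exact: (@derivableV C C^o F z 1 F0 hF). Qed.

(** The mean of H(z) z^m does not depend on the radius by [mean_const], and it
    tends to 0 with the radius because H is bounded near 0. *)
Lemma holo_mean_zero (H : C -> C) (m : nat) (r : R) : holo_disk H -> (0 < m)%N -> 0 < r < 1 ->
  cint I01 (fun t => H (r%:C * circ t) * circ t ^+ m) = 0.
Proof.
move=> hH m0 r01; pose K (z : C) := H z * z ^+ m.
have hK : forall z : C, 0 < normc z < 1 -> derivable (K : C^o -> C^o) z 1.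
  by move=> z /andP[_ z1]; apply: derivable_mulC; [exact: hH|exact: derivable_expC].
have KE s : 0 < s < 1 -> cint I01 (fun t => K (s%:C * circ t)) =
    (s ^+ m)%:C * cint I01 (fun t => H (s%:C * circ t) * circ t ^+ m).
  move=> /andP[s0 s1]; rewrite -cintZ //; last first.
    by apply: cintg_circX; apply: cintg_circle => //; rewrite (ltW s0).
  by apply: eq_cint => t _; rewrite /K exprMn RCX mulrCA mulrA.
set c := cint _ _; have /andP[r0 r1] := r01.
have d01 : derivable (H : C^o -> C^o) 0 1 by apply: hH; rewrite /in_disk nc0 ltr01.
have [d d0 hd] := holo_cont d01 ltr01.
pose M := normc (H 0) + 1.
have rm : (r ^+ m)%:C != 0 :> C by rewrite -nc_eq0 ncR normr_eq0 expf_neq0 // gt_eqF.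
apply: (mulfI rm); rewrite mulr0 -KE //; apply/eqP; rewrite -nc_eq0.
set N := normc _; apply: contraT => N0.
have Np : 0 < N by rewrite lt_neqAle eq_sym N0 nc_ge0.
have M0 : 0 < M by rewrite /M ltr_wpDl // nc_ge0.
pose s := Num.min (d / 2) (Num.min (2^-1) (N / (2 * M))).
have NM : 0 < N / (2 * M) by rewrite divr_gt0 // mulr_gt0.
have s0 : 0 < s by rewrite !lt_min NM invr_gt0 ltr0n divr_gt0.
have sd : s < d by rewrite gt_min ltr_pdivrMr // ltr_pMr // ltr1n.
have s1 : s < 1 by rewrite !gt_min invf_lt1 // ltr1n orbT.
have sN : s <= N / (2 * M) by rewrite !ge_min lexx !orbT.
have : N <= s * M * 1.
  rewrite /N (mean_const hK r01 (r' := s)) ?s0 //.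
  apply: nc_cint_le => //; first exact: muI01.
    apply: cintg_cont => t _; apply: ctoM; first by apply: circle_cont => //; rewrite (ltW s0).
    by apply: ctoX; apply: ctoM; [exact: cto_cst|exact: circ_cont].
  move=> t _; rewrite /K ncM ncX ncM ncR nc_circ mulr1 mulrC (ger0_norm (ltW s0)).
  apply: ler_pM; rewrite ?exprn_ge0 ?nc_ge0 ?(ltW s0) //.
    by rewrite -{2}[s]expr1 ler_wiXn2l // ltW.
  have := hd (s%:C * circ t); rewrite add0r ncM ncR nc_circ mulr1 (ger0_norm (ltW s0)) => /(_ sd) h.
  have -> : H (s%:C * circ t) = H 0 + (H (s%:C * circ t) - H 0) by rewrite addrC subrK.
  by apply: le_trans (ncD _ _) _; rewrite lerD2l ltW.
rewrite mulr1 leNgt => /negP[]; apply: (@le_lt_trans _ _ (N / (2 * M) * M)).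
  by rewrite ler_pM2r.
by have -> : N / (2 * M) * M = N / 2 by [field; rewrite gt_eqF|]; lra.
Qed.

(** [mean_const] for H(z) / z^n, holomorphic off the origin. *)
Lemma holo_coef (H : C -> C) (n : nat) (r r' : R) : holo_disk H -> 0 < r < 1 -> 0 < r' < 1 ->
  (r ^- n)%:C * cint I01 (fun t => H (r%:C * circ t) * (circ t)^* ^+ n) =
  (r' ^- n)%:C * cint I01 (fun t => H (r'%:C * circ t) * (circ t)^* ^+ n).
Proof.
move=> hH; pose K (z : C) := H z * (z ^+ n)^-1.
have hK : forall z : C, 0 < normc z < 1 -> derivable (K : C^o -> C^o) z 1.
  move=> z /andP[z0 z1]; apply: derivable_mulC; first exact: hH.
  apply: (@derivable_invC (fun w => w ^+ n)); last exact: derivable_expC.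
  by rewrite expf_neq0 // -nc_gt0.
have KE s : 0 < s < 1 -> cint I01 (fun t => K (s%:C * circ t)) =
    (s ^- n)%:C * cint I01 (fun t => H (s%:C * circ t) * (circ t)^* ^+ n).
  move=> /andP[s0 s1]; rewrite -cintZ //; last first.
    by apply: cintg_circJX; apply: cintg_circle => //; rewrite (ltW s0).
  apply: eq_cint => t _; rewrite /K.
  have -> : ((s%:C * circ t) ^+ n)^-1 = (s ^- n)%:C * (circ t)^* ^+ n.
    by rewrite RCV -RCX (circJV t) exprVn exprMn invfM.
  by rewrite mulrCA.
by move=> h h'; rewrite -(KE r h) -(KE r' h'); exact: (mean_const hK h h').
Qed.

Lemma circ_mean m : (0 < m)%N -> cint I01 (fun t => @circ R t ^+ m) = 0.
Proof.
move=> m0; have h : holo_disk (fun _ : C => 1 : C) by move=> z _; exact: derivable_cst.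
have := @holo_mean_zero _ m 2^-1 h m0; rewrite invr_gt0 ltr0n invf_lt1 // ltr1n => /(_ isT) <-.
by apply: eq_cint => t _; rewrite mul1r.
Qed.

Lemma circJ_mean m : (0 < m)%N -> cint I01 (fun t => (@circ R t)^* ^+ m) = 0.
Proof.
move=> m0; have := circ_mean m0; rewrite /cint => -[h1 h2]; congr (_ +i* _).
  by rewrite -[RHS]h1; apply: eq_Rintegral => t _; rewrite -conjcX ReJ.
have hi : mu.-integrable I01 (EFin \o (fun t => complex.Im (@circ R t ^+ m))).
  have [_ h] : cintg I01 (fun t => @circ R t ^+ m).
    by apply: (@cintg_bounded _ _ 1) => [|t _]; [exact: cmeas_circX|rewrite nc_circX].
  exact: h.
rewrite -[RHS](mulr0 (-1)) -[X in _ = _ * X]h2 -RintegralZl //; apply: eq_Rintegral => t _.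
by rewrite -conjcX ImJ mulN1r.
Qed.

Lemma circ_orth m n : cint I01 (fun t => @circ R t ^+ m * (circ t)^* ^+ n) = (m == n)%:R.
Proof.
have [mn|mn|->] := ltngtP m n.
- rewrite (_ : cint _ _ = cint I01 (fun t => (@circ R t)^* ^+ (n - m))).
    by rewrite circJ_mean // subn_gt0.
  by apply: eq_cint => t _; rewrite -{1}(subnK (ltnW mn)) exprD mulrCA -exprMn circMJ expr1n mulr1.
- rewrite (_ : cint _ _ = cint I01 (fun t => (@circ R t) ^+ (m - n))).
    by rewrite circ_mean // subn_gt0.
  by apply: eq_cint => t _; rewrite -{1}(subnK (ltnW mn)) exprD -mulrA -exprMn circMJ expr1n mulr1.
- have -> : cint I01 (fun t => @circ R t ^+ n * (circ t)^* ^+ n) = cint I01 (fun=> 1).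
    by apply: eq_cint => t _; rewrite -exprMn circMJ expr1n.
  by rewrite cint_cst01.
Qed.

Definition coef u n : C := cint I01 (fun t => u t * (circ t)^* ^+ n).

(** The kernel is the sum of the nonnegative powers of z conj tau, so this is the
    power series with coefficients [coef u n] ([cauchy_series]). *)
Definition cauchy u (z : C) : C := cint I01 (fun t => u t * (1 - z * (circ t)^*)^-1).

Lemma ker_lower (z : C) (t : R) : 1 - normc z <= normc (1 - z * (circ t)^*).
Proof. by have := nc_rev 1 (z * (circ t)^*); rewrite nc1 ncM ncJ nc_circ mulr1. Qed.

Lemma ker_neq0 (z : C) (t : R) : in_disk z -> 1 - z * (circ t)^* != 0.
Proof. by move=> z1; rewrite -nc_gt0; apply: lt_le_trans (ker_lower z t); rewrite subr_gt0. Qed.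

Lemma ker_bound (z : C) (t : R) : in_disk z -> normc (1 - z * (circ t)^*)^-1 <= (1 - normc z)^-1.
Proof.
move=> z1; rewrite ncV lef_pV2 ?posrE ?nc_gt0 ?ker_neq0 ?subr_gt0 //; exact: ker_lower.
Qed.

Lemma cmeas_ker (z : C) : cmeas I01 (fun t => (1 - z * (circ t)^*)^-1).
Proof.
apply: cmeasV; apply: cmeasB; first exact: cmeas_cst.
by apply: cmeasM; [exact: cmeas_cst|apply: cmeasJ; exact: cmeas_circ].
Qed.

Lemma cintg_ker u (z : C) : cintg I01 u -> in_disk z ->
  cintg I01 (fun t => u t * (1 - z * (circ t)^*)^-1).
Proof.
move=> hu z1; apply: (@cintg_circM _ _ (1 - normc z)^-1) => // [|t _]; first exact: cmeas_ker.
exact: ker_bound.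
Qed.

Definition norm1 u : R := Rintegral mu I01 (fun t => normc (u t)).

Lemma norm1_ge0 u : 0 <= norm1 u.
Proof. by apply: Rintegral_ge0 => t _; exact: nc_ge0. Qed.

Lemma nc_cintM_le u v (K : R) : cintg I01 u -> cmeas I01 v -> (forall t, I01 t -> normc (v t) <= K) ->
  normc (cint I01 (fun t => u t * v t)) <= K * norm1 u.
Proof.
move=> hu hv hK; have hi := cintg_circM hu hv hK.
apply: le_trans (nc_cint mI01 hi) _; rewrite /norm1 -RintegralZl //; last exact: cintg_nc.
apply: le_Rintegral => //; first exact: cintg_nc.
  exact: (@integrableZlR _ _ mI01 K _ (cintg_nc mI01 hu)).
by move=> t It; rewrite ncM mulrC ler_wpM2r ?nc_ge0 // hK.
Qed.

Lemma geom_id (w : C) N : 1 - w != 0 ->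
  (1 - w)^-1 = \sum_(0 <= n < N) w ^+ n + w ^+ N * (1 - w)^-1.
Proof.
move=> w0; elim: N => [|N ih]; first by rewrite big_geq // add0r expr0 mul1r.
rewrite big_nat_recr //= {1}ih -addrA; congr (_ + _).
by rewrite exprS; field.
Qed.

Lemma cauchy_expand u (z : C) N : cintg I01 u -> in_disk z ->
  normc (cauchy u z - \sum_(0 <= n < N) coef u n * z ^+ n) <=
    normc z ^+ N / (1 - normc z) * norm1 u.
Proof.
move=> hu z1.
have -> : \sum_(0 <= n < N) coef u n * z ^+ n =
    cint I01 (fun t => \sum_(0 <= n < N) z ^+ n * (u t * (circ t)^* ^+ n)).
  rewrite cint_sum //; last by move=> i; apply: cintgZ => //; exact: cintg_circJX.
  by apply: eq_bigr => i _; rewrite cintZ 1?mulrC //; exact: cintg_circJX.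
rewrite -cintB //; [|exact: cintg_ker|]; last first.
  by apply: cintg_sum => // i; apply: cintgZ => //; exact: cintg_circJX.
rewrite (@eq_cint _ _ _ (fun t => u t * ((z * (circ t)^*) ^+ N * (1 - z * (circ t)^*)^-1))); last first.
  move=> t _; rewrite {1}(@geom_id _ N (ker_neq0 t z1)) mulrDr addrAC.
  rewrite -[RHS]add0r; congr (_ + _); apply/eqP; rewrite subr_eq0 mulr_sumr; apply/eqP.
  by apply: eq_bigr => i _; rewrite exprMn mulrCA.
apply: nc_cintM_le => //.
  apply: cmeasM; last exact: cmeas_ker.
  by apply: cmeasX; apply: cmeasM; [exact: cmeas_cst|apply: cmeasJ; exact: cmeas_circ].
move=> t _; rewrite ncM ncX ncM ncJ nc_circ mulr1 ler_wpM2l ?exprn_ge0 ?nc_ge0 //.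
exact: ker_bound.
Qed.

Lemma geom_cvg0 (q K : R) : 0 <= q < 1 -> (fun n => q ^+ n * K) @ \oo --> 0.
Proof.
move=> /andP[q0 q1]; have h := @cvg_geometric _ K q; rewrite ger0_norm // in h.
by apply: cvg_trans (h q1); apply: near_eq_cvg; apply: nearW => n; rewrite /geometric /= mulrC.
Qed.

Lemma cauchy_series u (z : C) : cintg I01 u -> in_disk z ->
  cto \oo (fun N => \sum_(0 <= n < N) coef u n * z ^+ n) (cauchy u z).
Proof.
move=> hu z1; have hz : 0 <= normc z < 1 by rewrite nc_ge0.
apply: cto_squeeze (geom_cvg0 ((1 - normc z)^-1 * norm1 u) hz) _.
apply: nearW => N; rewrite ncdist; apply: le_trans (cauchy_expand N hu z1) _.
by rewrite mulrA.
Qed.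

(** Differentiation under the integral sign; the remainder of the kernel k is
    explicit, k(z+h) - k(z) - h k'(z) = h^2 (conj tau)^2 k(z)^2 k(z+h). *)
Lemma holo_cauchy u : cintg I01 u -> holo_disk (cauchy u).
Proof.
move=> hu z z1; apply/derivableC.
pose k1 t := (1 - z * (@circ R t)^*)^-1.
pose l := cint I01 (fun t => u t * ((circ t)^* * k1 t ^+ 2)).
exists l => e e0; pose p := (1 - normc z) / 2.
have p0 : 0 < p by rewrite divr_gt0 // subr_gt0.
pose K := p^-1 ^+ 3 * norm1 u + 1.
have K0 : 0 < K by rewrite /K ltr_wpDl // mulr_ge0 ?norm1_ge0 // exprn_ge0 // invr_ge0 ltW.
exists (Num.min p (e / K)); first by rewrite lt_min p0 divr_gt0.
move=> h; rewrite lt_min => /andP[hp he].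
have zh : normc (z + h) <= 1 - p by have := ncD z h; rewrite /p in hp *; lra.
have zh1 : in_disk (z + h) by rewrite /in_disk; lra.
have mk1 : cmeas I01 k1 by exact: cmeas_ker.
have b1 t : normc (k1 t) <= p^-1.
  apply: le_trans (ker_bound t z1) _; rewrite lef_pV2 ?posrE ?subr_gt0 //; rewrite /p.
  by have : 0 < 1 - normc z; [rewrite subr_gt0|lra].
have b2 t : normc (1 - (z + h) * (circ t)^*)^-1 <= p^-1.
  apply: le_trans (ker_bound t zh1) _; rewrite lef_pV2 ?posrE ?subr_gt0 //; lra.
have mJ : cmeas I01 (fun t => (@circ R t)^*) by apply: cmeasJ; exact: cmeas_circ.
have il : cintg I01 (fun t => u t * ((circ t)^* * k1 t ^+ 2)).
  apply: (@cintg_circM _ _ (p^-1 ^+ 2)) => // [|t _]; first by apply: cmeasM => //; exact: cmeasX.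
  rewrite ncM ncJ nc_circ mul1r ncX ler_pXn2r ?nnegrE ?nc_ge0 ?b1 //.
  by rewrite invr_ge0 ltW.
have i1 := cintg_ker hu zh1; have i2 := cintg_ker hu z1.
rewrite /cauchy [l * h]mulrC /l -cintZ // -!cintB //; [|exact: cintgB|exact: cintgZ].
rewrite (@eq_cint _ _ _ (fun t => u t * (h ^+ 2 * ((circ t)^* ^+ 2 * k1 t ^+ 2 *
    (1 - (z + h) * (circ t)^*)^-1)))); last first.
  by move=> t _; rewrite /k1; field; rewrite !ker_neq0.
apply: le_trans (nc_cintM_le (K := normc h ^+ 2 * (p^-1 ^+ 3)) hu _ _) _.
- apply: cmeasM; first exact: cmeas_cst.
  by apply: cmeasM; [apply: cmeasM; exact: cmeasX|exact: cmeas_ker].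
- move=> t _; rewrite (ncM (h ^+ 2)) (ncX h) ler_wpM2l ?exprn_ge0 ?nc_ge0 //.
  rewrite (ncM (_ * _)) (ncM (_ ^+ 2)) (ncX (k1 t)) (ncX (circ t)^* ) ncJ nc_circ expr1n mul1r.
  rewrite [_ ^+ 3]exprSr; apply: ler_pM; rewrite ?exprn_ge0 ?nc_ge0 //.
  by rewrite ler_pXn2r ?nnegrE ?nc_ge0 ?b1 // invr_ge0 ltW.
have hK : normc h * K <= e by rewrite -ler_pdivlMr // ltW.
have n1 : p^-1 ^+ 3 * norm1 u <= K by rewrite /K lerDl.
have -> : normc h ^+ 2 * p^-1 ^+ 3 * norm1 u = normc h * (p^-1 ^+ 3 * norm1 u) * normc h.
  by ring.
rewrite ler_wpM2r ?nc_ge0 //; apply: le_trans hK; by rewrite ler_wpM2l ?nc_ge0.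
Qed.

End CauchyIntegral.

(** * The Poisson kernel *)

Section RadialLimits.
Variable R : realType.
Notation C := R[i].
Notation mu := (@lebesgue_measure R).
Notation TR := (measurableTypeR R).
Notation I01 := (`[0%R, 1%R]%classic : set TR).
Implicit Types (u v : TR -> C).

Lemma RCM (a b : R) : (a * b)%:C = a%:C * b%:C :> C. Proof. exact: rmorphM. Qed.
Lemma RCB (a b : R) : (a - b)%:C = a%:C - b%:C :> C. Proof. exact: rmorphB. Qed.
Lemma circD (s t : R) : circ (s + t) = circ s * circ t.
Proof.
rewrite /circ mulrDr; apply: eq_ReIm; rewrite ?ReM ?ImM /= ?cosD ?sinD //.
by rewrite addrC [X in X + _]mulrC addrC.
Qed.

Lemma sin_pi_lower (b : R) : 0 < b < 1 -> exists2 c : R, 0 < c &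
  forall y, 0 <= y <= b -> c * y <= sin (pi * y).
Proof.
move=> /andP[b0 b1]; have h2 : 0 < 2^-1 :> R by rewrite invr_gt0.
have [d d0 hd] := is_derive_eps (is_derive_sin (0 : R)) h2.
have p0 := pi_gt0 R.
have small y : 0 <= y -> pi * y < d -> pi / 2 * y <= sin (pi * y).
  move=> y0 yd; have py : 0 <= pi * y by rewrite mulr_ge0 // ltW.
  have := hd (pi * y); rewrite ger0_norm // => /(_ yd).
  by rewrite add0r sin0 cos0 subr0 mul1r ler_distl => /andP[h _]; lra.
have [hb|hb] := ltP (pi * b) d.
  exists (pi / 2); first by rewrite divr_gt0.
  move=> y /andP[y0 yb]; apply: small => //; apply: le_lt_trans hb.
  by rewrite ler_pM2l.
pose n := d / (2 * pi).
have n0 : 0 < n by rewrite divr_gt0 // mulr_gt0.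
have nb : n <= b.
  by rewrite /n ler_pdivrMr ?mulr_gt0 //; nra.
have cs : {within `[n, b], continuous (fun y : R => sin (pi * y))}.
  apply: continuous_subspaceT => y; apply: (continuous_comp (f := fun y => pi * y)).
    by apply: (@cvgM R) => //; exact: cvg_cst.
  exact: continuous_sin.
have [m mI hm] := EVT_min nb cs.
have m0 : 0 < sin (pi * m).
  apply: sin_gt0_pi; move: mI; rewrite in_itv /= => /andP[m1 m2].
  apply/andP; split; first by rewrite mulr_gt0 // (lt_le_trans n0).
  by rewrite -[X in _ < X]mulr1 ltr_pM2l // (le_lt_trans m2).
exists (Num.min (pi / 2) (sin (pi * m))); first by rewrite lt_min m0 divr_gt0.
move=> y /andP[y0 yb]; have [yn|ny] := ltP y n.
  apply: le_trans (small y y0 _); first by rewrite ler_wpM2r // ge_min lexx.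
  apply: (@lt_le_trans _ _ (pi * n)); first by rewrite ltr_pM2l.
  have -> : pi * n = d / 2 by rewrite /n invfM (mulrC 2^-1) !mulrA [pi * d]mulrC mulfK // lt0r_neq0.
  lra.
apply: le_trans (hm y _); last by rewrite in_itv /= ny.
apply: (@le_trans _ _ (sin (pi * m) * y)); first by rewrite ler_wpM2r // ge_min lexx orbT.
by rewrite ler_piMr ?(ltW m0) // (le_trans yb) // ltW.
Qed.

Lemma nc_circ_sub1 (y : R) : normc (circ y - 1) = 2 * `|sin (pi * y)|.
Proof.
apply/eqP; rewrite -(@eqrXn2 _ 2) ?nc_ge0 ?mulr_ge0 // nc_sqr /circ ReD ImD /= oppr0 addr0.
rewrite exprMn real_normK ?num_real //.
have -> : 2 * pi * y = pi * y + pi * y by ring.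
rewrite cosD sinD; have := cos2Dsin2 (pi * y).
set c := cos _; set s := sin _ => h; apply/eqP.
have -> : (c * c - s * s - 1) ^+ 2 + (s * c + c * s) ^+ 2 =
  4 * s ^+ 2 + (c ^+ 2 + s ^+ 2 - 1) ^+ 2 by ring.
by rewrite h; ring.
Qed.

(** Chords are bounded below by parameter distance near an interior point x,
    although circ 0 = circ 1: for 0 < x < 1 the difference s - x stays away from
    +-1. Estimates on the circle can thus be made on the line. *)
Lemma circ_lower (x : R) : 0 < x < 1 -> exists2 c : R, 0 < c <= 1 &
  forall s, 0 <= s <= 1 -> c * `|s - x| <= normc (circ s - circ x).
Proof.
move=> /andP[x0 x1].
have [b hb hb2] : exists2 b : R, 0 < b < 1 & forall s, 0 <= s <= 1 -> `|s - x| <= b.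
  exists (Num.max x (1 - x)).
    by rewrite lt_max x0 gt_max x1 /=; lra.
  move=> s /andP[s0 s1]; rewrite ler_norml le_max; apply/andP; split; last by apply/orP; right; lra.
  by rewrite lerNl opprB le_max; apply/orP; left; lra.
have [c c0 hc] := sin_pi_lower hb.
exists (Num.min c 1); first by rewrite lt_min c0 ltr01 ge_min lexx orbT.
move=> s s01; have -> : circ s - circ x = circ x * (circ (s - x) - 1).
  by rewrite mulrBr mulr1 -circD (addrC x) subrK.
rewrite ncM nc_circ mul1r nc_circ_sub1.
have h := hc `|s - x|; rewrite normr_ge0 hb2 // in h.
apply: (@le_trans _ _ (c * `|s - x|)); first by rewrite ler_wpM2r // ge_min lexx.
have -> : `|sin (pi * (s - x))| = `|sin (pi * `|s - x|)|.
  have [h0|h0] := leP 0 (s - x); first by rewrite (ger0_norm h0).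
  by rewrite (ltr0_norm h0) mulrN sinN normrN.
apply: (le_trans (h isT)); apply: (le_trans (ler_norm _)).
by rewrite mulr_natl mulr2n lerDl.
Qed.

Definition poisson (z : C) (t : R) : R := (1 - normc z ^+ 2) / normc (1 - z * (circ t)^*) ^+ 2.

Lemma poissonE (z : C) (t : R) : in_disk z ->
  (poisson z t)%:C = (1 - z * (circ t)^*)^-1 + z^* * circ t * ((1 - z * (circ t)^*)^-1)^*.
Proof.
move=> z1; set w := 1 - z * (circ t)^*.
have w0 : w != 0 by exact: ker_neq0.
have wJ : w^* = 1 - z^* * circ t by rewrite /w conjcB conjcM conjcK conjc1.
have wJ0 : w^* != 0 by rewrite conjc_eq0.
rewrite /poisson RCM RCV -!/w -nc_mulJ conjc_inv.
have -> : (1 - normc z ^+ 2)%:C = w^* + z^* * circ t * w.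
  rewrite wJ /w RCB -nc_mulJ mulrBr mulr1.
  have -> : z^* * circ t * (z * (circ t)^*) = z * z^* * (circ t * (circ t)^*) by ring.
  by rewrite circMJ; ring.
by field; rewrite w0 wJ0.
Qed.

(** The conjugate half of the Poisson kernel is a series of positive powers of tau,
    and u annihilates each of them. *)
Lemma anti_zero u (z : C) : cintg I01 u -> in_disk z ->
  (forall n, (0 < n)%N -> cint I01 (fun t => u t * circ t ^+ n) = 0) ->
  cint I01 (fun t => u t * (z^* * circ t * ((1 - z * (circ t)^*)^-1)^*)) = 0.
Proof.
move=> hu z1 h0; set I := cint _ _.
have hz : 0 <= normc z < 1 by rewrite nc_ge0.
suff h N : normc I <= normc z ^+ N * ((1 - normc z)^-1 * norm1 u).
  apply/eqP; rewrite -nc_eq0 eq_le nc_ge0 andbT.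
  have /cvgP hc := geom_cvg0 ((1 - normc z)^-1 * norm1 u) hz.
  have <- := cvg_lim (@norm_hausdorff _ _) (geom_cvg0 ((1 - normc z)^-1 * norm1 u) hz).
  by apply: limr_ge => //; apply: nearW.
pose w t := z^* * @circ R t.
have wE t : ((1 - z * (circ t)^*)^-1)^* = (1 - w t)^-1.
  by rewrite conjc_inv conjcB conjcM conjcK conjc1.
have w1 t : 1 - w t != 0 by rewrite -[1]conjc1 -[w t]/(z^* * circ t) -[circ t]conjcK -conjcM -conjcB conjc_eq0 ker_neq0.
have mw : cmeas I01 w by apply: cmeasM; [exact: cmeas_cst|exact: cmeas_circ].
have bw t : normc (1 - w t)^-1 <= (1 - normc z)^-1 by rewrite -wE ncJ; exact: ker_bound.
have nw t : normc (w t) = normc z by rewrite ncM ncJ nc_circ mulr1.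
have iw n : cintg I01 (fun t => u t * w t ^+ n).
  apply: (@cintg_circM _ _ _ (normc z ^+ n)) => // [|t _]; first exact: cmeasX.
  by rewrite ncX nw.
have mk : cmeas I01 (fun t => (1 - w t)^-1).
  by apply: cmeasV; apply: cmeasB => //; exact: cmeas_cst.
have ib (n : nat) : cintg I01 (fun t => u t * (w t ^+ n * (1 - w t)^-1)).
  apply: (@cintg_circM _ _ _ (normc z ^+ n * (1 - normc z)^-1)) => // [|t _].
    by apply: cmeasM => //; exact: cmeasX.
  by rewrite ncM ncX nw ler_wpM2l ?exprn_ge0 ?nc_ge0.
have -> : I = cint I01 (fun t => \sum_(0 <= n < N) u t * w t ^+ n.+1) +
    cint I01 (fun t => u t * (w t ^+ N.+1 * (1 - w t)^-1)).
  rewrite -cintD //; last exact: cintg_sum.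
  apply: eq_cint => t _; rewrite wE -/(w t) [in LHS](@geom_id _ _ N (w1 t)) !mulrDr mulr_sumr; congr (_ + _).
    by rewrite mulr_sumr; apply: eq_bigr => n _; rewrite exprS.
  by rewrite exprS !mulrA.
rewrite cint_sum // big1 ?add0r.
  apply: le_trans (nc_cintM_le (K := normc z ^+ N * (1 - normc z)^-1) hu _ _) _ => //.
  - by apply: cmeasM => //; exact: cmeasX.
  - move=> t _; rewrite ncM ncX nw exprS -mulrA.
    apply: (@le_trans _ _ (normc z ^+ N * normc (1 - w t)^-1)).
      by rewrite ler_piMl ?mulr_ge0 ?exprn_ge0 ?nc_ge0 // ltW.
    by rewrite ler_wpM2l ?exprn_ge0 ?nc_ge0.
  - by rewrite mulrA.
move=> n _; rewrite (@eq_cint _ _ _ (fun t => z^* ^+ n.+1 * (u t * circ t ^+ n.+1))).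
  by rewrite cintZ ?h0 ?mulr0 //; exact: cintg_circX.
by move=> t _; rewrite /w exprMn mulrCA.
Qed.

Lemma cmeas_poisson (z : C) : cmeas I01 (fun t => (poisson z t)%:C).
Proof.
apply: cmeas_real; apply: measurable_funM => //.
apply: (@measurableT_comp _ _ _ _ _ _ (fun x : R => x^-1)); first exact: measurable_invr.
apply: measurable_nc2; apply: cmeasB; first exact: cmeas_cst.
by apply: cmeasM; [exact: cmeas_cst|apply: cmeasJ; exact: cmeas_circ].
Qed.

Lemma poisson_ge0 (z : C) t : in_disk z -> 0 <= poisson z t.
Proof.
move=> z1; rewrite divr_ge0 ?exprn_ge0 ?nc_ge0 // subr_ge0 expr_le1 ?nc_ge0 //; exact: ltW.
Qed.

Lemma poisson_ub (z : C) t : in_disk z -> poisson z t <= 2 / (1 - normc z).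
Proof.
move=> z1; have p : 0 < 1 - normc z by rewrite subr_gt0.
have k := ker_lower z t; have n0 := nc_ge0 z.
rewrite /poisson ler_pdivrMr; last by rewrite exprn_gt0 // nc_gt0 ker_neq0.
apply: (@le_trans _ _ (2 / (1 - normc z) * (1 - normc z) ^+ 2)).
  by rewrite expr2 mulrA mulfVK ?gt_eqF //; nra.
by rewrite ler_pM2l ?divr_gt0 // ler_pXn2r ?nnegrE ?nc_ge0 ?(ltW p).
Qed.

Lemma cintg_poisson u (z : C) : cintg I01 u -> in_disk z ->
  cintg I01 (fun t => u t * (poisson z t)%:C).
Proof.
move=> hu z1; apply: (@cintg_circM _ _ _ (2 / (1 - normc z))) => // [|t _].
  exact: cmeas_poisson.
by rewrite ncR ger0_norm ?poisson_ge0 // poisson_ub.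
Qed.

(** Replacing the Cauchy kernel by the positive Poisson kernel makes radial limits
    accessible to a majorant. *)
Lemma cauchy_poisson u (z : C) : cintg I01 u -> in_disk z ->
  (forall n, (0 < n)%N -> cint I01 (fun t => u t * circ t ^+ n) = 0) ->
  cauchy u z = cint I01 (fun t => u t * (poisson z t)%:C).
Proof.
move=> hu z1 h0.
have iz : cintg I01 (fun t => u t * (z^* * circ t * ((1 - z * (circ t)^*)^-1)^*)).
  have := cintgB mI01 (cintg_poisson hu z1) (cintg_ker hu z1).
  by apply: eq_cintg => // t _; rewrite poissonE //; ring.
rewrite -[LHS]addr0 -(anti_zero hu z1 h0) /cauchy -cintD //; last exact: cintg_ker.
by apply: eq_cint => t _; rewrite poissonE //; ring.
Qed.

Lemma poisson_one (z : C) : in_disk z -> cint I01 (fun t => (poisson z t)%:C) = 1.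
Proof.
move=> z1; have i1 : cintg I01 (fun=> 1 : C) by exact: cintg_cst01.
transitivity (cauchy (fun=> 1) z).
  rewrite cauchy_poisson //; first by apply: eq_cint => t _; rewrite mul1r.
  by move=> n n0; rewrite -[RHS](circ_mean R n0); apply: eq_cint => t _; rewrite mul1r.
apply: cto_unique (cauchy_series i1 z1) _.
apply: (near_eq_cto (f := fun=> 1)); last exact: cto_cst.
exists 1%N => // -[//|N] /= _.
rewrite big_nat_recl // big1 ?addr0 => [|n _].
  rewrite expr0 mulr1 /coef (@eq_cint _ _ _ (fun=> 1)) ?cint_cst01 // => t _.
  by rewrite expr0 mulr1.
rewrite /coef (@eq_cint _ _ _ (fun t => (@circ R t)^* ^+ n.+1)) ?circJ_mean ?mul0r // => t _.
by rewrite mul1r.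
Qed.

End RadialLimits.

(** * Fatou's theorem *)

Section Fatou.
Variable R : realType.
Notation C := R[i].
Notation mu := (@lebesgue_measure R).
Notation TR := (measurableTypeR R).
Notation I01 := (`[0%R, 1%R]%classic : set TR).
Implicit Types (u v : TR -> C).

(** A layer-cake bound of the majorant e / max(e, y)^2 by multiples of indicators
    of y < 2^k e up to the scale d. Integrated against |u - u x| with y the
    distance to x, each layer is small at a Lebesgue point, and the coefficients 4
    4^-k / e make the sum over the layers geometric. *)
Lemma layer_bound (e y d : R) N : 0 < e -> 0 <= y -> 0 < d -> d <= 2 ^+ N * e ->
  e / Num.max e y ^+ 2 <=
  \sum_(0 <= k < N.+1) (4 * 4^-1 ^+ k / e) * (y < 2 ^+ k * e)%R%:R + e / d ^+ 2.
Proof.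
move=> e0 y0 d0 dN.
have S0 n : 0 <= \sum_(0 <= k < n) (4 * 4^-1 ^+ k / e) * (y < 2 ^+ k * e)%R%:R.
  apply: sumr_ge0 => k _; apply: mulr_ge0 => //.
  by rewrite divr_ge0 ?mulr_ge0 ?exprn_ge0 ?(ltW e0).
have near n : y < 2 ^+ n * e -> e / Num.max e y ^+ 2 <=
    \sum_(0 <= k < n.+1) (4 * 4^-1 ^+ k / e) * (y < 2 ^+ k * e)%R%:R.
  elim: n => [|n ih].
    rewrite expr0 mul1r => ye; rewrite big_nat1 !expr0 mulr1 mul1r ye mulr1.
    rewrite max_l ?(ltW ye) //; have -> : e / e ^+ 2 = 1 / e by field; rewrite gt_eqF.
    by rewrite ler_pM2r ?invr_gt0 //; lra.
  move=> yn; rewrite big_nat_recr //=; have [h|h] := ltP y (2 ^+ n * e).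
    apply: le_trans (ih h) _; rewrite lerDl; apply: mulr_ge0 => //.
    by rewrite divr_ge0 ?mulr_ge0 ?exprn_ge0 ?(ltW e0).
  apply: ler_wpDl => //; rewrite yn mulr1 max_r; last first.
    apply: le_trans h; rewrite ler_peMl ?(ltW e0) // exprn_ege1 ?ler1n //.
  have p : 0 < 2 ^+ n * e by rewrite mulr_gt0 // exprn_gt0.
  apply: (@le_trans _ _ (e / (2 ^+ n * e) ^+ 2)).
    rewrite ler_pM2l // lef_pV2 ?posrE ?exprn_gt0 //; last exact: lt_le_trans h.
    by rewrite ler_pXn2r ?nnegrE ?(ltW p).
  have -> : 4^-1 ^+ n.+1 = 4^-1 * (2 ^+ n * 2 ^+ n)^-1 :> R.
    by rewrite exprS -exprMn -natrM exprVn.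
  have n2 : 2 ^+ n != 0 :> R by rewrite expf_neq0.
  by rewrite le_eqVlt; apply/orP; left; apply/eqP; field; rewrite n2 gt_eqF.
have [h|h] := ltP y (2 ^+ N * e).
  by apply: le_trans (near _ h) _; rewrite lerDl divr_ge0 ?exprn_ge0 // ltW.
apply: ler_wpDl => //; rewrite ler_pM2l // lef_pV2 ?posrE ?exprn_gt0 //; last first.
  by rewrite lt_max e0.
by rewrite ler_pXn2r ?nnegrE ?(ltW d0) ?le_max ?(ltW e0) // (le_trans dN h) orbT.
Qed.

Lemma layer_exists (e d : R) : 0 < e -> e < d -> exists2 N, d <= 2 ^+ N * e & 2 ^+ N * e < 2 * d.
Proof.
move=> e0 ed; have [n hn] : exists n, d <= 2 ^+ n * e.
  have [n hn] : exists n : nat, d / e <= n%:R.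
    exists (Num.bound (d / e)); apply: ltW; apply: archi_boundP.
    by rewrite divr_ge0 ?(ltW e0) // (le_trans (ltW e0)) // ltW.
  exists n; rewrite -ler_pdivrMr //; apply: le_trans hn _.
  by rewrite -natrX ler_nat; apply: ltnW; exact: ltn_expl.
have ex : exists n, (d <= 2 ^+ n * e)%R by exists n.
case: (ex_minnP ex) => N hN Nmin; exists N => //.
case: N hN Nmin => [|N] hN Nmin; first by rewrite expr0 mul1r; lra.
rewrite exprS -mulrA ltr_pM2l // ltNge; apply/negP => h.
by have := Nmin _ h; rewrite ltnn.
Qed.

Lemma sum_half N : \sum_(0 <= k < N) 2^-1 ^+ k <= 2 :> R.
Proof.
have -> : \sum_(0 <= i < N) 2^-1 ^+ i = 2 - 2 * 2^-1 ^+ N :> R.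
  elim: N => [|n ih]; first by rewrite big_geq // expr0 mulr1 subrr.
  by rewrite big_nat_recr //= ih exprS; field.
by rewrite gerBl mulr_ge0 // exprn_ge0.
Qed.

(** The denominator is bounded below both by 1 - r and by a multiple of the
    distance of s to x. *)
Lemma poisson_majorant (x c : R) : 0 < c <= 1 ->
  (forall s, 0 <= s <= 1 -> c * `|s - x| <= normc (circ s - circ x)) ->
  forall r s, 0 <= r < 1 -> 0 <= s <= 1 ->
  poisson (r%:C * circ x) s <= (8 / c ^+ 2) * ((1 - r) / Num.max (1 - r) `|s - x| ^+ 2).
Proof.
move=> /andP[c0 c1] hc r s /andP[r0 r1] s01; set e := 1 - r.
have e0 : 0 < e by rewrite subr_gt0.
have nz : normc (r%:C * circ x) = r by rewrite ncM ncR nc_circ mulr1 ger0_norm.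
set w := normc (1 - r%:C * circ x * (circ s)^*).
have wE : w = normc (circ s - r%:C * circ x).
  rewrite /w -[LHS]mulr1 -(nc_circ s) -ncM; congr normc.
  have -> : (1 - r%:C * circ x * (circ s)^*) * circ s = circ s - r%:C * circ x * (circ s * (circ s)^*) by ring.
  by rewrite circMJ mulr1.
have w1 : e <= w by rewrite /w; apply: le_trans (ker_lower _ _); rewrite nz.
have w2 : normc (circ s - circ x) <= 2 * w.
  apply: le_trans (nc_triangle _ (r%:C * circ x) _) _; rewrite -wE.
  have -> : normc (r%:C * circ x - circ x) = e.
    have -> : r%:C * circ x - circ x = (r - 1)%:C * circ x by rewrite RCB mulrBl mul1r.
    by rewrite ncM nc_circ mulr1 ncR distrC ger0_norm // ltW.
  by rewrite mulr_natl mulr2n lerD2l.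
set m := Num.max e `|s - x|.
have m0 : 0 < m by rewrite lt_max e0.
have wm : c / 2 * m <= w.
  rewrite /m; have [h|h] := leP e `|s - x|; last first.
    by apply: le_trans w1; rewrite ler_piMl ?(ltW e0) //; lra.
  have := hc s s01; lra.
have w0 : 0 < w by exact: lt_le_trans w1.
rewrite /poisson -/w nz ler_pdivrMr ?exprn_gt0 //.
apply: (@le_trans _ _ (8 / c ^+ 2 * (e / m ^+ 2) * (c / 2 * m) ^+ 2)); last first.
  rewrite ler_pM2l ?mulr_gt0 ?invr_gt0 ?exprn_gt0 //.
  by rewrite ler_pXn2r ?nnegrE ?(ltW w0) ?mulr_ge0 ?(ltW m0) // ltW // divr_gt0.
have -> : 8 / c ^+ 2 * (e / m ^+ 2) * (c / 2 * m) ^+ 2 = 2 * e.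
  by field; rewrite !gt_eqF.
rewrite /e; nra.
Qed.

(** The point x is a Lebesgue point of u when this is o(h). *)
Definition locint u (x h : R) : R :=
  Rintegral mu I01 (fun s => normc (u s - u x) * (`|s - x| < h)%R%:R).

Lemma meas_ball (x h : R) : measurable_fun I01 (fun s : TR => (`|s - x| < h)%R%:R : R).
Proof.
have -> : (fun s : TR => (`|s - x| < h)%R%:R : R) = \1_(ball x h : set TR).
  apply/funext => s; rewrite indicE; congr ((nat_of_bool _)%:R); apply/idP/idP.
    by move=> hs; rewrite inE /ball /= distrC.
  by rewrite inE /ball /= distrC.
by apply: measurable_indic; exact: measurable_ball.
Qed.

Lemma int_locint u (x h : R) : cintg I01 u ->
  mu.-integrable I01 (EFin \o (fun s => normc (u s - u x) * (`|s - x| < h)%R%:R)).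
Proof.
move=> hu; have i0 : cintg I01 (fun s => u s - u x) by apply: cintgB => //; exact: cintg_cst01.
apply: (le_integrable mI01 _ _ (cintg_nc mI01 i0)).
  apply/measurable_EFinP; apply: measurable_funM; last exact: meas_ball.
  by apply: measurable_nc; exact: cintg_meas i0.
move=> s _ /=; rewrite lee_fin ger0_norm ?mulr_ge0 ?nc_ge0 // [leRHS]ger0_norm ?nc_ge0 //.
by rewrite ler_piMr ?nc_ge0 //; case: (_ < _)%R.
Qed.

(** The part of the Poisson kernel within distance d of x is handled by
    [layer_bound]; the rest is at most a constant times 1 - r. *)
Lemma fatou_point u (x : R) : 0 < x < 1 -> cintg I01 u ->
  (forall n, (0 < n)%N -> cint I01 (fun t => u t * circ t ^+ n) = 0) ->
  (forall e : R, 0 < e -> exists2 d : R, 0 < d & forall h, 0 < h < d -> locint u x h <= e * h) ->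
  cto (1 : R)^'- (fun r => cauchy u (r%:C * circ x)) (u x).
Proof.
move=> x01 hu h0 hloc e e0.
have [c c01 hc] := circ_lower x01; have /andP[c0 c1] := c01.
have i0 : cintg I01 (fun s => u s - u x) by apply: cintgB => //; exact: cintg_cst01.
pose A := norm1 (fun s => u s - u x).
have A0 : 0 <= A by exact: norm1_ge0.
pose K := 8 / c ^+ 2; have K0 : 0 < K by rewrite divr_gt0 // exprn_gt0.
pose eta := e / (32 * K); have eta0 : 0 < eta by rewrite divr_gt0 // mulr_gt0.
have [d1 d10 hd1] := hloc eta eta0; pose d := d1 / 2.
have d0 : 0 < d by rewrite divr_gt0.
pose B := K * (A + 1) / d ^+ 2; have B0 : 0 < B.
  by rewrite divr_gt0 ?exprn_gt0 // mulr_gt0 // ltr_wpDl.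
pose eps0 := Num.min (Num.min d 1) (e / (2 * B)).
have eps00 : 0 < eps0 by rewrite !lt_min d0 ltr01 divr_gt0 // mulr_gt0.
exists eps0 => //= r hr r1.
have e1 : 0 < 1 - r by rewrite subr_gt0.
have : 1 - r < eps0 by move: hr; rewrite /ball_ /= ger0_norm // ltW.
rewrite !lt_min => /andP[/andP[ed er1] eB]; set ep := 1 - r in e1 ed er1 eB *.
have r0 : 0 <= r by rewrite /ep in er1; lra.
have z1 : in_disk (r%:C * circ x) by apply: in_diskM; rewrite r0.
rewrite cauchy_poisson //.
have -> : cint I01 (fun t => u t * (poisson (r%:C * circ x) t)%:C) - u x =
    cint I01 (fun t => (u t - u x) * (poisson (r%:C * circ x) t)%:C).
  rewrite -[X in _ - X]mulr1 -(poisson_one z1) -cintZ //; last first.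
    have := cintg_poisson (cintg_cst01 1) z1.
    by apply: eq_cintg => // t _; rewrite mul1r.
  rewrite -cintB //; last first.
    have := cintg_poisson (cintg_cst01 (u x)) z1; exact.
  - exact: cintg_poisson.
  - by apply: eq_cint => t _; rewrite mulrBl.
have [N dN N2] := layer_exists e1 ed.
have ip := cintg_poisson i0 z1.
apply: le_lt_trans (nc_cint mI01 ip) _.
pose T k (s : TR) := 4 * 4^-1 ^+ k / ep * (normc (u s - u x) * (`|s - x| < 2 ^+ k * ep)%R%:R).
have iT k : mu.-integrable I01 (EFin \o T k) by apply: integrableZlR => //; exact: int_locint.
have iS n : mu.-integrable I01 (EFin \o (fun s => \sum_(0 <= k < n) T k s)).
  elim: n => [|n ih].
    by apply: eq_integrable (integrable_cst01 0) => // s _ /=; rewrite big_geq.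
  apply: eq_integrable (integrableDR mI01 ih (iT n)) => // s _ /=.
  by rewrite big_nat_recr.
pose G (s : TR) := K * (\sum_(0 <= k < N.+1) T k s + ep / d ^+ 2 * normc (u s - u x)).
have iG0 : mu.-integrable I01 (EFin \o (fun s => ep / d ^+ 2 * normc (u s - u x))).
  by apply: (@integrableZlR _ _ mI01 (ep / d ^+ 2) _ (cintg_nc mI01 i0)).
have iG1 := integrableDR mI01 (iS N.+1) iG0.
have iG : mu.-integrable I01 (EFin \o G) by exact: integrableZlR.
apply: (@le_lt_trans _ _ (Rintegral mu I01 G)).
  apply: le_Rintegral => //; first exact: cintg_nc.
  move=> s; rewrite /= in_itv /= => s01.
  rewrite ncM ncR ger0_norm ?poisson_ge0 // mulrC.
  have r01 : 0 <= r < 1 by rewrite r0.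
  have h1 := poisson_majorant c01 hc r01 s01.
  have h2 := layer_bound e1 (normr_ge0 (s - x)) d0 dN.
  apply: (@le_trans _ _ (K * (\sum_(0 <= k < N.+1) (4 * 4^-1 ^+ k / ep) * (`|s - x| < 2 ^+ k * ep)%R%:R + ep / d ^+ 2) * normc (u s - u x))).
    by rewrite ler_wpM2r ?nc_ge0 //; apply: le_trans h1 _; rewrite ler_pM2l.
  rewrite /G -mulrA ler_pM2l // mulrDl mulr_suml lerD2r le_eqVlt; apply/orP; left; apply/eqP.
  by apply: eq_bigr => k _; rewrite /T; ring.
rewrite RintegralZl // RintegralD //.
rewrite RintegralZl //; last exact: cintg_nc.
rewrite -/(norm1 _) -/A.
have SE n : Rintegral mu I01 (fun s => \sum_(0 <= k < n) T k s) =
    \sum_(0 <= k < n) 4 * 4^-1 ^+ k / ep * locint u x (2 ^+ k * ep).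
  elim: n => [|n ih].
    rewrite big_geq // -[RHS](mul0r (fine (mu I01))) -Rintegral_cst //.
    by apply: eq_Rintegral => s _; rewrite big_geq.
  rewrite big_nat_recr //= -ih -RintegralZl //; last exact: int_locint.
  rewrite -(RintegralD mI01 (iS n) (iT n)); by apply: eq_Rintegral => s _; rewrite big_nat_recr.
have S1 : Rintegral mu I01 (fun s => \sum_(0 <= k < N.+1) T k s) <= 8 * eta.
  rewrite SE; apply: (@le_trans _ _ (\sum_(0 <= k < N.+1) 4 * eta * 2^-1 ^+ k)).
    rewrite !big_nat; apply: ler_sum => k /andP[_ kN].
    have kp : 0 < 2 ^+ k * ep by rewrite mulr_gt0 // exprn_gt0.
    have kd : 0 < 2 ^+ k * ep < d1.
      rewrite kp /=; apply: (@le_lt_trans _ _ (2 ^+ N * ep)).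
        by rewrite ler_pM2r // ler_weXn2l // ler1n.
      by move: N2; rewrite /d; lra.
    apply: (@le_trans _ _ (4 * 4^-1 ^+ k / ep * (eta * (2 ^+ k * ep)))).
      rewrite ler_wpM2l ?hd1 // divr_ge0 ?mulr_ge0 ?exprn_ge0 ?(ltW e1) //.
    have -> : 4^-1 ^+ k = (2^-1 ^+ k) * (2^-1 ^+ k) :> R by rewrite -exprMn -invfM -natrM.
    have n2 : 2 ^+ k != 0 :> R by rewrite expf_neq0.
    rewrite le_eqVlt; apply/orP; left; apply/eqP; rewrite exprVn; field.
    by rewrite n2 gt_eqF.
  by rewrite -mulr_sumr; have := sum_half N.+1; nra.
apply: (@le_lt_trans _ _ (K * (8 * eta + ep / d ^+ 2 * A))).
  by rewrite ler_pM2l // lerD2r.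
rewrite mulrDr.
have -> : K * (8 * eta) = e / 4 by rewrite /eta; field; rewrite gt_eqF.
have : K * (ep / d ^+ 2 * A) <= ep * B.
  have -> : K * (ep / d ^+ 2 * A) = ep * (K * A / d ^+ 2) by field; rewrite gt_eqF.
  rewrite ler_pM2l // /B ler_pM2r ?invr_gt0 ?exprn_gt0 // ler_pM2l //; lra.
have : ep * B < e / 2.
  have -> : e / 2 = e / (2 * B) * B by field; rewrite gt_eqF.
  by rewrite ltr_pM2r.
lra.
Qed.

Lemma lebesgue_locint u (x : R) : 0 < x < 1 -> cintg I01 u ->
  lebesgue_pt ((fun t => complex.Re (u t)) \_ I01) x ->
  lebesgue_pt ((fun t => complex.Im (u t)) \_ I01) x ->
  forall e : R, 0 < e -> exists2 d : R, 0 < d & forall h, 0 < h < d -> locint u x h <= e * h.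
Proof.
move=> /andP[x0 x1] hu L1 L2 e e0.
pose d0 := Num.min x (1 - x).
have d00 : 0 < d0 by rewrite lt_min x0 subr_gt0.
have bI h : h < d0 -> (ball x h : set TR) `<=` I01.
  move=> hd0 s; rewrite /ball /= /ball_ /= in_itv /= distrC ltr_distl => /andP[s1 s2].
  by move: hd0; rewrite lt_min => /andP[? ?]; apply/andP; split; lra.
have Ix : I01 x by rewrite /= in_itv /= !ltW.
clearbody d0.
have aux (f : TR -> R) : mu.-integrable I01 (EFin \o f) -> lebesgue_pt (f \_ I01) x ->
   exists2 d : R, 0 < d & forall h, 0 < h < d -> h < d0 ->
     Rintegral mu (ball x h : set TR) (fun s => `|f s - f x|) <= e / 2 * h.
  move=> hf L; have e4 : 0 < e / 4 by rewrite divr_gt0.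
  have /fine_cvgP[L1' /cvgrPdist_lt/(_ _ e4) L2'] := L.
  have [d /= dp hd] := filterI L1' L2'; exists d => // h /andP[h0 hd1] hd0.
  have := hd h; rewrite /= sub0r normrN (ger0_norm (ltW h0)) => /(_ hd1 h0) [fin].
  rewrite sub0r normrN => /(le_lt_trans (ler_norm _)) /ltW h3.
  have : (davg (f \_ I01) x h <= (e / 4)%:E)%E by rewrite -(fineK fin) lee_fin.
  have muB : mu (ball x h : set TR) = (h *+ 2)%:E by exact: lebesgue_measure_ball (ltW h0).
  have h2 : 0 < h *+ 2 by rewrite mulr2n addr_gt0.
  rewrite /davg /iavg [X in (X^-1 * _ <= _)%E -> _]muB inver gt_eqF // muleC -lee_pdivlMr ?invr_gt0 //.
  rewrite (eq_integral (fun s => `|f s - f x|%:E)); last first.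
    move=> s /set_mem sB; rewrite abse_EFin /= !patchE mem_set ?mem_set //.
    exact: bI sB.
  rewrite invrK -EFinM => le1; rewrite -lee_fin fineK; last first.
    rewrite ge0_fin_numE; first by apply: le_lt_trans le1 _; rewrite ltry.
    by apply: integral_ge0 => s _; rewrite lee_fin.
  apply: le_trans le1 _; rewrite lee_fin -mulr_natr; lra.
have [hR hI] := hu.
have [da da0 ha] := aux _ hR L1; have [db db0 hb] := aux _ hI L2.
exists (Num.min (Num.min da db) d0); first by rewrite !lt_min da0 db0.
move=> h /andP[h0]; rewrite !lt_min => /andP[/andP[hda hdb] hd0].
have mB : measurable (ball x h : set TR) by exact: measurable_ball.
have -> : locint u x h = Rintegral mu (ball x h : set TR) (fun s => normc (u s - u x)).
  have -> : (ball x h : set TR) = I01 `&` ball x h by rewrite setIidr //; exact: bI.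
  rewrite Rintegral_mkcondr; apply: eq_Rintegral => s _; rewrite patchE.
  have -> : (s \in (ball x h : set TR)) = (`|s - x| < h)%R.
    by apply/idP/idP; rewrite inE /ball /= distrC.
  by case: (`|s - x| < h)%R; rewrite ?mulr1 ?mulr0.
have i0 : cintg I01 (fun s => u s - u x) by apply: cintgB => //; exact: cintg_cst01.
have [i1 i2] := i0.
have j0 := integrableS mI01 mB (bI _ hd0) (cintg_nc mI01 i0).
have j1 := integrable_abse (integrableS mI01 mB (bI _ hd0) i1).
have j2 := integrable_abse (integrableS mI01 mB (bI _ hd0) i2).
apply: (@le_trans _ _ (Rintegral mu (ball x h : set TR)
   (fun s => `|complex.Re (u s) - complex.Re (u x)| + `|complex.Im (u s) - complex.Im (u x)|))).
  apply: le_Rintegral => //.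
    apply: eq_integrable (integrableD mB j1 j2) => // s _ /=.
    by rewrite -EFinD ReD ImD ReN ImN.
  by move=> s _; apply: le_trans (nc_ReIm _) _; rewrite ReD ImD ReN ImN.
rewrite RintegralD //; last 2 first.
- by apply: eq_integrable j1 => // s _ /=; rewrite ReD ReN.
- by apply: eq_integrable j2 => // s _ /=; rewrite ImD ImN.
have := ha h; rewrite h0 hda => /(_ isT hd0) k1.
have := hb h; rewrite h0 hdb => /(_ isT hd0) k2.
by apply: le_trans (lerD k1 k2) _; rewrite -mulrDl -splitr.
Qed.

Lemma aeS2 (P Q S : TR -> Prop) : (forall x, P x -> Q x -> S x) ->
  {ae mu, forall x, P x} -> {ae mu, forall x, Q x} -> {ae mu, forall x, S x}.
Proof. exact: (@filterS2 _ _ (ae_filter_ringOfSetsType mu)). Qed.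

Lemma ae_I01_interior : {ae mu, forall t : TR, I01 t -> 0 < t < 1}.
Proof.
exists ([set 0] `|` [set 1]); split.
- by apply: measurableU; exact: measurable_set1.
- apply: countable_lebesgue_measure0; exact: finite_set_countable (finite_set2 _ _).
move=> t /= /not_implyP[]; rewrite in_itv /= => /andP[t0 t1] /negP.
rewrite negb_and -!leNgt => /orP[h|h]; [left|right]; apply/eqP; rewrite eq_le.
  by rewrite h t0.
by rewrite h t1.
Qed.

(** Almost every point is a Lebesgue point of the real and of the imaginary part. *)
Theorem fatou_radial u : cintg I01 u ->
  (forall n, (0 < n)%N -> cint I01 (fun t => u t * circ t ^+ n) = 0) ->
  {ae mu, forall t, I01 t -> cto (1 : R)^'- (fun r => cauchy u (r%:C * circ t)) (u t)}.
Proof.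
move=> hu h0; have [hR hI] := hu.
have aux (f : TR -> R) : mu.-integrable I01 (EFin \o f) -> {ae mu, forall t, lebesgue_pt (f \_ I01) t}.
  move=> hf; apply: lebesgue_differentiation; apply: open_integrable_locally; first exact: openT.
  have := (integrable_mkcond (EFin \o f) mI01).1 hf; by rewrite restrict_EFin.
have h1 := aux _ hR; have h2 := aux _ hI.
have h3 := aeS2 (fun t a b => conj a b) h1 h2.
apply: (aeS2 _ h3 ae_I01_interior) => t [L1 L2] h It.
exact: (fatou_point (h It) hu h0 (lebesgue_locint (h It) hu L1 L2)).
Qed.

End Fatou.

(** * Boundary functions of the Hardy space *)

Section HardySpace.
Variable R : realType.
Notation C := R[i].
Notation mu := (@lebesgue_measure R).
Notation TR := (measurableTypeR R).
Notation I01 := (`[0%R, 1%R]%classic : set TR).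
Implicit Types (u v : TR -> C) (F : C -> C) (a : nat -> C).

Hint Resolve mI01 muI01_fin : core.

Definition trig a m N (t : TR) : C := \sum_(m <= n < N) a n * circ t ^+ n.

Lemma L2_circX n : L2 (fun t : TR => circ t ^+ n : C).
Proof. by apply: (@L2_bounded _ _ 1) => [|t _]; [exact: cmeas_circX|rewrite nc_circX]. Qed.

Lemma L2_circJX n : L2 (fun t : TR => (circ t)^* ^+ n : C).
Proof.
by apply: (@L2_bounded _ _ 1) => [|t _]; [exact: cmeas_circJX|rewrite -conjcX ncJ nc_circX].
Qed.

Lemma L2_trig a m N : L2 (trig a m N).
Proof. by apply: L2_sum => n; apply: L2Z; exact: L2_circX. Qed.

Lemma n2C u : L2 u -> (n2 u)%:C = cint I01 (fun t => u t * (u t)^*).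
Proof.
move=> hu; rewrite /cint /n2; apply: eq_ReIm => /=.
  by apply: eq_Rintegral => t _; rewrite nc_mulJ.
rewrite -[LHS](mul0r (fine (mu I01))) -Rintegral_cst //.
by apply: eq_Rintegral => t _; rewrite nc_mulJ.
Qed.

Lemma cintJ u : cintg I01 u -> cint I01 (fun t => (u t)^*) = (cint I01 u)^*.
Proof.
move=> [hR hI]; rewrite /cint; apply: eq_ReIm => /=.
  by apply: eq_Rintegral => t _; rewrite ReJ.
rewrite -mulN1r -RintegralZl //.
by apply: eq_Rintegral => t _; rewrite ImJ mulN1r.
Qed.

Lemma cintgJ u : cintg I01 u -> cintg I01 (fun t => (u t)^*).
Proof.
move=> hu; have := cintg_nc mI01 hu => h.
apply: (cintg_le mI01 _ h); first by apply: cmeasJ; exact: cintg_meas hu.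
by move=> t _; rewrite ncJ.
Qed.

Lemma cint_trigJ u a m N : L2 u ->
  cint I01 (fun t => u t * (trig a m N t)^*) = \sum_(m <= n < N) (a n)^* * coef u n.
Proof.
move=> hu.
rewrite (@eq_cint _ _ _ (fun t => \sum_(m <= n < N) (a n)^* * (u t * (circ t)^* ^+ n))); last first.
  move=> t _; rewrite /trig rmorph_sum /= mulr_sumr; apply: eq_bigr => n _.
  by rewrite conjcM conjcX; ring.
rewrite cint_sum // => [|n]; last by apply: cintgZ => //; apply: L2_cintgM => //; exact: L2_circJX.
by apply: eq_bigr => n _; rewrite cintZ //; apply: L2_cintgM => //; exact: L2_circJX.
Qed.

Lemma coef_trig a m N n : coef (trig a m N) n = if (m <= n < N)%N then a n else 0.
Proof.
rewrite /coef (@eq_cint _ _ _ (fun t => \sum_(m <= k < N) a k * (circ t ^+ k * (circ t)^* ^+ n))); last first.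
  by move=> t _; rewrite /trig mulr_suml; apply: eq_bigr => k _; ring.
rewrite cint_sum // => [|k]; last first.
  by apply: cintgZ => //; apply: L2_cintgM; [exact: L2_circX|exact: L2_circJX].
rewrite (eq_bigr (fun k => a k * (k == n)%:R)); last first.
  move=> k _; rewrite cintZ //; last by apply: L2_cintgM; [exact: L2_circX|exact: L2_circJX].
  by rewrite circ_orth.
case: ifP => h.
  rewrite (bigD1_seq n) ?iota_uniq ?mem_index_iota //= eqxx mulr1 big1 ?addr0 //.
  by move=> k /negbTE->; rewrite mulr0.
rewrite big_nat big1 // => k hk; case: eqP => [kn|]; rewrite ?mulr0 //.
by move: h; rewrite -kn hk.
Qed.

Lemma trig_anti a m N n : (0 < n)%N -> cint I01 (fun t => trig a m N t * circ t ^+ n) = 0.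
Proof.
move=> n0; rewrite (@eq_cint _ _ _ (fun t => \sum_(m <= k < N) a k * circ t ^+ (k + n))); last first.
  by move=> t _; rewrite /trig mulr_suml; apply: eq_bigr => k _; rewrite exprD; ring.
rewrite cint_sum // => [|k]; last by apply: cintgZ => //; apply: L2_cintg; exact: L2_circX.
rewrite big1 // => k _; rewrite cintZ //; last by apply: L2_cintg; exact: L2_circX.
by rewrite circ_mean ?mulr0 // addn_gt0 n0 orbT.
Qed.

Lemma n2_trig a m N : n2 (trig a m N) = \sum_(m <= n < N) normc (a n) ^+ 2.
Proof.
apply: (congr1 (@complex.Re R) (_ : (n2 (trig a m N))%:C = (\sum_(m <= n < N) normc (a n) ^+ 2)%:C)).
rewrite n2C; last exact: L2_trig.
rewrite cint_trigJ; last exact: L2_trig.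
rewrite rmorph_sum /= !big_nat; apply: eq_bigr => n h.
by rewrite coef_trig h mulrC nc_mulJ.
Qed.

Lemma bessel u N : L2 u -> \sum_(0 <= n < N) normc (coef u n) ^+ 2 <= n2 u.
Proof.
move=> hu; pose S := trig (coef u) 0 N; have hS : L2 S by exact: L2_trig.
have hD := L2B hu hS.
have i1 := L2_cintgM hu (L2J hu); have i2 := L2_cintgM hu (L2J hS).
have i4 := L2_cintgM hS (L2J hS).
have E : cint I01 (fun t => u t * (S t)^*) = (\sum_(0 <= n < N) normc (coef u n) ^+ 2)%:C.
  rewrite cint_trigJ // rmorph_sum /=; apply: eq_bigr => n _.
  by rewrite mulrC nc_mulJ.
have : (n2 (fun t => u t - S t))%:C = (n2 u - \sum_(0 <= n < N) normc (coef u n) ^+ 2)%:C.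
  rewrite n2C // (@eq_cint _ _ _ (fun t => u t * (u t)^* - u t * (S t)^* - ((u t * (S t)^*)^* - S t * (S t)^*))); last first.
    by move=> t _; rewrite conjcB conjcM conjcK; ring.
  have i3 := cintgJ i2.
  rewrite cintB //; [|exact: cintgB|exact: cintgB].
  rewrite cintB // cintB // cintJ // E -!n2C // n2_trig RCB.
  have -> : ((\sum_(0 <= n < N) normc (coef u n) ^+ 2)%:C)^* = (\sum_(0 <= n < N) normc (coef u n) ^+ 2)%:C :> C.
    by apply: eq_ReIm => //=; rewrite oppr0.
  ring.
move=> /(congr1 (@complex.Re R)) /= h.
by rewrite -subr_ge0 -h n2_ge0.
Qed.

Lemma ae_cont_eq (f g : TR -> C) : (forall t : R, cto (nbhs t) (f : R -> C) (f t)) ->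
  (forall t : R, cto (nbhs t) (g : R -> C) (g t)) ->
  {ae mu, forall t, I01 t -> f t = g t} -> forall t, I01 t -> f t = g t.
Proof.
move=> cf cg [N [mN N0 hN]] t0; rewrite /= in_itv /= => /andP[t0ge t0le].
apply/eqP/negPn/negP => ne.
have p : 0 < normc (f t0 - g t0) by rewrite nc_gt0 subr_eq0.
have cD : cto (nbhs (t0 : R)) (fun t => f t - g t) (f t0 - g t0) by exact: ctoB.
have [d /= d0 hd] := cD _ p.
pose x := Num.max 0 (t0 - d); pose y := Num.min 1 (t0 + d).
have xy : x < y by rewrite /x /y lt_min !gt_max; apply/andP; split; apply/andP; split; lra.
have sub : (`]x, y[%classic : set TR) `<=` N.
  move=> s; rewrite /= in_itv /= /x /y gt_max lt_min => /andP[/andP[s0 s1] /andP[s2 s3]].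
  apply: hN => /= h; have : f s = g s by apply: h; rewrite in_itv /= !ltW.
  move=> E; have /hd : ball_ Num.Def.normr (t0 : R) d s by rewrite /ball_ /= ltr_distlC; apply/andP; split; lra.
  by rewrite /= E subrr sub0r ncN ltxx.
have : (mu (`]x, y[%classic : set TR) <= mu N)%E by apply: le_measure => //; rewrite ?inE.
by rewrite N0 lebesgue_measure_itv /= lte_fin xy -EFinB lee_fin; lra.
Qed.

Lemma circ_surj (z : C) : normc z = 1 -> exists2 t : R, 0 <= t <= 1 & z = circ t.
Proof.
move=> z1; have E : complex.Re z ^+ 2 + complex.Im z ^+ 2 = 1 by rewrite -nc_sqr z1 expr1n.
have p0 : 0 < pi :> R := pi_gt0 R.
have h : -1 <= complex.Re z <= 1 by rewrite -ler_norml; apply: le_trans (Re_nc z) _; rewrite z1.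
have hc := acosK h.
have a0 := acos_ge0 h; have a1 := acos_lepi h.
have p2 : 2 * pi * (acos (complex.Re z) / (2 * pi)) = acos (complex.Re z).
  by rewrite mulrC divfK // mulf_neq0 // gt_eqF.
have hs := sin_acos h.
have sE : Num.sqrt (1 - complex.Re z ^+ 2) = `|complex.Im z|.
  by rewrite -sqrtr_sqr; congr Num.sqrt; lra.
set s := acos (complex.Re z) / (2 * pi) in p2.
have s01 : 0 <= s <= 1.
  rewrite /s divr_ge0 ?mulr_ge0 ?(ltW p0) //= ler_pdivrMr ?mulr_gt0 //; lra.
have [i0|i0] := leP 0 (complex.Im z).
  exists s => //; rewrite /circ p2 hc hs sE ger0_norm //; by case: z {z1 E h hc a0 a1 hs sE s p2 s01 i0}.
exists (1 - s); first by lra.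
rewrite -circJ /circ p2 hc hs sE ltr0_norm //=; case: z {z1 E h hc a0 a1 hs sE s p2 s01 i0} => *.
by rewrite opprK.
Qed.

Lemma polar (z : C) : exists2 t : R, 0 <= t <= 1 & z = (normc z)%:C * circ t.
Proof.
have [->|z0] := eqVneq z 0; first by exists 0; [lra|rewrite nc0 mul0r].
have zp : normc z != 0 by rewrite nc_eq0.
have [|t t01 ht] := @circ_surj (z / (normc z)%:C).
  by rewrite ncM ncV ncR ger0_norm ?nc_ge0 // divff.
exists t => //; rewrite -ht mulrCA divff ?mulr1 //.
by apply: contra zp => /eqP/(congr1 (@complex.Re R))/= ->.
Qed.

Lemma continuous_disk F z : derivable (F : C^o -> C^o) z 1 ->
  cto (nbhs (z : C^o)) (F : C^o -> C) (F z).
Proof.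
move=> h e e0; have [d d0 hd] := holo_cont h e0; apply/nbhsC; exists d => // w hw.
by have := hd _ hw; rewrite subrKC.
Qed.

Lemma radial_cont F z : derivable (F : C^o -> C^o) z 1 -> in_disk z ->
  cto (1 : R)^'- (fun s => F (s%:C * z)) (F z).
Proof.
move=> hF hz e e0; have [d d0 hd] := holo_cont hF e0.
exists d => //= s hs _; have := hd ((s - 1)%:C * z).
rewrite RCB mulrBl mul1r subrKC; apply.
have -> : s%:C * z - z = (s - 1)%:C * z by rewrite RCB mulrBl mul1r.
rewrite ncM ncR; apply: le_lt_trans (_ : `|s - 1| < d); last by rewrite distrC.
by rewrite ler_piMr // ltW.
Qed.

Lemma coef_bound u n : L2 u -> normc (coef u n) ^+ 2 <= n2 u.
Proof.
move=> hu; apply: le_trans (bessel n.+1 hu).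
by rewrite big_nat_recr //= lerDr sumr_ge0 // => k _; rewrite exprn_ge0 // nc_ge0.
Qed.

(** The n-th moment is the Fourier coefficient of index -n. *)
Definition analytic u := forall n, (0 < n)%N -> cint I01 (fun t => u t * circ t ^+ n) = 0.

Lemma analytic_bound u n : L2 u -> normc (cint I01 (fun t => u t * circ t ^+ n)) ^+ 2 <= n2 u.
Proof.
move=> hu; have -> : cint I01 (fun t => u t * circ t ^+ n) = (coef (fun t => (u t)^*) n)^*.
  rewrite /coef -cintJ.
    by apply: eq_cint => t _; rewrite conjcM conjcX !conjcK.
  by apply: L2_cintgM; [exact: L2J|exact: L2_circJX].
by rewrite ncJ -(n2J u); apply: coef_bound; exact: L2J.
Qed.

(** Letting the radius tend to 1 in Bessel's inequality on circles of radius r < 1. *)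
Lemma taylor_bound (M : R) a : 0 <= M ->
  (forall r, 0 < r < 1 -> forall N, \sum_(0 <= n < N) normc (r%:C ^+ n * a n) ^+ 2 <= M) ->
  forall N, \sum_(0 <= n < N) normc (a n) ^+ 2 <= M.
Proof.
move=> M0 h N; pose S := \sum_(0 <= n < N) normc (a n) ^+ 2.
have S0 : 0 <= S by apply: sumr_ge0 => n _; rewrite exprn_ge0 // nc_ge0.
have cv : (fun r : R => r ^+ (2 * N) * S) @ (1 : R)^'- --> (1 : R) ^+ (2 * N) * S.
  apply: cvgMr_tmp; apply: cvg_at_left_filter; exact: exprn_continuous.
rewrite -/S -[S]mul1r -{1}(expr1n R (2 * N)).
apply: cvgr_to_le cv _.
near=> r; have r01 : 0 < r < 1 by apply/andP; split; near: r; [exact: nbhs_left_gt|exact: nbhs_left_lt].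
apply: le_trans (h r r01 N); rewrite /S mulr_sumr !big_nat; apply: ler_sum => n /andP[_ nN].
rewrite ncM ncX ncR ger0_norm; last by case/andP: r01 => /ltW.
rewrite exprMn ler_wpM2r ?exprn_ge0 ?nc_ge0 // -exprM.
case/andP: r01 => r0 r1; apply: ler_wiXn2l; rewrite ?(ltW r0) ?(ltW r1) //.
by rewrite mulnC leq_mul2l ltnW.
Unshelve. all: by end_near.
Qed.

Lemma coefB u v n : L2 u -> L2 v -> coef (fun t => u t - v t) n = coef u n - coef v n.
Proof.
move=> hu hv; rewrite /coef -cintB //.
- by apply: eq_cint => t _; rewrite mulrBl.
- by apply: L2_cintgM => //; exact: L2_circJX.
- by apply: L2_cintgM => //; exact: L2_circJX.
Qed.

Lemma momentB u v n : L2 u -> L2 v -> cint I01 (fun t => (u t - v t) * circ t ^+ n) =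
  cint I01 (fun t => u t * circ t ^+ n) - cint I01 (fun t => v t * circ t ^+ n).
Proof.
move=> hu hv; rewrite -cintB //.
- by apply: eq_cint => t _; rewrite mulrBl.
- by apply: L2_cintgM => //; exact: L2_circX.
- by apply: L2_cintgM => //; exact: L2_circX.
Qed.

(** The Taylor coefficients are square summable by Bessel's inequality on every
    circle, and [riesz_fischer] gives u with these Fourier coefficients. On the
    circle of radius r, [fatou_radial] recovers F almost everywhere from the Cauchy
    integral of its restriction, whose power series is that of [cauchy u] after
    dilation by r; continuity removes the exceptional set, and the origin is
    reached by a limit. *)
Theorem hardy2_boundary F : hardy2 F -> exists u, [/\ L2 u, analytic u,
  (forall z, in_disk z -> F z = cauchy u z) &
  {ae mu, forall t, I01 t -> cto (1 : R)^'- (fun r => F (r%:C * circ t)) (u t)}].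
Proof.
move=> [hF [M hM]].
have LF r : 0 <= r < 1 -> L2 (fun t => F (r%:C * circ t)) /\ n2 (fun t => F (r%:C * circ t)) <= M.
  move=> r01; have L : L2 (fun t => F (r%:C * circ t)).
    split; first by exact: cintg_meas (cintg_circle hF r01).
    by apply: le_lt_trans (hM r r01) _; rewrite ltry.
  by split => //; rewrite -lee_fin n2E //; exact: hM.
pose h : R := 2^-1; have h01 : 0 < h < 1 by rewrite /h; lra.
pose a n := (h ^- n)%:C * coef (fun t => F (h%:C * circ t)) n.
have aE r n : 0 < r < 1 -> coef (fun t => F (r%:C * circ t)) n = r%:C ^+ n * a n.
  move=> r01; rewrite /a /coef -(holo_coef n hF r01 h01) mulrA RCX -RCM divff ?mul1r //.
  by rewrite expf_neq0 // gt_eqF //; case/andP: r01.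
have M0 : 0 <= M by have [_] := LF 0 (ltac:(lra)); apply: le_trans; exact: n2_ge0.
have aM : forall N, \sum_(0 <= n < N) normc (a n) ^+ 2 <= M.
  apply: taylor_bound => // r r01 N; have /andP[r0 r1] := r01.
  have [L LM] := LF r (ltac:(by rewrite (ltW r0))).
  by apply: le_trans LM; apply: le_trans (bessel N L); apply: ler_sum => n _; rewrite aE.
pose x n := normc (a n) ^+ 2.
have x0 n : 0 <= x n by rewrite exprn_ge0 // nc_ge0.
have nd : nondecreasing_seq (series x).
  by apply/nondecreasing_seqP => n; rewrite /series /= big_nat_recr //= lerDl.
have cvx : cvgn (series x).
  by apply: nondecreasing_is_cvgn => //; exists M => _ [n _ <-]; exact: aM.
pose s := limn (series x); pose e m := s - series x m.
have e0 : e @ \oo --> 0 by rewrite -(subrr s); apply: cvgB => //; exact: cvg_cst.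
have [||u Lu ue] := @riesz_fischer R (trig a 0) e _ _ e0.
- by move=> n; exact: L2_trig.
- move=> m n mn; rewrite (@eq_n2 _ _ (trig a m n)) => [|t _].
    rewrite n2_trig /e -subr_ge0.
    have <- : s - series x n = s - series x m - \sum_(m <= k < n) normc (a k) ^+ 2.
      by rewrite /series /= (big_cat_nat (n := m) (p := n)) //=; ring.
    by rewrite subr_ge0; exact: nondecreasing_cvgn_le.
  by rewrite /trig (@big_cat_nat _ _ _ m 0 n) //= addrAC subrr add0r.
have lim0 (y : R) (b : C) : (forall m, (y < m%:R)%R -> normc b ^+ 2 <= e m) -> b = 0.
  move=> hb; apply/eqP; rewrite -nc_eq0 -sqrf_eq0 eq_le exprn_ge0 ?nc_ge0 // andbT.
  apply: cvgr_to_ge e0 _; near=> m; apply: hb.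
  near: m; exact: nbhs_infty_gtr.
have cu n : coef u n = a n.
  apply/subr0_eq; apply: (lim0 n%:R) => m; rewrite ltr_nat => nm.
  have L := L2B Lu (L2_trig a 0 m).
  apply: le_trans (ue m); apply: le_trans (coef_bound n L).
  by rewrite coefB ?coef_trig ?nm //; exact: L2_trig.
have au : analytic u.
  move=> n n0; apply: (lim0 0) => m _.
  have L := L2B Lu (L2_trig a 0 m).
  apply: le_trans (ue m); apply: le_trans (analytic_bound n L).
  by rewrite momentB ?trig_anti ?subr0 //; exact: L2_trig.
have iu := L2_cintg Lu; have hC := holo_cauchy iu.
have FC r : 0 < r < 1 -> forall t, I01 t -> F (r%:C * circ t) = cauchy u (r%:C * circ t).
  move=> r01; have r01' : 0 <= r < 1 by case/andP: r01 => /ltW ->.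
  have iF := cintg_circle hF r01'.
  apply: ae_cont_eq => [t|t|]; [exact: circle_cont|exact: circle_cont|].
  have an n : (0 < n)%N -> cint I01 (fun t => F (r%:C * circ t) * circ t ^+ n) = 0.
    by move=> n0; exact: holo_mean_zero.
  apply: filterS (fatou_radial iF an) => t ht It.
  apply: (cto_unique (ht It)).
  apply: near_eq_cto (radial_cont (hC _ (in_diskM t r01')) (in_diskM t r01')).
  near=> p; have p01 : 0 <= p < 1 by apply/andP; split; [apply: ltW|]; near: p; [exact: nbhs_left_gt|exact: nbhs_left_lt].
  have k1 := in_diskM t p01.
  have k2 : in_disk (p%:C * (r%:C * circ t)).
    rewrite mulrCA; move: k1; rewrite /in_disk !ncM !ncR nc_circ !mulr1.
    case/andP: p01 => p0 p1; case/andP: r01 => r0 r1.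
    by rewrite !ger0_norm ?(ltW r0) // => _; nra.
  apply: (cto_unique (cauchy_series iu k2)).
  apply: eq_cto (cauchy_series iF k1) => N; apply: eq_bigr => n _.
  by rewrite aE // cu !exprMn; ring.
have FC1 z : in_disk z -> F z = cauchy u z.
  move=> hz; have [z0|z0] := eqVneq z 0; last first.
    have [t t01 ->] := polar z; apply: FC; rewrite ?nc_gt0 ?z0 //.
  have cF := continuous_disk (hF z hz); have cC := continuous_disk (hC z hz).
  have hr : cto (0 : R)^'+ (fun r => r%:C * circ 0) z.
    rewrite z0 -(mul0r (circ (0 : R))); apply: ctoM; last exact: cto_cst.
    by apply: cto_real; exact: cvg_at_right_filter.
  have c1 (G : C -> C) : cto (nbhs (z : C^o)) (G : C^o -> C) (G z) ->
      cto (0 : R)^'+ (fun r => G (r%:C * circ 0)) (G z).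
    move=> hG eps eps0; have /nbhsC[d d0 hd] := hG eps eps0.
    by apply: filterS (hr d d0) => r; exact: hd.
  apply: (cto_unique (c1 _ cF)); apply: near_eq_cto (c1 _ cC).
  near=> r; apply/esym; apply: FC; last by rewrite /= in_itv /= lexx ler01.
  by apply/andP; split; near: r; [exact: nbhs_right_gt|exact: nbhs_right_lt].
exists u; split => //.
apply: filterS (fatou_radial iu au) => t ht It.
apply: near_eq_cto (ht It); near=> p; rewrite FC1 //; apply: in_diskM.
by apply/andP; split; [apply: ltW|]; near: p; [exact: nbhs_left_gt|exact: nbhs_left_lt].
Unshelve. all: by end_near.
Qed.

End HardySpace.

(** * Products in the Hardy space and measurability of boundary values *)

Section HardyProducts.
Variable R : realType.
Notation C := R[i].
Notation mu := (@lebesgue_measure R).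
Notation TR := (measurableTypeR R).
Notation I01 := (`[0%R, 1%R]%classic : set TR).
Implicit Types (u v : TR -> C) (F G : C -> C).

Hint Resolve mI01 muI01_fin : core.

Lemma circle_L2 F (M r : R) : holo_disk F -> 0 <= r < 1 ->
  (eint_circle (fun tau => (normc (F (r%:C * tau)) ^+ 2)%:E) <= M%:E)%E ->
  L2 (fun t : TR => F (r%:C * circ t)).
Proof.
move=> hF r01 h; split; first exact: cintg_meas (cintg_circle hF r01).
by apply: le_lt_trans h _; rewrite ltry.
Qed.

Lemma hardy2_intro F (M : R) : holo_disk F ->
  (forall r, 0 <= r < 1 -> L2 (fun t : TR => F (r%:C * circ t)) /\
     n2 (fun t : TR => F (r%:C * circ t)) <= M) -> hardy2 F.
Proof.
move=> hF h; split => //; exists M => r r01; have [L LM] := h r r01.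
by rewrite -lee_fin n2E in LM.
Qed.

Lemma n2_bounded u (M : R) : cmeas I01 u -> (forall t, I01 t -> normc (u t) <= M) ->
  L2 u /\ n2 u <= M ^+ 2.
Proof.
move=> mu hM; have L1 : L2 (fun=> 1 : C).
  by apply: (@L2_bounded _ _ 1) => [|t _]; [exact: cmeas_cst|rewrite nc1].
have [h1 h2] := L2M_bounded mu hM L1; rewrite n2_cst1 mulr1 in h2.
split; first by apply: eq_L2 h1 => t _; rewrite mulr1.
by rewrite (@eq_n2 _ _ (fun t => u t * 1)) // => t _; rewrite mulr1.
Qed.

(** The boundary function of such a product is the product of the boundary
    functions, since radial limits multiply. *)
Lemma hardyooM_hardy2 F G : hardyoo G -> hardy2 F -> hardy2 (fun z => G z * F z).
Proof.
move=> [hG [K hK]] [hF [M hM]].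
have K0 : 0 <= K.
  by apply: le_trans (hK 0 _); [exact: nc_ge0|rewrite /in_disk nc0].
apply: (@hardy2_intro _ (K ^+ 2 * M)).
  by move=> z hz; apply: derivable_mulC; [exact: hG|exact: hF].
move=> r r01; have L := circle_L2 hF r01 (hM r r01).
have [|h1 h2] := @L2M_bounded _ _ _ K (cintg_meas mI01 (cintg_circle hG r01)) _ L.
  by move=> t _; exact: hK (in_diskM t r01).
split => //; apply: le_trans h2 _; rewrite ler_wpM2l ?exprn_ge0 //.
by rewrite -lee_fin n2E //; exact: hM.
Qed.

Lemma hardyoo_hardy2 G : hardyoo G -> hardy2 G.
Proof.
move=> [hG [K hK]]; apply: (@hardy2_intro _ (K ^+ 2)) => // r r01.
have cm := cintg_meas mI01 (cintg_circle hG r01).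
by apply: (n2_bounded cm) => t _; exact: hK (in_diskM t r01).
Qed.

Lemma hardyooX n : hardyoo (fun z : C => z ^+ n).
Proof.
split; first by move=> z _; exact: derivable_expC.
by exists 1 => z hz; rewrite ncX exprn_ile1 ?nc_ge0 // ltW.
Qed.

Lemma hardyoo_conj F : hardyoo F -> hardyoo (fun z => (F z^*)^*).
Proof.
move=> [hF [K hK]]; split; last first.
  by exists K => z hz; rewrite ncJ; apply: hK; rewrite /in_disk ncJ.
move=> z hz; apply/derivableC; have := hF z^*; rewrite /in_disk ncJ => /(_ hz)/derivableC[l hl].
exists l^* => e e0; have [d d0 hd] := hl e e0; exists d => // h hh.
have := hd h^*; rewrite ncJ => /(_ hh); rewrite -(ncJ (_ - _ * h)) !conjcB conjcM !conjcK.
by rewrite conjcD.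
Qed.

(** On the circle of radius r the partial sums of the power series converge
    uniformly, and Bessel's inequality bounds their norms. *)
Lemma hardy2_cauchy u : L2 u -> hardy2 (cauchy u).
Proof.
move=> hu; have iu := L2_cintg hu; have hC := holo_cauchy iu.
apply: (@hardy2_intro _ (2 * (1 + n2 u))) => // r r01; have /andP[r0 r1] := r01.
have L : L2 (fun t => cauchy u (r%:C * circ t)).
  apply: (@L2_bounded _ _ ((1 - r)^-1 * norm1 u)); first exact: cintg_meas (cintg_circle hC r01).
  move=> t _; have hz := in_diskM t r01.
  apply: nc_cintM_le => // [|s _]; first exact: cmeas_ker.
  by apply: le_trans (ker_bound s hz) _; rewrite ncM ncR nc_circ mulr1 ger0_norm.
split => //.
have [N hN] : exists N, r ^+ N * ((1 - r)^-1 * norm1 u) <= 1.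
  have := @cvgr_le _ _ _ _ _ _ (@geom_cvg0 _ r ((1 - r)^-1 * norm1 u) r01) 1 ltr01.
  by case=> N _ /(_ N (leqnn N)) hN; exists N.
pose a n := coef u n * (r ^+ n)%:C; pose S := trig a 0 N.
have LS : L2 S by exact: L2_trig.
have LD := L2B L LS.
rewrite (@eq_n2 _ _ (fun t => (cauchy u (r%:C * circ t) - S t) + S t)); last by move=> t _; rewrite subrK.
apply: le_trans (n2D LD LS) _; rewrite ler_pM2l // lerD //.
  rewrite -[leRHS](expr1n R 2); apply: (n2_bounded _ _).2 => [|t _]; first exact: L2_meas LD.
  have hz := in_diskM t r01.
  apply: le_trans hN; have := cauchy_expand N iu hz.
  rewrite ncM ncR nc_circ mulr1 ger0_norm // mulrA; apply: le_trans; rewrite le_eqVlt; apply/orP; left; apply/eqP.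
  by congr (normc (_ - _)); apply: eq_bigr => n _; rewrite /a exprMn RCX; ring.
rewrite n2_trig; apply: le_trans (bessel N hu); apply: ler_sum => n _.
rewrite /a ncM ncR ger0_norm ?exprn_ge0 // exprMn ler_piMr ?exprn_ge0 ?nc_ge0 //.
by rewrite -exprM exprn_ile1 // ltW.
Qed.

Lemma cto_cauchy (T : Type) (F : set_system T) {FF : ProperFilter F} (f : T -> C) :
  (forall e : R, 0 < e -> exists z, \forall s \near F, normc (f s - z) < e) ->
  exists l, cto F f l.
Proof.
move=> h.
have aux (p : C -> R) : (forall x y, p (x - y) = p x - p y) -> (forall x, `|p x| <= normc x) ->
    cvg (p (f s) @[s --> F]).
  move=> pB pn; apply: cauchy_cvg; apply: cauchy_exP => e e0; have [z hz] := h e e0.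
  exists (p z); apply: filterS hz => s hs; rewrite /ball /= -pB; apply: le_lt_trans (pn _) _.
  by rewrite ncdist.
have c1 := aux (@complex.Re R) (fun x y => etrans (ReD _ _) (congr1 _ (ReN _))) (@Re_nc R).
have c2 := aux (@complex.Im R) (fun x y => etrans (ImD _ _) (congr1 _ (ImN _))) (@Im_nc R).
exists (lim (complex.Re (f s) @[s --> F]) +i* lim (complex.Im (f s) @[s --> F])).
by apply/cto_ReIm; split.
Qed.

Lemma bv_cto F (z l : C) : cto (1 : R)^'- (fun r => F (r%:C * z)) l -> bv F z = l.
Proof. by move=> h; apply: cto_lim. Qed.

(** The limit operator returns the default point 0 when there is no limit, so
    boundary values are determined at every point. *)
Lemma bv_dvg F (z : C) : (forall l, ~ cto (1 : R)^'- (fun r => F (r%:C * z)) l) -> bv F z = 0.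
Proof.
move=> h; rewrite /bv dvgP // => /cvg_ex[l /ctoP hl]; exact: h hl.
Qed.

Lemma hardyoo_bv F (M : R) : (forall z, in_disk z -> normc (F z) <= M) -> 0 <= M ->
  forall t : R, normc (bv F (circ t)) <= M.
Proof.
move=> hM M0 t; have [[l hl]|h] := pselect (exists l, cto (1 : R)^'- (fun r => F (r%:C * circ t)) l).
  rewrite (bv_cto hl); apply: cvgr_to_le (cto_nc hl) _; near=> r; apply: hM; apply: in_diskM.
  by apply/andP; split; [apply: ltW|]; near: r; [exact: nbhs_left_gt|exact: nbhs_left_lt].
by rewrite bv_dvg ?nc0 // => l hl; apply: h; exists l.
Unshelve. all: by end_near.
Qed.

Lemma cmeas_if (D E : set TR) u : measurable D -> measurable E -> cmeas D u ->
  cmeas D (fun t => if t \in E then u t else 0).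
Proof.
move=> mD mE hu; apply: (@eq_cmeas _ _ (fun t => (\1_E t)%:C * u t)).
  by move=> t _; rewrite indicE; case: (t \in E); rewrite ?mul1r ?mul0r.
by apply: cmeasM => //; apply: cmeas_real; exact: measurable_indic.
Qed.

(** Where F is continuous, convergence along the radius is a Cauchy criterion over
    rational radii, hence a countable condition; off that set the boundary value is
    0. *)
Lemma cmeas_bv F : (forall z, in_disk z -> forall e : R, 0 < e -> exists2 d : R, 0 < d &
    forall h, normc h < d -> normc (F (z + h) - F z) < e) ->
  cmeas I01 (fun t => bv F (circ t)).
Proof.
move=> cF.
have cFr (r : R) : 0 <= r < 1 -> cmeas I01 (fun t => F (r%:C * circ t)).
  move=> r01; apply: cmeas_continuous => t e e0.
  have [d d0 hd] := cF _ (in_diskM t r01) e e0.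
  have := circ_cont t d0; apply: filterS => s hs.
  have := hd (r%:C * circ s - r%:C * circ t); rewrite subrKC; apply.
  rewrite -mulrBr ncM ncR; apply: le_lt_trans hs; rewrite ler_piMl ?nc_ge0 //.
  by case/andP: r01 => r0 r1; rewrite ger0_norm // ltW.
pose P (k n : nat) (p q : rat) : set TR := [set t | 1 - n.+1%:R^-1 < ratr p :> R -> ratr p < 1 :> R ->
  1 - n.+1%:R^-1 < ratr q :> R -> ratr q < 1 :> R ->
  normc (F ((ratr p)%:C * circ t) - F ((ratr q)%:C * circ t)) <= k.+1%:R^-1].
pose E := \bigcap_k \bigcup_n \bigcap_p \bigcap_q (I01 `&` P k n p q).
have bcr (A : rat -> set TR) : (forall p, measurable (A p)) -> measurable (\bigcap_p A p).
  move=> h; rewrite -(setCK (\bigcap_p A p)) setC_bigcap; apply: measurableC.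
  by apply: bigcupT_measurable_rat => p; exact: measurableC.
have n1 n : 0 <= 1 - n.+1%:R^-1 :> R by rewrite subr_ge0 invf_le1 // ler1n.
have mE : measurable E.
  apply: bigcapT_measurable => k; apply: bigcupT_measurable => n.
  apply: (bcr) => p; apply: (bcr) => q.
  have [[[a1 a2] [b1 b2]]|h] := pselect ((1 - n.+1%:R^-1 < ratr p :> R /\ ratr p < 1 :> R) /\
      (1 - n.+1%:R^-1 < ratr q :> R /\ ratr q < 1 :> R)).
    have -> : I01 `&` P k n p q = I01 `&` [set t | normc (F ((ratr p)%:C * circ t) - F ((ratr q)%:C * circ t)) <= k.+1%:R^-1].
      by apply/seteqP; split => t [It /= h]; split => //=; exact: h.
    have m : measurable_fun I01 (fun t => normc (F ((ratr p)%:C * circ t) - F ((ratr q)%:C * circ t))).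
      apply: measurable_nc; apply: cmeasB => //; apply: cFr; rewrite ?a2 ?b2 andbT.
        exact: le_trans (n1 n) (ltW a1).
      exact: le_trans (n1 n) (ltW b1).
    have := m mI01 `]-oo, k.+1%:R^-1]%classic (measurable_itv _).
    by congr measurable; apply/seteqP; split => t [It /= h]; split => //; move: h; rewrite /= in_itv /=.
  have -> : I01 `&` P k n p q = I01; last exact: mI01.
  by apply/seteqP; split => t; [case|move=> It; split => // ? ? ? ?; case: h].
pose s (n : nat) : R := 1 - n.+1%:R^-1.
have s01 n : 0 <= s n < 1 by rewrite n1 /s gtrBl invr_gt0 ltr0n.
have s1 : s @ \oo --> (1 : R)^'-.
  move=> A [d /= d0 hd]; have := @cvgr_lt _ _ _ _ _ _ (@cvg_harmonic R) d d0.
  case=> N _ hN; exists N => // n /= /hN hn; apply: hd => /=.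
    by rewrite /ball_ /= /s opprB addrC subrK ger0_norm.
  by case/andP: (s01 n).
have EP t : I01 t -> E t <-> exists l, cto (1 : R)^'- (fun r => F (r%:C * circ t)) l.
  move=> It; split.
    move=> Et; apply: cto_cauchy => e e0.
    have [k hk] : exists k, k.+1%:R^-1 < e.
      have := @cvgr_lt _ _ _ _ _ _ (@cvg_harmonic R) e e0.
      by case=> N _ /(_ N (leqnn N)) hN; exists N.
    have [n _ hn] := Et k I.
    have near1 (r : R) (eps : R) : s n < r -> r < 1 -> 0 < eps -> exists q : rat,
        [/\ s n < ratr q :> R, ratr q < 1 :> R & normc (F (r%:C * circ t) - F ((ratr q)%:C * circ t)) < eps].
      move=> r1 r2 eps0; have r01 : 0 <= r < 1.
        by rewrite r2 andbT; apply: le_trans (ltW r1); case/andP: (s01 n).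
      have [d d0 hd] := cF _ (in_diskM t r01) eps eps0.
      have : Num.max (s n) (r - d) < r by rewrite gt_max r1 gtrBl.
      case/rat_in_itvoo => q; rewrite in_itv /= gt_max => /andP[/andP[q1 q2] q3].
      exists q; split => //; first exact: lt_trans q3 r2.
      have := hd ((ratr q)%:C * circ t - r%:C * circ t); rewrite subrKC ncdist; apply.
      rewrite -mulrBl ncM nc_circ mulr1 -RCB ncR ltr0_norm ?subr_lt0 //; lra.
    have [|||q [q1 q2 _]] := near1 ((s n + 1) / 2) 1 => //; [by have := s01 n; lra..|].
    exists (F ((ratr q)%:C * circ t)); near=> r.
    have r1 : s n < r by near: r; apply: nbhs_left_gt; case/andP: (s01 n).
    have r2 : r < 1 by near: r; exact: nbhs_left_lt.
    have [|p [p1 p2 p3]] := near1 r ((e - k.+1%:R^-1)) r1 r2; first by rewrite subr_gt0.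
    apply: le_lt_trans (nc_triangle _ (F ((ratr p)%:C * circ t)) _) _.
    have [_ /(_ p1 p2 q1 q2) h3] := hn p I q I.
    by have := ltr_leD p3 h3; rewrite subrK.
  move=> [l hl] k _; have k0 : 0 < k.+1%:R^-1 / 2 :> R by rewrite divr_gt0.
  have [d /= d0 hd] := hl _ k0.
  have [n hn] : exists n, n.+1%:R^-1 < d.
    have := @cvgr_lt _ _ _ _ _ _ (@cvg_harmonic R) d d0.
    by case=> N _ /(_ N (leqnn N)) hN; exists N.
  exists n => // p _ q _; split => // p1 p2 q1 q2.
  have a (r : R) : 1 - n.+1%:R^-1 < r -> r < 1 -> normc (F (r%:C * circ t) - l) < k.+1%:R^-1 / 2.
    move=> r1 r2; apply: hd => //=; rewrite ger0_norm ?subr_ge0 ?(ltW r2) //.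
    by apply: lt_trans hn; rewrite ltrBlDl -ltrBlDr.
  apply: le_trans (nc_triangle _ l _) _; rewrite (ncdist l).
  by have := ltrD (a _ p1 p2) (a _ q1 q2); rewrite -splitr => /ltW.
apply: (@cmeas_lim _ _ (fun n t => if t \in E then F ((s n)%:C * circ t) else 0)).
  by move=> n; apply: cmeas_if => //; exact: cFr.
move=> t It; case: (boolP (t \in E)) => [|] /=.
  rewrite inE => /(EP t It)[l hl]; rewrite (bv_cto hl).
  by move=> e e0; exact: s1 (hl e e0).
rewrite notin_setE => nE; rewrite bv_dvg; first exact: cto_cst.
by move=> l hl; apply: nE; apply/EP => //; exists l.
Unshelve. all: by end_near.
Qed.

End HardyProducts.

(** * Summable families *)

Section Families.
Variables (R : realType) (N : set R) (w : R -> R).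
Notation C := R[i].
Implicit Types (A B : {fset R}).
Hypothesis w0 : forall x, N x -> 0 <= w x.

Definition wsum A : R := \sum_(x <- A | x \in N) w x.

Lemma big_fset_split (T : Type) (idx : T) (op : Monoid.com_law idx) (P : pred R) (F : R -> T) A B :
  (A `<=` B)%fset ->
  \big[op/idx]_(x <- B | P x) F x =
  op (\big[op/idx]_(x <- A | P x) F x) (\big[op/idx]_(x <- (B `\` A)%fset | P x) F x).
Proof.
move=> AB; rewrite (big_fsetIDcond _ (mem A)); congr (op _ _); apply: eq_fbigl_cond => x; rewrite !inE /=.
  by case xA: (x \in A); rewrite ?andbF // (fsubsetP AB).
by congr (_ && _); rewrite andbC.
Qed.

Lemma wsum_le_esum A : ((wsum A)%:E <= \esum_(x in N) (w x)%:E)%E.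
Proof.
pose X := [set` [fset x in A | x \in N]%fset].
have -> : (wsum A)%:E = (\sum_(x \in X) (w x)%:E)%E.
  by rewrite -fsbig_seq ?fset_uniq //= -sumEFin /wsum big_fset_condE.
apply: ereal_sup_ubound; exists X => //; split; first exact: finite_fset.
by move=> x; rewrite /X /= !inE /= => /andP[_]; rewrite inE.
Qed.

(** For A0 nearly attaining the supremum, the sum over the union of A0 and A
    exceeds the sum over A0 by little. *)
Lemma esum_tail : (\esum_(x in N) (w x)%:E < +oo)%E -> forall e : R, 0 < e ->
  exists A0, forall A, [disjoint A & A0]%fset -> wsum A <= e.
Proof.
move=> fin e e0; set S := (\esum_(x in N) _)%E in fin.
have S0 : (0 <= S)%E by apply: esum_ge0 => x Nx; rewrite lee_fin w0.
have Sf : S \is a fin_num by rewrite ge0_fin_numE.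
have [_ /= [X [fX XN] <-] hX] := ub_ereal_sup_adherent e0 Sf.
have [X0 X0E] := finite_fsetP.1 fX; exists X0 => A dA.
have E : (\sum_(x \in X) (w x)%:E)%E = (wsum X0)%:E.
  rewrite X0E -fsbig_seq ?fset_uniq //= sumEFin /wsum big_seq [in RHS]big_seq_cond.
  congr EFin; apply: eq_bigl => x; case: (boolP (x \in X0)) => //= xX; apply/esym.
  by apply/mem_set/XN; rewrite X0E.
have := wsum_le_esum (X0 `|` A)%fset.
have -> : wsum (X0 `|` A)%fset = wsum X0 + wsum A.
  rewrite /wsum (@big_fset_split _ _ _ _ _ X0) ?fsubsetUl //=; congr (_ + _).
  apply: eq_fbigl_cond => x; rewrite !inE.
  case: (boolP (x \in X0)) => //= xX.
  by case: (boolP (x \in A)) => // xA; move/fdisjointP: dA => /(_ _ xA); rewrite xX.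
have hX' : (S + (- e)%:E < (wsum X0)%:E)%E by rewrite -E; exact: hX.
move: hX'; rewrite -/S -(fineK Sf) -EFinD lte_fin lee_fin; lra.
Qed.

Instance totally_proper : ProperFilter (@summability.totally R).
Proof. exact: summability.totally_filter. Qed.

Lemma sum_totally (f : R -> C) : (\esum_(x in N) (w x)%:E < +oo)%E ->
  (forall x, N x -> normc (f x) <= w x) -> (forall x, ~ N x -> f x = 0) ->
  exists2 l : C, cto (@summability.totally R) (fun A => \sum_(x <- A) f x) l &
    forall M : R, (\esum_(x in N) (w x)%:E <= M%:E)%E -> normc l <= M.
Proof.
move=> fin fw f0.
have fE A : \sum_(x <- A) f x = \sum_(x <- A | x \in N) f x.
  rewrite (bigID (mem N)) /= [X in _ + X]big1 ?addr0 // => x xN; apply: f0.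
  by move=> Nx; move: xN; rewrite notin_setE.
have fb A : normc (\sum_(x <- A) f x) <= wsum A.
  rewrite fE; apply: le_trans (nc_sum _ _ _) _; apply: ler_sum => x xN.
  by apply: fw; rewrite -inE.
have [|l hl] := @cto_cauchy R {fset R} (@summability.totally R) _ (fun A => \sum_(x <- A) f x).
  move=> e e0; have e2 : 0 < e / 2 by rewrite divr_gt0.
  have [A0 h] := esum_tail fin e2; exists (\sum_(x <- A0) f x).
  exists A0 => // A /= A0A.
  rewrite (@big_fset_split _ _ _ xpredT f A0 A A0A) /= addrAC subrr add0r.
  apply: le_lt_trans (fb _) _; apply: le_lt_trans (h _ _) _; last lra.
  by apply/fdisjointP => x; rewrite inE => /andP[].
exists l => // M hM; apply: cvgr_to_le (cto_nc hl) _.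
exists fset0 => // A _ /=; apply: le_trans (fb A) _.
by rewrite -lee_fin; apply: le_trans hM; exact: wsum_le_esum.
Qed.

End Families.

(** * Blaschke products *)

Section Blaschke.
Variable R : realType.
Notation C := R[i].
Notation mu := (@lebesgue_measure R).
Notation TR := (measurableTypeR R).
Notation I01 := (`[0%R, 1%R]%classic : set TR).
Notation bf := (@blaschke_factor R).
Implicit Types (N Z : set R) (A : {fset R}) (x : R) (z w : C).

(** The closed disk without +-1: real zeros with summable 1 - |x| accumulate on the
    circle only at these two points. *)
Definition adm z := normc z <= 1 /\ `|complex.Re z| < 1.
(** A lower bound for |1 - z x|, uniform in real x with |x| < 1 ([gap_lower]); it
    controls the convergence of the product at z. *)
Definition gap z : R := 1 - `|complex.Re z|.

Lemma gap_gt0 z : adm z -> 0 < gap z.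
Proof. by case=> _; rewrite subr_gt0. Qed.

Lemma adm_disk z : in_disk z -> adm z.
Proof. by move=> h; split; [exact: ltW|exact: le_lt_trans (Re_nc z) h]. Qed.

Lemma gap_lower z x : `|x| < 1 -> gap z <= normc (1 - z * x%:C).
Proof.
move=> x1; apply: le_trans (Re_nc _); rewrite ReD ReN ReM /= mulr0 subr0.
apply: le_trans (ler_norm _); rewrite /gap lerD2l lerN2.
apply: le_trans (ler_norm _) _; rewrite normrM ler_piMr //; exact: ltW.
Qed.

Lemma den_neq0 z x : adm z -> `|x| < 1 -> 1 - z * x%:C != 0.
Proof. by move=> hz hx; rewrite -nc_gt0; apply: lt_le_trans (gap_gt0 hz) (gap_lower _ hx). Qed.

Lemma nc_den z x : normc (1 - z * x%:C) ^+ 2 - normc (x%:C - z) ^+ 2 = (1 - x ^+ 2) * (1 - normc z ^+ 2).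
Proof. by case: z => a b; rewrite !nc_sqr !ReD !ImD !ReN !ImN !ReM !ImM /=; ring. Qed.

Lemma nc_bf z x : adm z -> `|x| < 1 -> normc (bf x z) <= 1.
Proof.
move=> hz x1; rewrite /bf; case: eqP => [_|/eqP x0]; first by case: hz.
have d0 := den_neq0 hz x1.
rewrite ncM ncR normrM normfV normr_id divff ?normr_eq0 // mul1r ncM ncV.
rewrite ler_pdivrMr ?nc_gt0 // mul1r -(@ler_pXn2r _ 2) ?nnegrE ?nc_ge0 // -subr_ge0 nc_den.
have [z1 _] := hz; apply: mulr_ge0; rewrite subr_ge0.
  by rewrite -(@real_normK _ x) ?num_real // exprn_ile1 // ltW.
by rewrite exprn_ile1 ?nc_ge0.
Qed.

Lemma nc_bf1 z x : adm z -> normc z = 1 -> `|x| < 1 -> normc (bf x z) = 1.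
Proof.
move=> hz z1 x1; rewrite /bf; case: eqP => [_|/eqP x0] //.
have d0 := den_neq0 hz x1.
rewrite ncM ncR normrM normfV normr_id divff ?normr_eq0 // mul1r ncM ncV.
have /eqP := nc_den z x; rewrite z1 expr1n subrr mulr0 subr_eq0 eqrXn2 ?nc_ge0 // => /eqP <-.
by rewrite divff // nc_eq0.
Qed.

(** For x nonzero of sign s, 1 - b_x(z) = (1 - |x|)(1 + s z) / (1 - z x). *)
Lemma bf_sub1 z x : adm z -> `|x| < 1 -> normc (bf x z - 1) <= 2 / gap z * (1 - `|x|).
Proof.
move=> hz x1; have g0 := gap_gt0 hz; have [z1 z2] := hz.
have g1 : gap z <= 1 by rewrite /gap gerBl.
rewrite /bf; case: eqP => [->|/eqP x0].
  rewrite normr0 subr0 mulr1; apply: le_trans (ncB _ _) _; rewrite nc1.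
  rewrite ler_pdivlMr //; have := nc_ge0 z; nra.
have d0 := den_neq0 hz x1.
pose s : R := `|x| / x.
have s2 : s * x = `|x| by rewrite /s divfK.
have sx : s * `|x| = x by rewrite /s mulrAC -expr2 real_normK ?num_real // expr2 mulfK.
have ns : `|s| = 1 by rewrite /s normrM normfV normr_id divff // normr_eq0.
have -> : s%:C * ((x%:C - z) / (1 - z * x%:C)) - 1 = - ((1 - `|x|)%:C * (1 + s%:C * z) / (1 - z * x%:C)).
  have -> : (1 - `|x|)%:C * (1 + s%:C * z) = (1 - z * x%:C) - s%:C * (x%:C - z).
    by rewrite RCB mulrBr -RCM s2 mulrBl mul1r mulrDr mulr1 mulrA -RCM [_ * s]mulrC sx; ring.
  by field.
rewrite ncN ncM ncV ncM ncR [ `|1 - _| ]ger0_norm ?subr_ge0 ?(ltW x1) //.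
have n1 : normc (1 + s%:C * z) <= 2.
  apply: le_trans (ncD _ _) _; rewrite nc1 ncM ncR ns mul1r; lra.
apply: (@le_trans _ _ ((1 - `|x|) * 2 * (gap z)^-1)); last by rewrite le_eqVlt; apply/orP; left; apply/eqP; ring.
apply: ler_pM; rewrite ?invr_ge0 ?mulr_ge0 ?nc_ge0 ?subr_ge0 ?(ltW x1) //.
  by rewrite ler_wpM2l // subr_ge0 ltW.
by rewrite lef_pV2 ?posrE ?nc_gt0 // gap_lower.
Qed.

Lemma prod_sub1 (r : seq R) (P : pred R) (F : R -> C) (K : R -> R) :
  (forall x, P x -> normc (F x) <= 1 /\ normc (F x - 1) <= K x) ->
  normc (\prod_(x <- r | P x) F x - 1) <= \sum_(x <- r | P x) K x.
Proof.
move=> h; elim: r => [|x r ih]; first by rewrite !big_nil subrr nc0.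
rewrite !big_cons; case: ifP => // Px; have [h1 h2] := h x Px.
have -> : F x * \prod_(j <- r | P j) F j - 1 = (F x - 1) + F x * (\prod_(j <- r | P j) F j - 1) by ring.
apply: le_trans (ncD _ _) _; apply: lerD => //; rewrite ncM; apply: le_trans ih.
by rewrite ler_piMl ?nc_ge0.
Qed.

Definition bprod N A z : C := \prod_(x <- A | x \in N) bf x z.

Lemma zeros_lt1 N x : blaschke_zeros N -> N x -> `|x| < 1.
Proof. by move=> [h _] /h; rewrite /= in_itv /= ltr_norml. Qed.

Lemma zeros_ge0 N x : blaschke_zeros N -> N x -> 0 <= 1 - `|x|.
Proof. by move=> hN Nx; rewrite subr_ge0 ltW // (zeros_lt1 hN). Qed.

Lemma zeros_sub N Z : blaschke_zeros Z -> N `<=` Z -> blaschke_zeros N.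
Proof.
move=> [h1 h2] NZ; split; first exact: subset_trans h1.
apply: le_lt_trans h2; apply: le_ereal_sup => _ [X [fX XN] <-]; exists X => //.
by split => //; exact: subset_trans NZ.
Qed.

Lemma nc_bprod N A z : blaschke_zeros N -> adm z -> normc (bprod N A z) <= 1.
Proof.
move=> hN hz; rewrite nc_prod; apply: prodr_ile1 => x xN; rewrite nc_ge0 /=.
apply: nc_bf => //; apply: (zeros_lt1 hN); exact: set_mem.
Qed.

Lemma bprod_sub1 N A z : blaschke_zeros N -> adm z ->
  normc (bprod N A z - 1) <= 2 / gap z * wsum N (fun x => 1 - `|x|) A.
Proof.
move=> hN hz; rewrite /wsum mulr_sumr; apply: prod_sub1 => x; rewrite inE => Nx.
have x1 := zeros_lt1 hN Nx.
by split; [exact: nc_bf|exact: bf_sub1].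
Qed.

(** The factors have modulus at most 1, so factors outside A0 change the product by
    at most the sum of |b_x - 1|. *)
Lemma bprod_near N (e : R) : blaschke_zeros N -> 0 < e -> exists A0, forall A z,
  (A0 `<=` A)%fset -> adm z -> normc (bprod N A z - bprod N A0 z) <= 2 / gap z * e.
Proof.
move=> hN e0; have [A0 h] := esum_tail (fun x => @zeros_ge0 N x hN) hN.2 e0.
exists A0 => A z A0A hz.
rewrite {1}/bprod (@big_fset_split R _ _ _ _ _ A0 A A0A) /= -/(bprod N A0 z) -/(bprod N (A `\` A0)%fset z).
have -> : bprod N A0 z * bprod N (A `\` A0)%fset z - bprod N A0 z =
    bprod N A0 z * (bprod N (A `\` A0)%fset z - 1) by ring.
rewrite ncM; apply: le_trans (_ : normc (bprod N (A `\` A0)%fset z - 1) <= _).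
  by rewrite ler_piMl ?nc_ge0 // nc_bprod.
apply: le_trans (bprod_sub1 _ hN hz) _.
rewrite ler_pM2l ?divr_gt0 ?gap_gt0 //; apply: h.
by apply/fdisjointP => x; rewrite inE => /andP[].
Qed.

Lemma blaschke_lim N z : blaschke_zeros N -> adm z ->
  cto (@summability.totally R) (fun A => bprod N A z) (blaschke N z).
Proof.
move=> hN hz; have g0 := gap_gt0 hz.
have [|l hl] := @cto_cauchy R {fset R} (@summability.totally R) (totally_proper R) (fun A => bprod N A z).
  move=> e e0; have e' : 0 < e * gap z / 4 by rewrite divr_gt0 // mulr_gt0.
  have [A0 h] := bprod_near hN e'; exists (bprod N A0 z); exists A0 => // A /= A0A.
  apply: le_lt_trans (h _ _ A0A hz) _.
  have -> : 2 / gap z * (e * gap z / 4) = e / 2 by field; rewrite gt_eqF.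
  by lra.
by rewrite (_ : blaschke N z = l) //; apply: (@cto_lim R _ _ (totally_proper R)).
Qed.

Lemma blaschke_near N (e : R) : blaschke_zeros N -> 0 < e -> exists A0, forall z,
  adm z -> normc (blaschke N z - bprod N A0 z) <= 2 / gap z * e.
Proof.
move=> hN e0; have [A0 h] := bprod_near hN e0; exists A0 => z hz.
have hl := blaschke_lim hN hz.
have FF := totally_proper R.
have hc := @cto_cst R _ _ (@filter_filter _ _ FF) (bprod N A0 z).
apply: cvgr_to_le (cto_nc (ctoB hl hc)) _.
by exists A0 => // A /= A0A; exact: h.
Qed.

Section Continuity.
Variables (T : Type) (F : set_system T).
Context {FF : ProperFilter F}.
Implicit Types (f : T -> C).

Lemma bf_cto f z x : cto F f z -> adm z -> `|x| < 1 -> cto F (fun s => bf x (f s)) (bf x z).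
Proof.
move=> hf hz x1; rewrite /bf; case: eqP => // _.
apply: ctoM; first exact: cto_cst.
apply: ctoM; first by apply: ctoB => //; exact: cto_cst.
apply: ctoV; first exact: den_neq0.
by apply: ctoB; [exact: cto_cst|apply: ctoM => //; exact: cto_cst].
Qed.

Lemma bprod_cto f z N A : blaschke_zeros N -> cto F f z -> adm z ->
  cto F (fun s => bprod N A (f s)) (bprod N A z).
Proof.
move=> hN hf hz; rewrite /bprod big_mkcond /=.
have h : forall x, cto F (fun s => if x \in N then bf x (f s) else 1) (if x \in N then bf x z else 1).
  move=> x; case: ifPn => [|_]; last exact: cto_cst.
  by rewrite inE => Nx; apply: bf_cto => //; exact: zeros_lt1 Nx.
by apply: eq_cto (cto_prod A h) => s; rewrite [RHS]big_mkcond.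
Qed.

(** A 3-epsilon argument, with [blaschke_near] and the continuity of finite
    products. *)
Lemma blaschke_cto f z N : blaschke_zeros N -> cto F f z -> adm z ->
  (\forall s \near F, adm (f s)) -> cto F (fun s => blaschke N (f s)) (blaschke N z).
Proof.
move=> hN hf hz nf e e0; have g0 := gap_gt0 hz.
have g2 : 0 < gap z / 2 by rewrite divr_gt0.
have e' : 0 < e * gap z / 16 by rewrite divr_gt0 // mulr_gt0.
have [A0 h] := blaschke_near hN e'.
have e4 : 0 < e / 4 by rewrite divr_gt0.
have h1 := bprod_cto A0 hN hf hz e4; have h2 := hf _ g2.
near=> s.
have as_ : adm (f s) by near: s.
have gs : gap z / 2 <= gap (f s).
  have : `|complex.Re (f s) - complex.Re z| < gap z / 2.
    rewrite -ReN -ReD; apply: le_lt_trans (Re_nc _) _; near: s; exact: h2.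
  rewrite /gap => h3; have := ler_normD (complex.Re z) (complex.Re (f s) - complex.Re z).
  rewrite addrC subrK; move: h3; rewrite /gap; lra.
have b1 : normc (blaschke N (f s) - bprod N A0 (f s)) <= e / 4.
  apply: le_trans (h _ as_) _.
  have -> : e / 4 = 2 / (gap z / 2) * (e * gap z / 16) by field; rewrite gt_eqF.
  by rewrite ler_pM2r // ler_pM2l // lef_pV2 ?posrE ?gap_gt0.
have b2 : normc (bprod N A0 z - blaschke N z) <= e / 8.
  rewrite ncdist; apply: le_trans (h _ hz) _.
  by rewrite le_eqVlt; apply/orP; left; apply/eqP; field; rewrite gt_eqF.
have b3 : normc (bprod N A0 (f s) - bprod N A0 z) < e / 4 by near: s; exact: h1.
have t1 := nc_triangle (blaschke N (f s)) (bprod N A0 (f s)) (blaschke N z).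
have t2 := nc_triangle (bprod N A0 (f s)) (bprod N A0 z) (blaschke N z).
lra.
Unshelve. all: by end_near.
Qed.
End Continuity.

Lemma blaschke_radial N z : blaschke_zeros N -> adm z ->
  cto (1 : R)^'- (fun r => blaschke N (r%:C * z)) (blaschke N z).
Proof.
move=> hN hz; apply: blaschke_cto => //.
  rewrite -[z in cto _ _ z]mul1r; apply: ctoM; last exact: cto_cst.
  by apply: cto_real; exact: cvg_at_left_filter.
near=> r; apply: adm_disk; rewrite /in_disk ncM ncR.
have r01 : 0 < r < 1 by apply/andP; split; near: r; [exact: nbhs_left_gt|exact: nbhs_left_lt].
case/andP: r01 => r0 r1; rewrite gtr0_norm //; case: hz => z1 _.
by apply: le_lt_trans r1; rewrite ler_piMr // ltW.
Unshelve. all: by end_near.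
Qed.

Lemma nc_blaschke N z : blaschke_zeros N -> adm z -> normc (blaschke N z) <= 1.
Proof.
move=> hN hz; have FF := totally_proper R.
apply: cvgr_to_le (cto_nc (blaschke_lim hN hz)) _.
by exists fset0 => // A _ /=; exact: nc_bprod.
Qed.

Lemma nc_blaschke1 N z : blaschke_zeros N -> adm z -> normc z = 1 -> normc (blaschke N z) = 1.
Proof.
move=> hN hz z1; have FF := totally_proper R.
apply/eqP; rewrite eq_le nc_blaschke //=.
apply: cvgr_to_ge (cto_nc (blaschke_lim hN hz)) _.
exists fset0 => // A _ /=; rewrite nc_prod big1 // => x; rewrite inE => Nx.
by apply: nc_bf1 => //; exact: zeros_lt1 Nx.
Qed.

Lemma bf_zero x : bf x x%:C = 0.
Proof. by rewrite /bf; case: eqP => [->|]; rewrite ?subrr ?mul0r ?mulr0. Qed.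

Lemma adm_real x : `|x| < 1 -> adm x%:C.
Proof. by move=> h; split => //; rewrite ncR ltW. Qed.

Lemma blaschke_split Z A0 z : blaschke_zeros Z -> [set` A0] `<=` Z -> adm z ->
  blaschke Z z = \prod_(x <- A0) bf x z * blaschke (Z `\` [set` A0]) z.
Proof.
move=> hZ A0Z hz; have FF := totally_proper R.
have hN : blaschke_zeros (Z `\` [set` A0]) by apply: zeros_sub hZ _; exact: subDsetl.
apply: (cto_unique (blaschke_lim hZ hz)).
have hc := @cto_cst R _ _ (@filter_filter _ _ FF) (\prod_(x <- A0) bf x z).
apply: near_eq_cto (ctoM hc (blaschke_lim hN hz)).
exists A0 => // A /= A0A; rewrite /bprod.
have e1 : \prod_(x <- A0 | x \in Z) bf x z = \prod_(x <- A0) bf x z.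
  rewrite [RHS]big_seq [LHS]big_seq_cond; apply: eq_bigl => x.
  by case: (boolP (x \in A0)) => //= xA; apply/mem_set/A0Z.
have e2 : \prod_(x <- A0 | x \in Z `\` [set` A0]) bf x z = 1.
  by rewrite big1_seq // => x /andP[]; rewrite inE => -[_ h] xA; case: h.
have e3 : \prod_(x <- (A `\` A0)%fset | x \in Z `\` [set` A0]) bf x z =
    \prod_(x <- (A `\` A0)%fset | x \in Z) bf x z.
  rewrite big_seq_cond [RHS]big_seq_cond; apply: eq_bigl => x.
  rewrite !inE /=; case: (boolP (x \in A0)) => //= xA; congr (_ && _).
  apply/idP/idP => [/set_mem[h _]|/set_mem h]; apply/mem_set => //.
  by split => //; apply/negP.
rewrite (@big_fset_split R _ _ _ _ _ A0 A A0A) /= e2 mul1r e3.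
by rewrite [RHS](@big_fset_split R _ _ _ _ _ A0 A A0A) /= e1.
Qed.

Lemma blaschke_split1 Z x z : blaschke_zeros Z -> Z x -> adm z ->
  blaschke Z z = bf x z * blaschke (Z `\ x) z.
Proof.
move=> hZ Zx hz; rewrite (@blaschke_split Z [fset x]%fset) //.
  by rewrite big_seq_fset1 set_fset1.
by rewrite set_fset1 => _ ->.
Qed.

Lemma blaschke_zero N x : blaschke_zeros N -> N x -> blaschke N x%:C = 0.
Proof.
move=> hN Nx; rewrite (blaschke_split1 hN Nx) ?bf_zero ?mul0r //.
by apply: adm_real; exact: zeros_lt1 Nx.
Qed.

Lemma bfJ x z : bf x z^* = (bf x z)^*.
Proof.
have RJ (r : R) : (r%:C)^* = r%:C :> C by apply: eq_ReIm => //=; rewrite oppr0.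
rewrite /bf; case: eqP => // _; rewrite conjcM RJ; congr (_ * _).
rewrite conjcM conjcB RJ; congr (_ * _).
by rewrite fmorphV /= ?conjcB ?conjcM ?RJ ?rmorph1.
Qed.

Lemma admJ z : adm z -> adm z^*.
Proof. by case=> h1 h2; split; rewrite ?ncJ ?ReJ. Qed.

Lemma blaschkeJ N z : blaschke_zeros N -> adm z -> blaschke N z^* = (blaschke N z)^*.
Proof.
move=> hN hz; have FF := totally_proper R.
apply: (cto_unique (blaschke_lim hN (admJ hz))).
apply: eq_cto (ctoJ (blaschke_lim hN hz)) => A.
by rewrite /bprod rmorph_prod; apply: eq_bigr => x _; rewrite bfJ.
Qed.

Lemma circ_adm (t : R) : 0 < t < 1 -> t != 2^-1 -> adm (circ t).
Proof.
move=> /andP[t0 t1] th; have p0 : 0 < pi :> R := pi_gt0 R.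
split; first by rewrite nc_circ.
have s0 : sin (2 * pi * t) != 0.
  have [h|h|/eqP] := ltgtP t 2^-1; last by rewrite (negbTE th).
    by rewrite gt_eqF //; apply: sin_gt0_pi; rewrite ?mulr_gt0 //=; nra.
  have -> : 2 * pi * t = (2 * pi * t - pi) + pi by rewrite subrK.
  rewrite sinDpi oppr_eq0 gt_eqF //; apply: sin_gt0_pi; nra.
rewrite /= -(@ltr_pXn2r _ 2) ?nnegrE // expr1n real_normK ?num_real //.
have := cos2Dsin2 (2 * pi * t); have : 0 < sin (2 * pi * t) ^+ 2 by rewrite exprn_even_gt0.
lra.
Qed.

Lemma ae_circ_adm : {ae mu, forall t : TR, I01 t -> adm (circ t)}.
Proof.
exists ([set 0; 1; 2^-1] : set TR); split.
- by apply: measurableU; [apply: measurableU|]; exact: measurable_set1.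
- apply: countable_lebesgue_measure0; apply: finite_set_countable.
  by rewrite finite_setU; split; [exact: finite_set2|exact: finite_set1].
move=> t /= /not_implyP[]; rewrite in_itv /= => /andP[t0 t1] h.
have [->|n0] := eqVneq t 0; first by left; left.
have [->|n1] := eqVneq t 1; first by left; right.
have [->|nh] := eqVneq t 2^-1; first by right.
by case: h; apply: circ_adm => //; rewrite !lt_def n0 t0 t1 eq_sym n1.
Qed.

End Blaschke.

(** * Boundary values of B, O and T_- *)

Section BoundaryValues.
Variable R : realType.
Notation C := R[i].
Notation mu := (@lebesgue_measure R).
Notation TR := (measurableTypeR R).
Notation I01 := (`[0%R, 1%R]%classic : set TR).
Notation bf := (@blaschke_factor R).
Implicit Types (F G O : C -> C) (Z N : set R) (z : C).

Hint Resolve mI01 muI01_fin : core.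

Definition dcont F := forall z, in_disk z -> forall e : R, 0 < e ->
  exists2 d : R, 0 < d & forall h, normc h < d -> normc (F (z + h) - F z) < e.

Lemma dcontP F z : (forall e : R, 0 < e ->
  exists2 d : R, 0 < d & forall h, normc h < d -> normc (F (z + h) - F z) < e) <->
  cto (nbhs (0 : C^o)) (fun h : C^o => F (z + h)) (F z).
Proof.
split=> h e e0.
  have [d d0 hd] := h e e0; apply/nbhsC; exists d => // w; rewrite subr0; exact: hd.
by have /nbhsC[d d0 hd] := h e e0; exists d => // w; have := hd w; rewrite subr0.
Qed.

(** A nonzero limit of the first factor makes the radial limits of G and of the
    product exist together; when they do not exist both boundary values are 0, so
    the identity has no exceptional points. *)
Lemma bvM F G z a : cto (1 : R)^'- (fun r => F (r%:C * z)) a -> a != 0 ->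
  bv (fun w => F w * G w) z = a * bv G z.
Proof.
move=> hF a0; have [[l hl]|h] := pselect (exists l, cto (1 : R)^'- (fun r => G (r%:C * z)) l).
  by rewrite (bv_cto hl) (bv_cto (ctoM hF hl)).
rewrite (@bv_dvg _ G) => [|l hl]; last by apply: h; exists l.
rewrite mulr0; apply: bv_dvg => l hl; apply: h; exists (a^-1 * l).
apply: near_eq_cto (ctoM (ctoV a0 hF) hl).
have a1 : 0 < normc a by rewrite nc_gt0.
have := hF _ a1; apply: filterS => r hr.
suff h0 : F (r%:C * z) != 0 by rewrite mulKf.
by apply/eqP => E; move: hr; rewrite E sub0r ncN ltxx.
Qed.

Lemma bvJ F z : bv (fun w => (F w^*)^*) z = (bv F z^*)^*.
Proof.
have RJ (r : R) : (r%:C)^* = r%:C :> C by apply: eq_ReIm => //=; rewrite oppr0.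
have [[l hl]|h] := pselect (exists l, cto (1 : R)^'- (fun r => F (r%:C * z^*)) l).
  rewrite (bv_cto hl); apply: bv_cto; apply: eq_cto (ctoJ hl) => r.
  by rewrite conjcM RJ.
rewrite (@bv_dvg _ F) => [|l hl]; last by apply: h; exists l.
rewrite rmorph0; apply: bv_dvg => l hl; apply: h; exists l^*.
by apply: eq_cto (ctoJ hl) => r; rewrite conjcM RJ conjcK.
Qed.

Lemma with_bv_circ F (t : R) : with_bv F (circ t) = bv F (circ t).
Proof. by rewrite /with_bv nc_circ ltxx. Qed.

Lemma cexp_neq0 z : cexp z != 0.
Proof. by rewrite -nc_gt0 nc_cexp expR_gt0. Qed.

Lemma cexp_cto (T : Type) (F : set_system T) {FF : Filter F} (f : T -> C) a :
  cto F f a -> cto F (fun s => cexp (f s)) (cexp a).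
Proof.
move=> hf.
have h1 : cto F (fun s => cexp (f s - a)) 1.
  move=> e e0; have [d d0 hd] := @cexp_eps R 1 ltr01.
  have m0 : 0 < Num.min d (e / 2) by rewrite lt_min d0 divr_gt0.
  have := hf _ m0; apply: filterS => s; rewrite lt_min => /andP[h1 h2].
  have := hd _ h1; rewrite mul1r => h3.
  have -> : cexp (f s - a) - 1 = (cexp (f s - a) - 1 - (f s - a)) + (f s - a) by ring.
  apply: le_lt_trans (ncD _ _) _; lra.
rewrite -[cexp a]mulr1; apply: eq_cto (ctoM (cto_cst (cexp a)) h1) => s.
by rewrite -cexpD addrC subrK.
Qed.

(** (tau + z) / (tau - z) = 2 / (1 - z conj tau) - 1, so the exponent of an outer
    function is a Cauchy integral up to an additive constant. *)
Lemma outer_disk O : outer O -> (forall z, in_disk z -> O z != 0) /\ dcont O.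
Proof.
move=> [c [k [c1 ik hO]]].
have ck : cintg I01 (fun t => (k (circ t))%:C).
  split => //; apply: eq_integrable (integrable_cst01 0) => //.
have hH := holo_cauchy ck.
pose h z := 2 * cauchy (fun t => (k (circ t))%:C) z - cint I01 (fun t => (k (circ t))%:C).
have OE z : in_disk z -> O z = c * cexp (h z).
  move=> hz; rewrite hO //; congr (_ * cexp _).
  rewrite /h -cintZ //; last exact: cintg_ker.
  rewrite -cintB //; last by apply: cintgZ => //; exact: cintg_ker.
  apply: eq_cint => t _; have d0 := ker_neq0 t hz.
  have c0 := @circ_neq0 R t; rewrite circJV in d0 *.
  have d1 : circ t - z != 0.
    apply: contra d0 => /eqP E; rewrite subr_eq0 eq_sym; apply/eqP.
    by rewrite -(subr0_eq E) divff.
  by field; rewrite c0 d1 /=; rewrite -(@divff _ (circ t)) // -mulrBl mulf_neq0 ?invr_neq0 in d0 *.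
have c0 : c != 0 by rewrite -nc_gt0 c1 ltr01.
split=> [z hz|z hz]; first by rewrite OE // mulf_neq0 ?cexp_neq0.
apply/dcontP.
have nd : \forall w \near nbhs (0 : C^o), in_disk (z + w).
  have hz0 : 0 < 1 - normc z by rewrite subr_gt0.
  apply/nbhsC; exists (1 - normc z) => // w; rewrite subr0 => hw.
  rewrite /in_disk; apply: le_lt_trans (ncD _ _) _; lra.
rewrite OE //; apply: near_eq_cto (_ : cto _ (fun w => c * cexp (h (z + w))) _).
  by apply: filterS nd => w hw; rewrite OE.
apply: ctoM; first exact: cto_cst.
apply: cexp_cto; apply: ctoB; last exact: cto_cst.
apply: ctoM; first exact: cto_cst.
by apply/(dcontP (cauchy (fun t => (k (circ t))%:C)))=> e e0; exact: (holo_cont (hH z hz) e0).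
Qed.

Lemma near0_disk z : in_disk z -> \forall w \near nbhs (0 : C^o), in_disk (z + w).
Proof.
move=> hz; have hz0 : 0 < 1 - normc z by rewrite subr_gt0.
apply/nbhsC; exists (1 - normc z) => // w; rewrite subr0 => hw.
rewrite /in_disk; apply: le_lt_trans (ncD _ _) _; lra.
Qed.

Lemma dcont_blaschke N : blaschke_zeros N -> dcont (blaschke N).
Proof.
move=> hN z hz; apply/dcontP; apply: blaschke_cto => //.
- rewrite -[z in cto _ _ z]addr0; apply: ctoD; first exact: cto_cst.
  by move=> e e0; apply/nbhsC; exists e.
- exact: adm_disk.
- by apply: filterS (near0_disk hz) => w; exact: adm_disk.
Qed.

Lemma dcontM F G : dcont F -> dcont G -> dcont (fun z => F z * G z).
Proof.
move=> hF hG z hz; apply/(dcontP (fun z => F z * G z)); apply: ctoM; apply/dcontP.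
  exact: hF.
exact: hG.
Qed.

(** The derivative of the Blaschke factor of x at x. *)
Definition dbf (x : R) : C := if x == 0 then 1 else - (`|x| / x / (1 - x ^+ 2))%:C.

(** 1/T_- = B/O = b_x B_(Z \ x) / O vanishes at x, and its difference quotient
    there is that of b_x times a continuous function. *)
Lemma dinvT_val Z O (x : R) : blaschke_zeros Z -> outer O -> Z x ->
  dinvT Z O x%:C = dbf x * blaschke (Z `\ x) x%:C / O x%:C.
Proof.
move=> hZ hO Zx; case: (outer_disk hO) => O0 cO; have x1 := zeros_lt1 hZ Zx.
have hx : in_disk (x%:C : C) by rewrite /in_disk ncR.
have hN : blaschke_zeros (Z `\ x) by apply: zeros_sub hZ _; exact: subDsetl.
pose q h : C := if x == 0 then 1 else - ((`|x| / x)%:C / (1 - (x%:C + h) * x%:C)).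
have qE h : bf x (x%:C + h) = h * q h.
  rewrite /bf /q; case: eqP => [->|_]; first by rewrite add0r mulr1.
  by rewrite opprD addNKr; ring.
have x2 : 1 - x ^+ 2 != 0 by rewrite gt_eqF // subr_gt0 -(@real_normK _ x) ?num_real // exprn_ilt1.
have cx : cto (nbhs (0 : C^o)) (fun h : C^o => x%:C + h) x%:C.
  by move=> e e0; apply/nbhsC; exists e => // w; rewrite subr0 addrAC subrr add0r.
have cq : cto (nbhs (0 : C^o)) q (dbf x).
  rewrite /q /dbf; case: ifPn => x0; first exact: cto_cst.
  have -> : - (`|x| / x / (1 - x ^+ 2))%:C = - ((`|x| / x)%:C / (1 - x%:C * x%:C)) :> C.
    by rewrite RCM RCV RCB -RCM -expr2.
  apply: ctoN; apply: ctoM; first exact: cto_cst.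
  apply: ctoV; first exact: den_neq0 (adm_disk hx) x1.
  by apply: ctoB; [exact: cto_cst|apply: ctoM => //; exact: cto_cst].
pose Q h := q h * blaschke (Z `\ x) (x%:C + h) / O (x%:C + h).
have cQ : cto (nbhs (0 : C^o)) Q (dbf x * blaschke (Z `\ x) x%:C / O x%:C).
  apply: ctoM; first by apply: ctoM => //; apply/(dcontP (blaschke _)); exact: dcont_blaschke.
  by apply: ctoV; [exact: O0|apply/(dcontP O); exact: cO].
apply: derive1C => e e0.
have /nbhsC[d1 d10 hd1] := cQ e e0; have /nbhsC[d2 d20 hd2] := near0_disk hx.
exists (Num.min d1 d2); first by rewrite lt_min d10.
move=> h; rewrite lt_min => /andP[hh1 hh2].
have h1 := hd1 h; rewrite subr0 in h1; have {}h1 := h1 hh1.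
have h2 := hd2 h; rewrite subr0 in h2; have {}h2 := h2 hh2.
rewrite /Tminus !invf_div (blaschke_zero hZ Zx) mul0r subr0.
rewrite (blaschke_split1 hZ Zx (adm_disk h2)) qE.
have -> : h * q h * blaschke (Z `\ x) (x%:C + h) / O (x%:C + h) -
  dbf x * blaschke (Z `\ x) x%:C / O x%:C * h = h * (Q h - dbf x * blaschke (Z `\ x) x%:C / O x%:C).
  by rewrite /Q; ring.
by rewrite ncM mulrC ler_wpM2r ?nc_ge0 // ltW.
Qed.

Lemma bv_blaschkeM N G z : blaschke_zeros N -> adm z -> normc z = 1 ->
  bv (fun w => blaschke N w * G w) z = blaschke N z * bv G z.
Proof.
move=> hN hz z1; apply: bvM; first exact: blaschke_radial.
by rewrite -nc_gt0 nc_blaschke1.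
Qed.

Lemma bv_blaschke N z : blaschke_zeros N -> adm z -> bv (blaschke N) z = blaschke N z.
Proof. by move=> hN hz; apply: bv_cto; exact: blaschke_radial. Qed.

Lemma bv_Tminus Z O z : blaschke_zeros Z -> adm z -> normc z = 1 ->
  bv (Tminus Z O) z = bv O z / blaschke Z z.
Proof.
move=> hZ hz z1; have B0 : blaschke Z z != 0 by rewrite -nc_gt0 nc_blaschke1.
rewrite (_ : Tminus Z O = fun w => (blaschke Z w)^-1 * O w); last by apply/funext => w; rewrite mulrC.
rewrite (@bvM _ _ _ (blaschke Z z)^-1) ?invr_neq0 //; first by rewrite mulrC.
by apply: ctoV => //; exact: blaschke_radial.
Qed.

Lemma bv_Tplus Z O z : bv (Tplus Z O) z = (bv (Tminus Z O) z^*)^*.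
Proof. exact: bvJ. Qed.

(** The extended logarithm is -oo at 0, so its integral could not exceed -oo if |r|
    = 1 held on a set of positive measure. *)
Lemma ae_circ_lt1 (r : C -> C) : measurable_circle r ->
  (-oo < eint_circle (fun tau => lne (1 - normc (r tau) ^+ 2)%:E))%E ->
  ae_circle (fun tau : C => normc (r tau) < 1).
Proof.
move=> mr hr; pose f (t : TR) := lne (1 - normc (r (circ t)) ^+ 2)%:E.
have mc : cmeas I01 (fun t => r (circ t)) by exact: mr.
have fE t : f t = if normc (r (circ t)) ^+ 2 < 1 then (ln (1 - normc (r (circ t)) ^+ 2))%:E else -oo%E.
  rewrite /f; case: ltP => h; first by rewrite lne_EFin // subr_gt0.
  by rewrite le0_lneNy // lee_fin subr_le0.
have f0 t : (f t <= 0)%E.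
  by rewrite lne_le0 lee_fin gerBl exprn_ge0 // nc_ge0.
have mf : measurable_fun I01 f.
  rewrite (_ : f = fun t => if normc (r (circ t)) ^+ 2 < 1 then (ln (1 - normc (r (circ t)) ^+ 2))%:E else -oo%E); last exact/funext.
  have m2 := measurable_nc2 mc.
  apply: measurable_fun_if => //.
  - by apply: measurable_fun_ltr => //; exact: measurable_cst.
  - apply/measurable_EFinP; apply: measurable_funS (_ : measurable_fun I01 _) => //.
    apply: (measurableT_comp (@measurable_ln R)).
    by apply: measurable_funB => //; exact: measurable_cst.
have fin : mu.-integrable I01 f.
  apply/integrableP; split => //.
  rewrite (eq_integral (fun t => - f t)%E); last by move=> t _; rewrite lee0_abs.
  have -> : (\int[mu]_(t in I01) (- f t) = - \int[mu]_(t in I01) f t)%E.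
    have := @integral_ge0N _ _ _ mu I01 (fun t => - f t)%E.
    rewrite (eq_integral f); last by move=> t _; rewrite oppeK.
    by move=> ->; rewrite ?oppeK // => t _; rewrite oppe_ge0.
  rewrite lteNl; exact: hr.
apply: filterS (integrable_ae mI01 fin) => t h It; have := h It.
rewrite fE; case: ltP => // h1 _; move: h1.
by rewrite -[X in _ < X](expr1n R 2) ltr_pXn2r ?nnegrE ?nc_ge0.
Qed.

End BoundaryValues.

(** * The reflection of the circle in the real axis *)

Section Reflection.
Variable R : realType.
Notation C := R[i].
Notation mu := (@lebesgue_measure R).
Notation TR := (measurableTypeR R).
Notation I01 := (`[0%R, 1%R]%classic : set TR).
Implicit Types (u : TR -> C).

Hint Resolve mI01 muI01_fin : core.

Definition rfl (t : TR) : TR := 1 - t.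

Lemma measurable_rfl : measurable_fun [set: TR] rfl.
Proof. by apply: (@measurable_funB _ TR R) => //; exact: measurable_cst. Qed.

Lemma rfl_I01 : rfl @^-1` I01 = I01.
Proof.
apply/seteqP; split => t; rewrite /rfl /= !in_itv /= ?subr_ge0 ?gerBl => /andP[h1 h2]; apply/andP; split; lra.
Qed.

Hint Resolve measurable_rfl : core.

(** Conjugation of the circle is t -> 1 - t. *)
Lemma mu_rfl (A : set TR) : measurable A -> pushforward mu rfl A = mu A.
Proof.
move=> mA; apply/esym/lebesgue_measure_unique => //= _ [[a b]] _ <-.
rewrite /pushforward.
have -> : rfl @^-1` `]a, b]%classic = `[1 - b, 1 - a[%classic.
  by apply/seteqP; split => t; rewrite /rfl /= !in_itv /= => /andP[h1 h2]; apply/andP; split; lra.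
rewrite !lebesgue_measure_itv /= !lte_fin ltrD2l ltrN2.
by case: ifP => // _; rewrite -!EFinB; congr EFin; lra.
Qed.

Lemma ge0_int_rfl (f : TR -> \bar R) : measurable_fun I01 f -> (forall t, 0 <= f t)%E ->
  (\int[mu]_(t in I01) f (rfl t) = \int[mu]_(t in I01) f t)%E.
Proof.
move=> mf f0; rewrite -{1}rfl_I01.
have -> : (\int[mu]_(t in rfl @^-1` I01) f (rfl t) = \int[mu]_(t in rfl @^-1` I01) (f \o rfl) t)%E by [].
rewrite -ge0_integral_pushforward //.
by apply: eq_measure_integral => //= A mA AS; exact: mu_rfl.
Qed.

Lemma int_rfl (f : TR -> \bar R) : measurable_fun I01 f ->
  (\int[mu]_(t in I01) f (rfl t) = \int[mu]_(t in I01) f t)%E.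
Proof.
move=> mf; rewrite integralE [RHS]integralE.
have h1 := ge0_int_rfl (measurable_funepos mf) (funepos_ge0 f).
have h2 := ge0_int_rfl (measurable_funeneg mf) (funeneg_ge0 f).
by rewrite -h1 -h2 -[fun x => f (rfl x)]/(f \o rfl) funepos_comp funeneg_comp.
Qed.

Lemma measurable_rfl01 d (T : measurableType d) (f : TR -> T) : measurable_fun I01 f ->
  measurable_fun I01 (fun t => f (1 - t)).
Proof.
move=> mf; apply: (@measurable_comp _ _ _ _ _ _ I01 f I01 rfl) => //.
  by move=> _ [t It <-]; have : (rfl @^-1` I01) t by rewrite rfl_I01.
exact: measurable_funS measurable_rfl.
Qed.

Lemma cmeas_rfl u : cmeas I01 u -> cmeas I01 (fun t => u (1 - t)).
Proof. by case=> h1 h2; split; apply: (measurable_rfl01 (f := fun t => _ (u t))). Qed.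

Lemma cint_rfl u : cmeas I01 u -> cint I01 (fun t => u (1 - t)) = cint I01 u.
Proof.
case=> h1 h2; rewrite /cint /Rintegral; congr (fine _ +i* fine _).
  by apply: (int_rfl (f := fun t => (complex.Re (u t))%:E)); exact/measurable_EFinP.
by apply: (int_rfl (f := fun t => (complex.Im (u t))%:E)); exact/measurable_EFinP.
Qed.

Lemma ae_rfl (P : TR -> Prop) : {ae mu, forall t, I01 t -> P t} ->
  {ae mu, forall t, I01 t -> P (1 - t)}.
Proof.
move=> [N [mN N0 hN]]; exists (rfl @^-1` N); split.
- by rewrite -[X in measurable X]setTI; exact: measurable_rfl.
- by have := mu_rfl mN; rewrite /pushforward N0.
move=> t /= h; apply: hN => /= h'; apply: h => It; apply: h'.
by have : (rfl @^-1` I01) t by rewrite rfl_I01.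
Qed.

End Reflection.

(** * Partial fractions of finite Blaschke products *)

Section PartialFractions.
Variable R : realType.
Notation C := R[i].
Notation mu := (@lebesgue_measure R).
Notation TR := (measurableTypeR R).
Notation I01 := (`[0%R, 1%R]%classic : set TR).
Notation bf := (@blaschke_factor R).
Implicit Types (z : C) (x y : R) (r : seq R).

Hint Resolve mI01 muI01_fin : core.

(** The reciprocal of the derivative at x of the product over r, that is, the
    coefficient of 1 / (z - x) in the reciprocal of the product. *)
Definition resid r x : C := (dbf x * \prod_(y <- r | y != x) bf y x%:C)^-1.

Lemma bf_inv y z : `|y| < 1 -> z != y%:C -> (bf y z)^-1 = `|y|%:C + (dbf y)^-1 / (z - y%:C).
Proof.
move=> y1 zy; rewrite /bf /dbf; case: eqP => [->|/eqP y0].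
  by rewrite normr0 add0r invr1 mul1r subr0.
have d0 : z - y%:C != 0 by rewrite subr_eq0.
have yC : y%:C != 0 :> C by apply/eqP => /(congr1 (@complex.Re R)) /= E; rewrite E eqxx in y0.
have aC : `|y|%:C != 0 :> C.
  by apply/eqP => /(congr1 (@complex.Re R)) /= /eqP; rewrite normr_eq0 (negbTE y0).
pose q : R := `|y| / y.
have q2 : q ^+ 2 = 1 by rewrite /q expr_div_n real_normK ?num_real // divff // sqrf_eq0.
have qy : `|y|%:C = q%:C * y%:C :> C by rewrite -RCM /q divfK.
have y2 : 1 - y%:C ^+ 2 != 0 :> C.
  rewrite RCX -RCB; apply/eqP => /(congr1 (@complex.Re R)) /= /eqP; apply/negP; rewrite gt_eqF //.
  by rewrite subr_gt0 -(@real_normK _ y) ?num_real // exprn_ilt1.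
have qC : q%:C != 0 :> C.
  apply/eqP => /(congr1 (@complex.Re R)) /= E; move: q2; rewrite E expr0n /= => /eqP.
  by rewrite eq_sym oner_eq0.
have qq : q%:C * q%:C = 1 :> C by rewrite -RCM -expr2 q2.
have -> : (`|y| / y / (1 - y ^+ 2))%:C = q%:C / (1 - y%:C ^+ 2) :> C.
  by rewrite -/q RCM RCV RCB RCX.
rewrite -/q qy invfM invf_div invrN invf_div.
have -> : (q%:C)^-1 = q%:C :> C by apply: (mulfI qC); rewrite divff.
have d1 : y%:C - z != 0 by rewrite -opprB oppr_eq0.
apply: (mulIf qC); field.
by rewrite d0 d1.
Qed.

(** Induction on the number of factors. By [bf_inv] a new factor multiplies the sum
    by a constant plus a simple fraction, and 1 / ((z - y)(z - x)) is a difference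
    of simple fractions; the new coefficient at y is recognized with the induction
    hypothesis at z = y. *)
Lemma partial_fractions r : uniq r -> (forall x, x \in r -> `|x| < 1) ->
  exists c : C, forall z, (forall x, x \in r -> z != x%:C) ->
  (\prod_(x <- r) bf x z)^-1 = c + \sum_(x <- r) resid r x / (z - x%:C).
Proof.
elim: r => [|y r ih] /=.
  by move=> _ _; exists 1 => z _; rewrite !big_nil invr1 addr0.
move=> /andP[yr ur] hr; have [x hx|c hc] := ih ur; first by apply: hr; rewrite inE hx orbT.
have y1 : `|y| < 1 by apply: hr; rewrite inE eqxx.
exists (`|y|%:C * c) => z hz.
have zy : z != y%:C by apply: hz; rewrite inE eqxx.
have zr x : x \in r -> z != x%:C by move=> xr; apply: hz; rewrite inE xr orbT.
have RCinj (a b : R) : a%:C = b%:C :> C -> a = b by move/(congr1 (@complex.Re R)).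
have ny x : x \in r -> x != y by apply: contraTneq => ->.
have ry : resid (y :: r) y = (dbf y)^-1 * (c + \sum_(x <- r) resid r x / (y%:C - x%:C)).
  rewrite -hc; last by move=> x xr; apply/eqP => /RCinj E; move: (ny x xr); rewrite E eqxx.
  rewrite /resid invfM big_cons eqxx /=; congr (_ * _^-1); rewrite big_seq_cond [RHS]big_seq.
  by apply: eq_bigl => x; case: (boolP (x \in r)) => //= /ny.
have rx x : x \in r -> resid (y :: r) x = resid r x * (`|y|%:C + (dbf y)^-1 / (x%:C - y%:C)).
  move=> xr; rewrite -bf_inv //; last by apply/eqP => /RCinj E; move: (ny x xr); rewrite E eqxx.
  by rewrite /resid big_cons eq_sym (ny x xr) mulrCA invfM mulrC.
rewrite !big_cons invfM hc // bf_inv // ry.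
have -> : \sum_(x <- r) resid (y :: r) x / (z - x%:C) = \sum_(x <- r) (`|y|%:C * (resid r x / (z - x%:C)) +
   (dbf y)^-1 / (z - y%:C) * (resid r x / (z - x%:C) - resid r x / (y%:C - x%:C))).
  rewrite big_seq [RHS]big_seq; apply: eq_bigr => x xr; rewrite rx //.
  have h1 : z - y%:C != 0 by rewrite subr_eq0.
  have h2 : z - x%:C != 0 by rewrite subr_eq0 zr.
  have h3 : y%:C - x%:C != 0 :> C.
    by rewrite subr_eq0; apply/eqP => /RCinj E; move: (ny x xr); rewrite E eqxx.
  rewrite -[x%:C - y%:C]opprB invrN; move: (dbf y)^-1 (resid r x) (`|y|%:C) h1 h2 h3.
  move: (x%:C : C) (y%:C : C) => a b q k p h1 h2 h3.
  by field; rewrite h1 h2 h3.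
rewrite big_split /= -!mulr_sumr sumrB; ring.
Qed.

(** On the circle tau / (tau - x) = 1 / (1 - x conj tau), the Cauchy kernel at x;
    the constant term meets the first moment of w, which is 0. *)
Lemma int_partial_fractions r (w : TR -> C) : uniq r -> (forall x, x \in r -> `|x| < 1) ->
  L2 w -> analytic w ->
  cint I01 (fun t => circ t * w t * (\prod_(x <- r) bf x (circ t))^-1) =
  \sum_(x <- r) resid r x * cauchy w x%:C.
Proof.
move=> ur hr hw aw; have [c hc] := partial_fractions ur hr; have iw := L2_cintg hw.
rewrite (@eq_cint _ _ _ (fun t => c * (w t * circ t ^+ 1) +
   \sum_(x <- r) (if x \in r then resid r x else 0) * (w t * (if `|x| < 1 then (1 - x%:C * (circ t)^*)^-1 else 0)))); last first.
  move=> t _; rewrite hc; last first.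
    move=> x /hr x1; apply/eqP => E; have := @nc_circ R t; rewrite E ncR => E1.
    by rewrite E1 ltxx in x1.
  rewrite mulrDr mulr_sumr expr1; congr (_ + _); first by ring.
  rewrite !big_seq; apply: eq_bigr => x xr; rewrite xr (hr x xr) circJV.
  have d0 : circ t - x%:C != 0.
    rewrite subr_eq0; apply/eqP => E; have := @nc_circ R t; rewrite E ncR => E1.
    by have := hr x xr; rewrite E1 ltxx.
  have c0 := @circ_neq0 R t.
  have d1 : 1 - x%:C * (circ t)^-1 != 0.
    by rewrite -(divff c0) -mulrBl mulf_neq0 ?invr_neq0.
  by field; rewrite d0 c0.
have ik x : cintg I01 (fun t => w t * (if `|x| < 1 then (1 - x%:C * (circ t)^*)^-1 else 0)).
  case: (boolP (`|x| < 1)) => h; first by apply: cintg_ker => //; rewrite /in_disk ncR.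
  have -> : (fun t => w t * 0) = fun=> 0 by apply/funext => t; rewrite mulr0.
  exact: cintg_cst01.
have i1 : cintg I01 (fun t => c * (w t * circ t ^+ 1)) by apply: cintgZ => //; exact: cintg_circX.
have i2 x : cintg I01 (fun t => (if x \in r then resid r x else 0) * (w t * (if `|x| < 1 then (1 - x%:C * (circ t)^*)^-1 else 0))).
  exact: cintgZ.
rewrite cintD //; last by apply: cintg_sum.
rewrite cintZ //; last exact: cintg_circX.
rewrite aw // mulr0 add0r cint_sum // !big_seq; apply: eq_bigr => x xr.
rewrite xr (hr x xr) cintZ //; apply: cintg_ker => //.
by rewrite /in_disk ncR hr.
Qed.

End PartialFractions.

(** * The Faddeev-Marchenko space *)

Section FaddeevMarchenko.
Variable R : realType.
Notation C := R[i].
Notation mu := (@lebesgue_measure R).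
Notation TR := (measurableTypeR R).
Notation I01 := (`[0%R, 1%R]%classic : set TR).
Implicit Types (f h : C -> C).

Hint Resolve mI01 muI01_fin : core.

Lemma RCJ (r : R) : (r%:C)^* = r%:C :> C.
Proof. by apply: eq_ReIm => //=; rewrite oppr0. Qed.

Lemma esum_le_wsum (N : set R) (w : R -> R) (M : R) :
  (forall A, wsum N w A <= M) -> (\esum_(x in N) (w x)%:E <= M%:E)%E.
Proof.
move=> hM; apply: ge_ereal_sup => _ /= [X [fX XN] <-].
have [X0 X0E] := finite_fsetP.1 fX; apply: le_trans (_ : ((wsum N w X0)%:E <= _)%E); last by rewrite lee_fin.
rewrite X0E -fsbig_seq ?fset_uniq //= sumEFin /wsum lee_fin big_seq [leRHS]big_seq_cond.
rewrite le_eqVlt; apply/orP; left; apply/eqP.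
apply: eq_bigl => x; case: (boolP (x \in X0)) => //= xX; apply/esym.
by apply/mem_set/XN; rewrite X0E.
Qed.

(** Completing the square diagonalizes the matrix W of the form. *)
Lemma form_polar (r u v u' v' : C) :
  u'^* * (u + r^* * v) + v'^* * (r * u + v) =
  (r * u + v) * (r * u' + v')^* + (1 - normc r ^+ 2)%:C * (u * u'^*).
Proof.
by rewrite RCB -nc_mulJ conjcD conjcM; ring.
Qed.

Section Data.
Variables (Z : set R) (a : scattering R).
Hypothesis mr : measurable_circle (refl a).
Hypothesis r1 : ae_circle (fun tau => normc (refl a tau) <= 1).
Hypothesis rs : ae_circle (fun tau => refl a tau = (refl a tau^*)^*).
Hypothesis w0 : forall x, Z x -> 0 < wgt a x.

(** The second component of W [f(tau); conj tau f(conj tau)], equal to T_- f^- on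
    the circle. *)
Definition phi f (t : TR) : C :=
  refl a (circ t) * f (circ t) + (circ t)^* * f (circ t)^*.
(** Chosen so that the form is phi conj phi + psi conj psi ([formE]): the circle
    part of the space embeds into two copies of L^2. *)
Definition psi f (t : TR) : C :=
  (Num.sqrt (1 - normc (refl a (circ t)) ^+ 2))%:C * f (circ t).

Lemma formE f h (t : TR) : normc (refl a (circ t)) <= 1 ->
  FM_form (refl a) f h (circ t) = phi f t * (phi h t)^* + psi f t * (psi h t)^*.
Proof.
move=> hr; have h0 : 0 <= 1 - normc (refl a (circ t)) ^+ 2.
  by rewrite subr_ge0 exprn_ile1 ?nc_ge0.
rewrite /phi /psi.
have -> : (Num.sqrt (1 - normc (refl a (circ t)) ^+ 2))%:C * f (circ t) *
    ((Num.sqrt (1 - normc (refl a (circ t)) ^+ 2))%:C * h (circ t))^* =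
    (1 - normc (refl a (circ t)) ^+ 2)%:C * (f (circ t) * (h (circ t))^*).
  by rewrite conjcM RCJ -{3}(sqr_sqrtr h0) expr2 RCM; ring.
rewrite -form_polar /FM_form; congr (_ + _ * _).
by rewrite conjcM conjcK.
Qed.

Lemma cmeas_conj f : measurable_circle f -> cmeas I01 (fun t => f (circ t)^*).
Proof.
move=> mf; have := @cmeas_rfl R (fun t => f (circ t)) mf.
by apply: eq_cmeas => t _; rewrite circJ.
Qed.

Lemma cmeas_phi f : measurable_circle f -> cmeas I01 (phi f).
Proof.
move=> mf; have cR : cmeas I01 (fun t => refl a (circ t)) by exact: mr.
have cf : cmeas I01 (fun t => f (circ t)) by exact: mf.
have cf' := cmeas_conj mf; have cc : cmeas I01 (@circ R) by exact: cmeas_circ.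
by apply: cmeasD => //; apply: cmeasM => //; exact: cmeasJ.
Qed.

Lemma cmeas_psi f : measurable_circle f -> cmeas I01 (psi f).
Proof.
move=> mf; have cR : cmeas I01 (fun t => refl a (circ t)) by exact: mr.
have cf : cmeas I01 (fun t => f (circ t)) by exact: mf.
apply: cmeasM => //; apply: cmeas_real; apply: (@measurableT_comp _ _ _ _ _ _ (Num.sqrt : R -> R)).
  by apply: continuous_measurable_fun; exact: sqrt_continuous.
by apply: measurable_funB => //; exact: measurable_nc2.
Qed.

Lemma cmeas_form f h : measurable_circle f -> measurable_circle h ->
  cmeas I01 (fun t => FM_form (refl a) f h (circ t)).
Proof.
move=> mf mh; have cR : cmeas I01 (fun t => refl a (circ t)) by exact: mr.
have cf : cmeas I01 (fun t => f (circ t)) by exact: mf.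
have ch : cmeas I01 (fun t => h (circ t)) by exact: mh.
have cf' := cmeas_conj mf; have ch' := cmeas_conj mh.
have cc : cmeas I01 (@circ R) by exact: cmeas_circ.
apply: cmeasD => //; apply: cmeasM => //.
- exact: cmeasJ.
- by apply: cmeasD => //; apply: cmeasM => //; [exact: cmeasJ|apply: cmeasM => //; exact: cmeasJ].
- by apply: cmeasM => //; exact: cmeasJ.
- by apply: cmeasD => //; apply: cmeasM => //; exact: cmeasJ.
Qed.

(** The part of the squared norm carried by Z. *)
Definition Ssq f : \bar R := (\esum_(x in Z) (normc (f x%:C) ^+ 2 * wgt a x)%:E)%E.

Lemma ssq_ge0 f x : Z x -> 0 <= normc (f x%:C) ^+ 2 * wgt a x.
Proof. by move=> Zx; rewrite mulr_ge0 ?exprn_ge0 ?nc_ge0 // ltW // w0. Qed.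

Lemma Ssq_ge0 f : (0 <= Ssq f)%E.
Proof. by apply: esum_ge0 => x Zx; rewrite lee_fin ssq_ge0. Qed.

Lemma FM_energyE f : measurable_circle f ->
  (eint_circle (fun tau => (complex.Re (FM_form (refl a) f f tau))%:E) =
   \int[mu]_(t in I01) (normc (phi f t) ^+ 2)%:E + \int[mu]_(t in I01) (normc (psi f t) ^+ 2)%:E)%E.
Proof.
move=> mf; have mp := measurable_nc2 (cmeas_phi mf); have mq := measurable_nc2 (cmeas_psi mf).
rewrite -ge0_integralD //; last 4 first.
- by move=> t _; rewrite lee_fin exprn_ge0 // nc_ge0.
- exact/measurable_EFinP.
- by move=> t _; rewrite lee_fin exprn_ge0 // nc_ge0.
- exact/measurable_EFinP.
apply: ae_eq_integral => //.
- by apply/measurable_EFinP; case: (cmeas_form mf mf).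
- by apply/measurable_EFinP; exact: measurable_funD.
have r1' : {ae mu, forall t, I01 t -> normc (refl a (circ t)) <= 1} by exact: r1.
by apply: filterS r1' => t ht It; rewrite /= formE ?ht // ReD !nc_mulJ /= -EFinD.
Qed.

Lemma FM_L2P f : FM_L2 Z a f <-> [/\ measurable_circle f, (Ssq f < +oo)%E, L2 (phi f) & L2 (psi f)].
Proof.
have p0 (u : TR -> C) : (0 <= \int[mu]_(t in I01) (normc (u t) ^+ 2)%:E)%E.
  by apply: integral_ge0 => t _; rewrite lee_fin exprn_ge0 // nc_ge0.
split.
  move=> [mf]; rewrite /FM_normsq FM_energyE //.
  set A := (\int[mu]_(t in _) _)%E; set B := (\int[mu]_(t in _) _)%E => h.
  have A0 : (0 <= A)%E by exact: p0.
  have B0 : (0 <= B)%E by exact: p0.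
  have S0 := Ssq_ge0 f.
  have h1 : (Ssq f < +oo)%E.
    by apply: le_lt_trans h; rewrite leeDl //; apply: mule_ge0 => //; rewrite adde_ge0.
  have h2 : (A + B < +oo)%E.
    have : ((2^-1)%:E * (A + B) < +oo)%E by apply: le_lt_trans h; rewrite leeDr.
    rewrite !ltey; apply: contra_neq => ->; rewrite gt0_muley //.
  split => //; split; [exact: cmeas_phi| |exact: cmeas_psi|].
    by apply: le_lt_trans h2; rewrite leeDl.
  by apply: le_lt_trans h2; rewrite leeDr.
move=> [mf h1 [m1 h2] [m2 h3]]; split => //.
rewrite /FM_normsq FM_energyE // lte_add_pinfty // lte_mul_pinfty // ?lee_fin //.
exact: lte_add_pinfty.
Qed.

Lemma FM_normsqE f : FM_L2 Z a f -> FM_normsq Z a f = (Ssq f + (2^-1 * (n2 (phi f) + n2 (psi f)))%:E)%E.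
Proof. by move=> /FM_L2P[mf h1 h2 h3]; rewrite /FM_normsq FM_energyE // -!n2E. Qed.

Lemma normsq_ge0 f : FM_L2 Z a f -> (0 <= FM_normsq Z a f)%E.
Proof.
move=> hf; rewrite FM_normsqE // adde_ge0 ?Ssq_ge0 // lee_fin mulr_ge0 //.
by rewrite addr_ge0 ?n2_ge0.
Qed.

Lemma phiB f h t : phi (f \- h)%R t = phi f t - phi h t.
Proof. by rewrite /phi /=; ring. Qed.

Lemma psiB f h t : psi (f \- h)%R t = psi f t - psi h t.
Proof. by rewrite /psi /=; ring. Qed.

Definition fsum f h (x : R) : C := if x \in Z then f x%:C * (h x%:C)^* * (wgt a x)%:C else 0.

Lemma sum_lim (g : R -> C) l : cto (@summability.totally R) (fun A => \sum_(x <- A) g x) l ->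
  summability.sum (g : R -> C^o) = l.
Proof.
move=> h; have FF := totally_proper R.
apply: (@cto_lim R _ _ FF (summability.partial_sum (g : R -> C^o)) l).
by apply: eq_cto h => A; rewrite /summability.partial_sum -(big_seq_fsetE _ _ xpredT).
Qed.

Lemma fsum_bound f h (l : R) x : 0 < l -> Z x ->
  normc (fsum f h x) <= (l * (normc (f x%:C) ^+ 2 * wgt a x) + l^-1 * (normc (h x%:C) ^+ 2 * wgt a x)) / 2.
Proof.
move=> l0 Zx; have wx := w0 Zx; rewrite /fsum mem_set // !ncM ncJ ncR gtr0_norm //.
set p := normc _; set q := normc _.
have -> : (l * (p ^+ 2 * wgt a x) + l^-1 * (q ^+ 2 * wgt a x)) / 2 =
  p * q * wgt a x + (l * p - q) ^+ 2 / l * wgt a x / 2 by field; rewrite gt_eqF.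
by rewrite lerDl; apply: divr_ge0 => //; apply: mulr_ge0; rewrite ?(ltW wx) // divr_ge0 ?sqr_ge0 // ltW.
Qed.

Lemma fsum_cto f h : FM_L2 Z a f -> FM_L2 Z a h ->
  cto (@summability.totally R) (fun A => \sum_(x <- A) fsum f h x) (summability.sum (fsum f h : R -> C^o)) /\
  forall l : R, 0 < l -> normc (summability.sum (fsum f h : R -> C^o)) <=
     (l * fine (Ssq f) + l^-1 * fine (Ssq h)) / 2.
Proof.
move=> /FM_L2P[_ hf _ _] /FM_L2P[_ hh _ _].
have Ff : Ssq f \is a fin_num by rewrite ge0_fin_numE ?Ssq_ge0.
have Fh : Ssq h \is a fin_num by rewrite ge0_fin_numE ?Ssq_ge0.
pose w l x := (l * (normc (f x%:C) ^+ 2 * wgt a x) + l^-1 * (normc (h x%:C) ^+ 2 * wgt a x)) / 2.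
have ws l : 0 < l -> (\esum_(x in Z) (w l x)%:E <= ((l * fine (Ssq f) + l^-1 * fine (Ssq h)) / 2)%:E)%E.
  move=> l0; apply: esum_le_wsum => A.
  have -> : wsum Z (w l) A = (l * wsum Z (fun x => normc (f x%:C) ^+ 2 * wgt a x) A +
     l^-1 * wsum Z (fun x => normc (h x%:C) ^+ 2 * wgt a x) A) / 2.
    by rewrite /wsum !mulr_sumr -big_split /= mulr_suml.
  rewrite ler_pM2r // lerD // ler_pM2l ?invr_gt0 // -lee_fin fineK //; exact: wsum_le_esum.
have w_ge0 l x : 0 < l -> Z x -> 0 <= w l x.
  by move=> l0 Zx; apply: le_trans (fsum_bound f h l0 Zx); exact: nc_ge0.
have key l : 0 < l -> exists2 s : C, cto (@summability.totally R) (fun A => \sum_(x <- A) fsum f h x) s &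
    normc s <= (l * fine (Ssq f) + l^-1 * fine (Ssq h)) / 2.
  move=> l0; have h1 : (\esum_(x in Z) (w l x)%:E < +oo)%E by apply: le_lt_trans (ws l l0) _; rewrite ltry.
  have h2 x : Z x -> normc (fsum f h x) <= w l x by move=> Zx; exact: fsum_bound.
  have h3 x : ~ Z x -> fsum f h x = 0 by move=> nZ; rewrite /fsum memNset.
  have [s s1 s2] := sum_totally (fun x => @w_ge0 l x l0) h1 h2 h3.
  by exists s => //; apply: s2; exact: ws.
have [s s1 _] := key 1 ltr01; split; first by rewrite (sum_lim s1).
by move=> l l0; have [s' s1' s2'] := key l l0; rewrite (sum_lim s1').
Qed.

Lemma L2_int_form f h : FM_L2 Z a f -> FM_L2 Z a h ->
  [/\ cintg I01 (fun t => phi f t * (phi h t)^*), cintg I01 (fun t => psi f t * (psi h t)^*) &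
    cint_circle (FM_form (refl a) f h) =
    cint I01 (fun t => phi f t * (phi h t)^*) + cint I01 (fun t => psi f t * (psi h t)^*)].
Proof.
move=> /FM_L2P[mf _ f1 f2] /FM_L2P[mh _ h1 h2].
have i1 := L2_cintgM f1 (L2J h1); have i2 := L2_cintgM f2 (L2J h2).
split => //; rewrite -cintD //; apply: (@cint_ae R _ mI01 (fun t => FM_form (refl a) f h (circ t))).
- exact: cmeas_form.
- by have i3 := cintgD mI01 i1 i2; have := cintg_meas mI01 i3.
have r1' : {ae mu, forall t, I01 t -> normc (refl a (circ t)) <= 1} by exact: r1.
by apply: filterS r1' => t ht It; rewrite formE ?ht.
Qed.

(** Cauchy-Schwarz with a free weight, which holds separately for the sum over Z
    and for the phi and psi parts. *)
Lemma inner_bound f h (l : R) : FM_L2 Z a f -> FM_L2 Z a h -> 0 < l ->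
  normc (FM_inner Z a f h) <=
  (l * fine (FM_normsq Z a f) + l^-1 * fine (FM_normsq Z a h)) / 2.
Proof.
move=> hf hh l0; have [i1 i2 E] := L2_int_form hf hh.
have [_ sb] := fsum_cto hf hh.
rewrite !FM_normsqE //.
have /FM_L2P[_ hf' f1 f2] := hf; have /FM_L2P[_ hh' h1 h2] := hh.
have Ff : Ssq f \is a fin_num by rewrite ge0_fin_numE ?Ssq_ge0.
have Fh : Ssq h \is a fin_num by rewrite ge0_fin_numE ?Ssq_ge0.
rewrite !fineD //=; rewrite /FM_inner -/(fsum f h) E.
have b1 : normc (cint I01 (fun t => phi f t * (phi h t)^*)) <= (l * n2 (phi f) + l^-1 * n2 (phi h)) / 2.
  apply: le_trans (nc_cint mI01 i1) _; rewrite -(n2J (phi h)); apply: L1_young => //; exact: L2J.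
have b2 : normc (cint I01 (fun t => psi f t * (psi h t)^*)) <= (l * n2 (psi f) + l^-1 * n2 (psi h)) / 2.
  apply: le_trans (nc_cint mI01 i2) _; rewrite -(n2J (psi h)); apply: L1_young => //; exact: L2J.
apply: le_trans (ncD _ _) _.
have -> : (l * (fine (Ssq f) + 2^-1 * (n2 (phi f) + n2 (psi f))) +
  l^-1 * (fine (Ssq h) + 2^-1 * (n2 (phi h) + n2 (psi h)))) / 2 =
  (l * fine (Ssq f) + l^-1 * fine (Ssq h)) / 2 + 2^-1 * ((l * n2 (phi f) + l^-1 * n2 (phi h)) / 2 +
    (l * n2 (psi f) + l^-1 * n2 (psi h)) / 2) by ring.
apply: lerD; first exact: sb.
have n12 : normc (2^-1 : C) = 2^-1.
  have -> : 2^-1 = (2^-1 : R)%:C :> C by rewrite RCV; congr (_^-1); apply: eq_ReIm => //=; rewrite addr0.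
  by rewrite ncR ger0_norm.
rewrite ncM n12 ler_pM2l ?invr_gt0 //.
by apply: le_trans (ncD _ _) _; exact: lerD.
Qed.

Lemma FM_L2B f h : FM_L2 Z a f -> FM_L2 Z a h -> FM_L2 Z a (f \- h)%R.
Proof.
move=> /FM_L2P[mf Sf f1 f2] /FM_L2P[mh Sh h1 h2]; apply/FM_L2P; split.
- have cf : cmeas I01 (fun t => f (circ t)) by exact: mf.
  have ch : cmeas I01 (fun t => h (circ t)) by exact: mh.
  by have := cmeasB cf ch.
- have Ff : Ssq f \is a fin_num by rewrite ge0_fin_numE ?Ssq_ge0.
  have Fh : Ssq h \is a fin_num by rewrite ge0_fin_numE ?Ssq_ge0.
  apply: (@le_lt_trans _ _ (2 * (fine (Ssq f) + fine (Ssq h)))%:E); last by rewrite ltry.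
  apply: esum_le_wsum => A.
  apply: (@le_trans _ _ (2 * (wsum Z (fun x => normc (f x%:C) ^+ 2 * wgt a x) A +
     wsum Z (fun x => normc (h x%:C) ^+ 2 * wgt a x) A))).
    rewrite /wsum -big_split /= mulr_sumr; apply: ler_sum => x /set_mem Zx.
    have wx := w0 Zx; rewrite -mulrDl mulrA ler_pM2r //.
    have b := ncB (f x%:C) (h x%:C); apply: (@le_trans _ _ ((normc (f x%:C) + normc (h x%:C)) ^+ 2)).
      by rewrite ler_pXn2r ?nnegrE ?nc_ge0 ?addr_ge0 ?nc_ge0.
    rewrite -subr_ge0.
    have -> : 2 * (normc (f x%:C) ^+ 2 + normc (h x%:C) ^+ 2) - (normc (f x%:C) + normc (h x%:C)) ^+ 2 =
      (normc (f x%:C) - normc (h x%:C)) ^+ 2 by ring.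
    exact: sqr_ge0.
  rewrite ler_pM2l // lerD // -lee_fin fineK //; exact: wsum_le_esum.
- by apply: eq_L2 (L2B f1 h1) => t _; rewrite phiB.
- by apply: eq_L2 (L2B f2 h2) => t _; rewrite psiB.
Qed.

Lemma innerB f h k : FM_L2 Z a f -> FM_L2 Z a h -> FM_L2 Z a k ->
  FM_inner Z a f (h \- k)%R = FM_inner Z a f h - FM_inner Z a f k.
Proof.
move=> hf hh hk; have hhk := FM_L2B hh hk.
have [i1 i2 E] := L2_int_form hf hh; have [j1 j2 E'] := L2_int_form hf hk.
have [_ _ E''] := L2_int_form hf hhk.
have [s1 _] := fsum_cto hf hh; have [s2 _] := fsum_cto hf hk.
rewrite /FM_inner -/(fsum f h) -/(fsum f k) -/(fsum f (h \- k)) E E' E''.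
have FF := @filter_filter _ _ (totally_proper R).
rewrite (@sum_lim (fsum f (h \- k)%R) (summability.sum (fsum f h : R -> C^o) - summability.sum (fsum f k : R -> C^o))); last first.
  apply: eq_cto (ctoB s1 s2) => A; rewrite -sumrB; apply: eq_bigr => x _.
  by rewrite /fsum; case: ifP => _; rewrite ?subrr //= conjcB; ring.
have e1 : cint I01 (fun t => phi f t * (phi (h \- k)%R t)^*) =
  cint I01 (fun t => phi f t * (phi h t)^*) - cint I01 (fun t => phi f t * (phi k t)^*).
  by rewrite -cintB //; apply: eq_cint => t _; rewrite phiB conjcB mulrBr.
have e2 : cint I01 (fun t => psi f t * (psi (h \- k)%R t)^*) =
  cint I01 (fun t => psi f t * (psi h t)^*) - cint I01 (fun t => psi f t * (psi k t)^*).
  by rewrite -cintB //; apply: eq_cint => t _; rewrite psiB conjcB mulrBr.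
rewrite e1 e2; ring.
Qed.

Lemma orth_closure f (S : set (C -> C)) : FM_L2 Z a f -> (forall s, S s -> FM_L2 Z a s) ->
  (forall s, S s -> FM_inner Z a f s = 0) -> FM_orth Z a (FM_closure Z a S) f.
Proof.
move=> hf hS h0; split => // h [hh cl].
apply/eqP; rewrite -nc_eq0 eq_le nc_ge0 andbT; apply/ler_addgt0Pl => e e0; rewrite addr0.
pose n := fine (FM_normsq Z a f); have n0 : 0 <= n.
  by rewrite fine_ge0 // normsq_ge0.
have n1 : 0 < n + 1 by rewrite ltr_wpDl.
(* this weight and a distance below l e make both halves of the bound at most e / 2 *)
pose l := e / (n + 1); have l0 : 0 < l by rewrite divr_gt0.
have [|s Ss hs] := cl (l * e); first by rewrite mulr_gt0.
have hs' := hS s Ss; have hd := FM_L2B hh hs'.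
have -> : FM_inner Z a f h = FM_inner Z a f (h \- s)%R.
  by rewrite innerB // (h0 s Ss) subr0.
apply: le_trans (inner_bound hf hd l0) _; rewrite -/n.
have f1 : fine (FM_normsq Z a (h \- s)%R) <= l * e.
  rewrite -lee_fin fineK; first exact: ltW hs.
  by rewrite ge0_fin_numE ?normsq_ge0 //; case: hd.
have f2 : l^-1 * fine (FM_normsq Z a (h \- s)%R) <= e.
  by rewrite -ler_pdivlMl ?invr_gt0 // invrK.
have f3 : l * n <= e.
  by rewrite /l mulrAC ler_pdivrMr // ler_pM2l //; lra.
lra.
Qed.

Lemma closure_self (S : set (C -> C)) s : FM_L2 Z a s -> S s -> FM_closure Z a S s.
Proof.
move=> hs Ss; split => // e e0; exists s => //.
have -> : FM_normsq Z a (s \- s)%R = 0%E; last by rewrite lte_fin.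
rewrite /FM_normsq esum1 ?add0e => [|x _]; last by rewrite /= subrr nc0 expr0n mul0r.
rewrite (_ : eint_circle _ = 0)%E ?mule0 //.
rewrite /eint_circle (eq_integral (cst 0%E)) ?integral0 // => t _ /=.
by rewrite /FM_form /= !subrr rmorph0 !mulr0 !mul0r addr0.
Qed.

End Data.
End FaddeevMarchenko.

(** * Test functions *)

Section TestFunctions.
Variable R : realType.
Notation C := R[i].
Notation mu := (@lebesgue_measure R).
Notation TR := (measurableTypeR R).
Notation I01 := (`[0%R, 1%R]%classic : set TR).
Implicit Types (f h g G : C -> C) (u : TR -> C) (N : set R) (t : TR).

Hint Resolve mI01 muI01_fin : core.

Lemma L2_ae_bounded u (M : R) : 0 <= M -> cmeas I01 u ->
  {ae mu, forall t, I01 t -> normc (u t) <= M} -> L2 u.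
Proof.
move=> M0 mu_ hM; pose E : set TR := I01 `&` [set t | normc (u t) <= M].
have mE : measurable E.
  have := measurable_nc mu_ mI01 (measurable_itv `]-oo, M]).
  by congr measurable; apply/seteqP; split => t [It /= h]; split => //; move: h; rewrite /= in_itv.
have h1 : L2 (fun t => if t \in E then u t else 0).
  apply: (@L2_bounded _ _ M); first exact: cmeas_if.
  by move=> t _; case: (boolP (t \in E)) => [/set_mem[]|_] //; rewrite nc0.
have [] := @L2_ae R (fun t => if t \in E then u t else 0) u mu_ _ h1; last by [].
by apply: filterS hM => t h It; rewrite mem_set //; split => //; exact: h.
Qed.

Lemma cintg_rfl u : cintg I01 u -> cintg I01 (fun t => u (rfl t)).
Proof.
move=> hu; have mu_ := cintg_meas mI01 hu; apply/(cintgP mI01); split; first exact: cmeas_rfl.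
have [_] := (cintgP mI01 u).1 hu; rewrite (ge0_int_rfl (f := fun t => (normc (u t))%:E)) //.
  by apply/measurable_EFinP; exact: measurable_nc.
by move=> t; rewrite lee_fin nc_ge0.
Qed.

Lemma hardyoo_dcont g : hardyoo g -> dcont g.
Proof. by move=> [hg _] z hz e e0; exact: (holo_cont (hg z hz) e0). Qed.

Section Data.
Variables (Z : set R) (a : scattering R).
Hypothesis hZ : blaschke_zeros Z.
Hypothesis mr : measurable_circle (refl a).
Hypothesis r1 : ae_circle (fun tau => normc (refl a tau) <= 1).
Hypothesis rs : ae_circle (fun tau => refl a tau = (refl a tau^*)^*).
Hypothesis w0 : forall x, Z x -> 0 < wgt a x.

(** The substitution tau -> conj tau exchanges the two terms of the form because
    R(conj tau) = conj R(tau); each of them therefore contributes half. *)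
Lemma circle_half f h : FM_L2 Z a f -> FM_L2 Z a h ->
  L2 (fun t => (circ t)^* * h (circ t)^*) ->
  2^-1 * cint_circle (FM_form (refl a) f h) =
  cint I01 (fun t => circ t * (h (circ t)^*)^* * phi a f t).
Proof.
move=> hf hh hV; have /(FM_L2P mr r1 w0) [mf _ f1 f2] := hf.
have /(FM_L2P mr r1 w0) [mh _ _ _] := hh.
pose Q t := circ t * (h (circ t)^*)^* * phi a f t.
have iQ : cintg I01 Q.
  apply: eq_cintg (L2_cintgM (L2J hV) f1) => // t _.
  by rewrite /Q conjcM conjcK.
have iQ' := cintg_rfl iQ.
have E : cint_circle (FM_form (refl a) f h) = cint I01 Q + cint I01 Q.
  rewrite -[X in X + _](cint_rfl (cintg_meas mI01 iQ)) -cintD //.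
  apply: (@cint_ae R _ mI01 (fun t => FM_form (refl a) f h (circ t))).
  - exact: cmeas_form.
  - by have i3 := cintgD mI01 iQ' iQ; have := cintg_meas mI01 i3.
  have rs' : {ae mu, forall t, I01 t -> refl a (circ t) = (refl a (circ t)^*)^*} by exact: rs.
  apply: filterS rs' => t ht It.
  rewrite /Q /phi -!circJ !conjcK /FM_form (ht It) !conjcK.
  have := circMJ t; move: (circ t) (circ t)^* => c c' cc.
  have e : f c = c' * (c * f c) by rewrite mulrA [c' * c]mulrC cc mul1r.
  by rewrite [X in (_ * (X + _) + _)]e; ring.
by rewrite E -/Q; field.
Qed.

(** The generators of the Hardy subspace. *)
Definition test N g : C -> C := with_bv (fun z => blaschke N z * g z).

Lemma test_circ N g t : test N g (circ t) = bv (fun z => blaschke N z * g z) (circ t).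
Proof. exact: with_bv_circ. Qed.

Lemma test_real N g x : Z x -> test N g x%:C = blaschke N x%:C * g x%:C.
Proof. by move=> Zx; rewrite /test /with_bv ncR (zeros_lt1 hZ Zx). Qed.

Lemma hardyoo_ub g : hardyoo g -> exists2 M : R, 0 <= M & forall z, in_disk z -> normc (g z) <= M.
Proof.
move=> [_ [M hM]]; exists M => //; apply: le_trans (hM 0 _); first exact: nc_ge0.
by rewrite /in_disk nc0.
Qed.

Lemma test_bounded N g : blaschke_zeros N -> hardyoo g ->
  exists2 M : R, 0 <= M & forall t, normc (test N g (circ t)) <= M.
Proof.
move=> hN /hardyoo_ub [M M0 hM]; exists M => // t; rewrite test_circ.
apply: hardyoo_bv => // z hz; rewrite ncM; apply: le_trans (hM z hz).
by rewrite ler_piMl ?nc_ge0 // nc_blaschke //; exact: adm_disk.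
Qed.

Lemma test_meas N g : blaschke_zeros N -> hardyoo g -> measurable_circle (test N g).
Proof.
move=> hN hg; have h : cmeas I01 (fun t => test N g (circ t)).
  apply: (@eq_cmeas _ _ (fun t => bv (fun z => blaschke N z * g z) (circ t))).
    by move=> t _; rewrite test_circ.
  by apply: cmeas_bv; apply: dcontM; [exact: dcont_blaschke|exact: hardyoo_dcont].
exact: h.
Qed.

Lemma test_FM N g : N `<=` Z -> finite_set (Z `\` N) -> hardyoo g -> FM_L2 Z a (test N g).
Proof.
move=> NZ fN hg; have hN := zeros_sub hZ NZ.
have ms := test_meas hN hg; have [M M0 hM] := test_bounded hN hg.
have M2 : 0 <= M + M by rewrite addr_ge0.
have r1' : {ae mu, forall t, I01 t -> normc (refl a (circ t)) <= 1} by exact: r1.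
apply/(FM_L2P mr r1 w0); split => //.
- rewrite /Ssq (esumID N); last by move=> x Zx; rewrite lee_fin (ssq_ge0 w0).
  rewrite esum1 ?add0e; last first.
    move=> x [Zx Nx]; rewrite test_real // blaschke_zero // mul0r nc0 expr0n mul0r //.
  rewrite -setDE esum_fset //; last first.
    by move=> x /set_mem[Zx _]; rewrite lee_fin (ssq_ge0 w0).
  by rewrite fsumEFin // ltry.
- apply: (@L2_ae_bounded _ (M + M)) => //; first exact: cmeas_phi.
  apply: filterS r1' => t ht It; rewrite /phi; apply: le_trans (ncD _ _) _.
  rewrite !ncM ncJ nc_circ mul1r circJ; apply: lerD; last exact: hM.
  by apply: le_trans (hM t); rewrite ler_piMl ?nc_ge0 // ht.
- apply: (@L2_ae_bounded _ M) => //; first exact: cmeas_psi.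
  apply: filterS r1' => t ht It; rewrite /psi ncM ncR; apply: le_trans (hM t).
  rewrite ler_piMl ?nc_ge0 // ger0_norm ?sqrtr_ge0 // -[leRHS](@sqrtr1 R) ler_wsqrtr //.
  by rewrite gerBl exprn_ge0 // nc_ge0.
Qed.

(** The zeros are real, so conjugating the test function at conj tau reflects g and
    leaves B_N unchanged; on Z only the finitely many points outside N contribute,
    B_N being 0 on N. *)
Lemma inner_test f N g (A : {fset R}) : FM_L2 Z a f -> N `<=` Z -> Z `\` N = [set` A] -> hardyoo g ->
  FM_inner Z a f (test N g) =
  \sum_(x <- A) f x%:C * (blaschke N x%:C * (g x%:C)^*) * (wgt a x)%:C +
  cint I01 (fun t => circ t * (bv (blaschke N) (circ t) * bv (fun z => (g z^*)^*) (circ t)) * phi a f t).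
Proof.
move=> hf NZ AE hg; have hN := zeros_sub hZ NZ.
have fA : finite_set (Z `\` N) by rewrite AE; exact: finite_fset.
have hs := test_FM NZ fA hg; have [M M0 hM] := test_bounded hN hg.
have AZ x : x \in A -> Z x /\ ~ N x by move=> xA; have : (Z `\` N) x by rewrite AE.
rewrite /FM_inner -/(fsum Z a f (test N g)); congr (_ + _).
  apply: sum_lim; have FF := @filter_filter _ _ (totally_proper R).
  have hc := @cto_cst R _ (@summability.totally R) FF (\sum_(x <- A) f x%:C * (blaschke N x%:C * (g x%:C)^*) * (wgt a x)%:C).
  apply: near_eq_cto hc.
  exists A => // D /= AD; rewrite (@big_fset_split R _ _ _ xpredT _ A D AD) /=.
  rewrite [X in _ + X]big1_seq ?addr0; last first.
    move=> x /andP[_]; rewrite inE => /andP[xA _]; rewrite /fsum.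
    case: ifP => // /set_mem Zx; rewrite test_real //.
    have [Nx|nN] := pselect (N x); first by rewrite blaschke_zero // mul0r rmorph0 mulr0 mul0r.
    by have : [set` A] x; [rewrite -AE|rewrite /= (negbTE xA)].
  rewrite big_seq [RHS]big_seq; apply: eq_bigr => x xA; have [Zx _] := AZ x xA.
  rewrite /fsum mem_set // test_real // conjcM -blaschkeJ //.
    by rewrite RCJ.
  by apply: adm_real; exact: zeros_lt1 Zx.
have mf' : cmeas I01 (phi a f) by have /(FM_L2P mr r1 w0) [_ _ [] ] := hf.
have cb : cmeas I01 (fun t => bv (blaschke N) (circ t)) by apply: cmeas_bv; exact: dcont_blaschke.
have cg : cmeas I01 (fun t => bv (fun z => (g z^*)^*) (circ t)).
  by apply: cmeas_bv; apply: hardyoo_dcont; exact: hardyoo_conj.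
have cc : cmeas I01 (@circ R) by exact: cmeas_circ.
rewrite circle_half //; last first.
  apply: (@L2_bounded _ _ M).
    apply: cmeasM => //; first exact: cmeasJ.
    by apply: cmeas_conj; exact: test_meas.
  by move=> t _; rewrite ncM ncJ nc_circ mul1r circJ.
apply: cint_ae => //.
- apply: cmeasM => //; apply: cmeasM => //; apply: cmeasJ => //.
  by apply: cmeas_conj; exact: test_meas.
- by apply: cmeasM => //; apply: cmeasM => //; exact: cmeasM.
apply: filterS (ae_circ_adm R) => t ht It; have at_ := ht It.
congr (_ * _ * _); rewrite circJ test_circ -circJ.
rewrite (@bv_blaschkeM _ _ _ _ hN (admJ at_)) ?ncJ ?nc_circ // conjcM blaschkeJ // conjcK.
by rewrite bv_blaschke // bvJ.
Qed.

End Data.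
End TestFunctions.

(** * The dual data *)

Section Duality.
Variable R : realType.
Notation C := R[i].
Notation mu := (@lebesgue_measure R).
Notation TR := (measurableTypeR R).
Notation I01 := (`[0%R, 1%R]%classic : set TR).
Notation bf := (@blaschke_factor R).
Implicit Types (f h g G : C -> C) (u v : TR -> C) (N : set R) (t : TR) (x : R).

Hint Resolve mI01 muI01_fin : core.

(** Boundary values at +-1, where B may have no limit, are thereby harmless. *)
Lemma cmeas_modif (s : seq R) u v : (forall t, I01 t -> t \notin s -> u t = v t) -> cmeas I01 u -> cmeas I01 v.
Proof.
elim: s u v => [|p s ih] u v uv hu.
  by apply: eq_cmeas hu => t It; exact: uv.
apply: (ih (fun t => (if t \in [set p] then v p else 0) + (if t \in ~` [set p] then u t else 0))).
  move=> t It ts; have [->|tp] := eqVneq t p.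
    by rewrite mem_set // memNset ?addr0 //=; apply.
  rewrite memNset ?add0r; last by apply/eqP.
  by rewrite mem_set ?uv ?inE ?negb_or ?tp //; apply/eqP.
have mp : measurable ([set p] : set TR) by exact: measurable_set1.
have h1 := cmeas_if mI01 mp (cmeas_cst _ (v p)).
have h2 := cmeas_if mI01 (measurableC mp) hu.
exact: cmeasD h1 h2.
Qed.

(** The value of the form, for u = f(tau) and v = conj tau f(conj tau). *)
Definition energy (r u v : C) : R :=
  normc (r * u + v) ^+ 2 + (1 - normc r ^+ 2) * normc u ^+ 2.

Lemma Re_form_polar (r u v : C) :
  complex.Re (u^* * (u + r^* * v) + v^* * (r * u + v)) = energy r u v.
Proof. by rewrite form_polar !nc_mulJ -RCM ReD. Qed.

(** With |p|^2 = |q|^2 = 1 - |r|^2 the duality exchanges the two squares: the dual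
    phi is (1 - |r|^2) u / q, and the dual u is (r u + v) / p. *)
Lemma dual_energy (r u v p q : C) : normc r < 1 ->
  normc p ^+ 2 = 1 - normc r ^+ 2 -> normc q ^+ 2 = 1 - normc r ^+ 2 ->
  energy (- (p / q) * r^*) ((r * u + v) / p) ((u + r^* * v) / q) = energy r u v.
Proof.
move=> r1 hp hq.
have rho : 0 < 1 - normc r ^+ 2.
  by rewrite subr_gt0 -[ltRHS](expr1n R 2) ltr_pXn2r ?nnegrE ?nc_ge0.
have p0 : p != 0 by apply/eqP => E; move: rho; rewrite -hp E nc0 expr0n ltxx.
have q0 : q != 0 by apply/eqP => E; move: rho; rewrite -hq E nc0 expr0n ltxx.
have n0 : 1 - normc r ^+ 2 != 0 by rewrite gt_eqF.
rewrite /energy.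
have -> : - (p / q) * r^* * ((r * u + v) / p) + (u + r^* * v) / q = (1 - normc r ^+ 2)%:C * u / q.
  by rewrite RCB -nc_mulJ; field; rewrite p0 q0.
have -> : normc (- (p / q) * r^*) ^+ 2 = normc r ^+ 2.
  rewrite ncM (ncN (p / q)) (ncM p) (ncV q) ncJ (exprMn _ (normc p / _)) expr_div_n hp hq.
  by rewrite divff // mul1r.
rewrite (ncM _ q^-1) (ncM _ u) (ncM (r * u + v)) !ncV ncR ger0_norm ?(ltW rho) //.
rewrite !exprMn !exprVn hp hq.
move: (normc (r * u + v)) (normc u) n0 => x y; move: (normc r) => s n0.
by field.
Qed.

Section Data.
Variables (Z : set R) (a : scattering R) (O : C -> C).
Hypothesis hZ : blaschke_zeros Z.
Hypothesis ha : A_SB Z a.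
Hypothesis hO : outer O.
Hypothesis hOR : ae_circle (fun tau => normc (bv O tau) ^+ 2 + normc (refl a tau) ^+ 2 = 1).

Let mr : measurable_circle (refl a). Proof. by case: ha. Qed.
Let r1 : ae_circle (fun tau => normc (refl a tau) <= 1). Proof. by case: ha. Qed.
Let rs : ae_circle (fun tau => refl a tau = (refl a tau^*)^*). Proof. by case: ha. Qed.
Let w0 x : Z x -> 0 < wgt a x. Proof. by case: ha => _ _ _ _; exact. Qed.

Notation T := (bv (Tminus Z O)).

Lemma ae_data : {ae mu, forall t, I01 t ->
  [/\ adm (circ t), normc (refl a (circ t)) < 1, refl a (circ t)^* = (refl a (circ t))^*,
    normc (T (circ t)) ^+ 2 = 1 - normc (refl a (circ t)) ^+ 2 &
    normc (T (circ t)^*) ^+ 2 = 1 - normc (refl a (circ t)) ^+ 2]}.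
Proof.
have hOR' : {ae mu, forall t, I01 t -> normc (bv O (circ t)) ^+ 2 + normc (refl a (circ t)) ^+ 2 = 1} by exact: hOR.
have lt1 : {ae mu, forall t, I01 t -> normc (refl a (circ t)) < 1}.
  by apply: (ae_circ_lt1 mr); case: ha.
have rs' : {ae mu, forall t, I01 t -> refl a (circ t) = (refl a (circ t)^*)^*} by exact: rs.
have h1 := aeS2 (fun t p q => conj p q) (ae_circ_adm R) lt1.
have h2 := aeS2 (fun t p q => conj p q) rs' hOR'.
have h3 := aeS2 (fun t p q => conj p q) h1 h2.
apply: (aeS2 _ h3 (ae_rfl hOR')) => t [[p1 p2] [p3 p4]] p5 It.
have a1 := p1 It; have s1 := p3 It.
have s2 : refl a (circ t)^* = (refl a (circ t))^* by rewrite [in RHS]s1 conjcK.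
have nB z : adm z -> normc z = 1 -> normc (T z) ^+ 2 = normc (bv O z) ^+ 2.
  by move=> az z1; rewrite bv_Tminus // ncM ncV nc_blaschke1 // invr1 mulr1.
split => //; first exact: p2.
  by rewrite nB ?nc_circ // -(p4 It) addrK.
rewrite nB ?ncJ ?nc_circ //; last exact: admJ.
by have := p5 It; rewrite -circJ s2 ncJ => <-; rewrite addrK.
Qed.

Lemma cmeas_T : cmeas I01 (fun t => T (circ t)).
Proof.
have [_ cO] := outer_disk hO.
apply: (@cmeas_modif [:: 0; 1; 2^-1] (fun t => bv O (circ t) * (bv (blaschke Z) (circ t))^-1)).
  move=> t; rewrite /= in_itv /= => /andP[t0 t1]; rewrite !inE !negb_or => /and3P[n0 n1 nh].
  have at_ : adm (circ t) by apply: circ_adm => //; rewrite !lt_def n0 t0 t1 eq_sym n1.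
  by rewrite bv_Tminus ?nc_circ // bv_blaschke.
apply: cmeasM => //; first exact: cmeas_bv.
by apply: cmeasV => //; apply: cmeas_bv; exact: dcont_blaschke.
Qed.

Lemma duality_circ f t : duality Z O a f (circ t) = phi a f t / T (circ t).
Proof. by rewrite /duality nc_circ eqxx addrC. Qed.

Lemma duality_real f x : Z x -> duality Z O a f x%:C =
  - (dbf x * blaschke (Z `\ x) x%:C / O x%:C) * (wgt a x)%:C * f x%:C.
Proof.
move=> Zx; have x1 := zeros_lt1 hZ Zx; rewrite /duality ncR ifF; last by apply/eqP => E; rewrite E ltxx in x1.
by rewrite dinvT_val.
Qed.

Notation a' := (dual_data Z O a).

Lemma refl_dual t : refl a' (circ t) = - (T (circ t) / T (circ t)^*) * (refl a (circ t))^*.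
Proof. by rewrite /= bv_Tplus conjcK. Qed.

Lemma cmeas_TJ : cmeas I01 (fun t => T (circ t)^*).
Proof. by apply: eq_cmeas (cmeas_rfl cmeas_T) => t _; rewrite circJ. Qed.

Lemma meas_refl_dual : measurable_circle (refl a').
Proof.
have h : cmeas I01 (fun t => refl a' (circ t)).
  apply: (@eq_cmeas _ _ (fun t => - (T (circ t) * (T (circ t)^*)^-1) * (refl a (circ t))^*)).
    by move=> t _; rewrite refl_dual.
  apply: cmeasM => //; last by apply: cmeasJ => //; exact: mr.
  apply: cmeasN => //; apply: cmeasM => //; first exact: cmeas_T.
  by apply: cmeasV => //; exact: cmeas_TJ.
exact: h.
Qed.

Lemma meas_duality f : measurable_circle f -> measurable_circle (duality Z O a f).
Proof.
move=> mf; have h : cmeas I01 (fun t => duality Z O a f (circ t)).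
  apply: (@eq_cmeas _ _ (fun t => phi a f t * (T (circ t))^-1)).
    by move=> t _; rewrite duality_circ.
  by apply: cmeasM => //; [exact: cmeas_phi|apply: cmeasV => //; exact: cmeas_T].
exact: h.
Qed.

Lemma dual_form f : {ae mu, forall t, I01 t ->
  complex.Re (FM_form (refl a') (duality Z O a f) (duality Z O a f) (circ t)) =
  complex.Re (FM_form (refl a) f f (circ t))}.
Proof.
apply: filterS ae_data => t h It; have [_ r1t rJ hT hT'] := h It.
pose U := f (circ t); pose V := (circ t)^* * f (circ t)^*; pose r := refl a (circ t).
have dU : duality Z O a f (circ t) = (r * U + V) / T (circ t) by rewrite duality_circ.
have dV : (circ t)^* * duality Z O a f (circ t)^* = (U + r^* * V) / T (circ t)^*.
  rewrite /V !circJ duality_circ /phi -!circJ !conjcK rJ mulrA; congr (_ / _).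
  have e : (circ t)^* * (circ t * f (circ t)) = U by rewrite mulrA [(circ t)^* * _]mulrC circMJ mul1r.
  by rewrite mulrDr e addrC mulrCA.
have FE (b : C -> C) (k : C -> C) : FM_form b k k (circ t) =
   (k (circ t))^* * (k (circ t) + (b (circ t))^* * ((circ t)^* * k (circ t)^*)) +
   ((circ t)^* * k (circ t)^*)^* * (b (circ t) * k (circ t) + (circ t)^* * k (circ t)^*).
  by rewrite /FM_form conjcM conjcK.
rewrite !FE !Re_form_polar dU dV refl_dual; exact: dual_energy.
Qed.

(** [dual_form] on the circle; on Z the dual weight cancels the factor |(1/T_-)'|^2
    nu of |f^-|^2. *)
Lemma duality_FM f : FM_L2 Z a f -> FM_L2 Z a' (duality Z O a f).
Proof.
move=> hf; have /(FM_L2P mr r1 w0) [mf Sf [_ f1] [_ f2]] := hf.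
have md := meas_duality mf; split => //; rewrite /FM_normsq.
have -> : eint_circle (fun tau => (complex.Re (FM_form (refl a') (duality Z O a f) (duality Z O a f) tau))%:E) =
    eint_circle (fun tau => (complex.Re (FM_form (refl a) f f tau))%:E).
  apply: ae_eq_integral => //.
  - by apply/measurable_EFinP; have [] := cmeas_form meas_refl_dual md md.
  - by apply/measurable_EFinP; have [] := cmeas_form mr mf mf.
  by apply: filterS (dual_form f) => t ht It; rewrite ht.
rewrite FM_energyE //; apply: lte_add_pinfty.
  apply: le_lt_trans Sf; apply: le_esum => x Zx; rewrite lee_fin.
  have wx := w0 Zx; have x1 := zeros_lt1 hZ Zx.
  rewrite /duality ncR ifF; last by apply/eqP => E; rewrite E ltxx in x1.
  rewrite /= !ncM ncN ncR gtr0_norm // -/(Tminus Z O).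
  set D := normc (dinvT Z O x%:C); have [->|D0] := eqVneq D 0.
    by rewrite !mul0r expr0n mul0r mulr_ge0 ?exprn_ge0 ?nc_ge0 // ltW.
  rewrite le_eqVlt; apply/orP; left; apply/eqP.
  by field; rewrite D0 gt_eqF.
rewrite lte_mul_pinfty // ?lee_fin //.
exact: lte_add_pinfty.
Qed.

End Data.
End Duality.

(** * Orthogonality and interpolation *)

Section Main.
Variable R : realType.
Notation C := R[i].
Notation mu := (@lebesgue_measure R).
Notation TR := (measurableTypeR R).
Notation I01 := (`[0%R, 1%R]%classic : set TR).
Notation bf := (@blaschke_factor R).
Implicit Types (f h g G : C -> C) (u v w : TR -> C) (N : set R) (t : TR) (x : R).

Hint Resolve mI01 muI01_fin : core.

Lemma cmeas_bf x : cmeas I01 (fun t => bf x (circ t)).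
Proof.
have cc : cmeas I01 (@circ R) by exact: cmeas_circ.
have ck (c : C) : cmeas I01 (fun=> c) by exact: cmeas_cst.
rewrite /bf; case: eqP => // _; apply: cmeasM => //.
apply: cmeasM => //; first exact: cmeasB.
by apply: cmeasV => //; apply: cmeasB => //; exact: cmeasM.
Qed.

Lemma dbf_neq0 x : `|x| < 1 -> dbf x != 0.
Proof.
move=> x1; rewrite /dbf; case: ifPn => [_|x0]; first exact: oner_neq0.
rewrite oppr_eq0; apply/eqP => /(congr1 (@complex.Re R)) /= /eqP.
rewrite !mulf_eq0 normr_eq0 !invr_eq0 (negbTE x0) /=.
by rewrite gt_eqF // subr_gt0 -(@real_normK _ x) ?num_real // exprn_ilt1.
Qed.

Lemma bf_neq0 x y : `|x| < 1 -> `|y| < 1 -> y != x -> bf y x%:C != 0.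
Proof.
move=> x1 y1 yx; have RC0 (r : R) : r != 0 -> r%:C != 0 :> C.
  by move=> r0; apply/eqP => /(congr1 (@complex.Re R)) /= /eqP; apply/negP.
have d0 := den_neq0 (adm_real x1) y1.
rewrite /bf; have [y0|y0] := eqVneq y 0; first by apply: RC0; rewrite eq_sym -y0.
rewrite mulf_neq0 // ?RC0 ?mulf_neq0 ?normr_eq0 ?invr_eq0 //.
by rewrite -RCB RC0 // subr_eq0.
Qed.

Lemma bv_X n t : bv (fun z : C => z ^+ n) (circ t) = circ t ^+ n.
Proof.
apply: bv_cto; rewrite -{2}[circ t]mul1r; apply: ctoX; apply: ctoM; last exact: cto_cst.
by apply: cto_real; exact: cvg_at_left_filter.
Qed.

Section Data.
Variables (Z : set R) (a : scattering R) (O : C -> C).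
Hypothesis hZ : blaschke_zeros Z.
Hypothesis ha : A_SB Z a.
Hypothesis hO : outer O.
Hypothesis hOR : ae_circle (fun tau => normc (bv O tau) ^+ 2 + normc (refl a tau) ^+ 2 = 1).

Let mr : measurable_circle (refl a). Proof. by case: ha. Qed.
Let r1 : ae_circle (fun tau => normc (refl a tau) <= 1). Proof. by case: ha. Qed.
Let rs : ae_circle (fun tau => refl a tau = (refl a tau^*)^*). Proof. by case: ha. Qed.
Let w0 x : Z x -> 0 < wgt a x. Proof. by case: ha => _ _ _ _; exact. Qed.

Notation T := (bv (Tminus Z O)).
Notation B := (bv (blaschke Z)).

Lemma nc_B t : normc (B (circ t)) <= 1.
Proof. by apply: hardyoo_bv => // z hz; apply: nc_blaschke => //; exact: adm_disk. Qed.

Lemma cmeas_bvB N : blaschke_zeros N -> cmeas I01 (fun t => bv (blaschke N) (circ t)).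
Proof. by move=> hN; apply: cmeas_bv; exact: dcont_blaschke. Qed.

Lemma T_neq0 : {ae mu, forall t, I01 t -> T (circ t) != 0}.
Proof.
apply: filterS (ae_data hZ ha hOR) => t h It; have [_ rt _ hT _] := h It.
apply/eqP => E; move: hT; rewrite E nc0 expr0n /= => /esym/eqP; apply/negP; rewrite gt_eqF //.
by rewrite subr_gt0 -[ltRHS](expr1n R 2) ltr_pXn2r ?nnegrE ?nc_ge0.
Qed.

Lemma B_T_dual f : {ae mu, forall t, I01 t ->
  B (circ t) * T (circ t) * duality Z O a f (circ t) = B (circ t) * phi a f t}.
Proof.
apply: filterS T_neq0 => t h It; rewrite duality_circ -mulrA; congr (_ * _).
by rewrite mulrC divfK // h.
Qed.

(** B_N is B divided by the finite product over A, which has modulus 1 on the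
    circle. *)
Lemma circle_residues f N (A : {fset R}) g w : FM_L2 Z a f -> N `<=` Z -> Z `\` N = [set` A] -> hardyoo g ->
  L2 w -> analytic w ->
  {ae mu, forall t, I01 t -> w t = bv (fun z => (g z^*)^*) (circ t) * (B (circ t) * phi a f t)} ->
  cint I01 (fun t => circ t * (bv (blaschke N) (circ t) * bv (fun z => (g z^*)^*) (circ t)) * phi a f t) =
  \sum_(x <- A) resid A x * cauchy w x%:C.
Proof.
move=> hf NZ AE hg hw aw wE; have hN := zeros_sub hZ NZ.
have AZ : [set` A] `<=` Z by rewrite -AE; exact: subDsetl.
have NE : N = Z `\` [set` A] by rewrite -AE setDD setIC; apply/esym/setIidl.
rewrite -(int_partial_fractions (fset_uniq A)) //; last first.
  by move=> x xA; apply: (zeros_lt1 hZ); exact: AZ.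
have cp : cmeas I01 (phi a f) by have /(FM_L2P mr r1 w0) [_ _ [] ] := hf.
have cc : cmeas I01 (@circ R) by exact: cmeas_circ.
have cg : cmeas I01 (fun t => bv (fun z => (g z^*)^*) (circ t)).
  by apply: cmeas_bv; apply: hardyoo_dcont; exact: hardyoo_conj.
have cN := cmeas_bvB hN.
apply: cint_ae => //.
- by apply: cmeasM => //; apply: cmeasM => //; exact: cmeasM.
- apply: cmeasM => //; first by apply: cmeasM => //; exact: L2_meas.
  by apply: cmeasV => //; apply: cmeas_prod => // x; exact: cmeas_bf.
apply: (aeS2 _ (ae_circ_adm R) wE) => t h1 h2 It; have at_ := h1 It.
rewrite (h2 It) !bv_blaschke // (blaschke_split hZ AZ at_) -NE.
have P0 : \prod_(x <- A) bf x (circ t) != 0.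
  rewrite -nc_gt0 nc_prod big_seq big1 // => x xA; apply: nc_bf1 => //; first exact: nc_circ.
  by apply: (zeros_lt1 hZ); exact: AZ.
move: (\prod_(x <- A) _) P0 => p p0; move: (blaschke N _) (bv _ _) (phi _ _ _) => b k q.
by field.
Qed.

(** Testing against B z^n shows that B phi has no coefficients of negative index;
    testing against B_(Z \ x) gives the value at x of its Cauchy integral. *)
Lemma orth_hat f : FM_orth Z a (checkH Z a) f -> hatH Z O (dual_data Z O a) (duality Z O a f).
Proof.
move=> [hf orth]; split; first exact: duality_FM.
have [nzO _] := outer_disk hO.
have test0 N g (A : {fset R}) : N `<=` Z -> Z `\` N = [set` A] -> hardyoo g ->
   FM_inner Z a f (test N g) = 0.
  move=> NZ AE hg; have fA : finite_set (Z `\` N) by rewrite AE; exact: finite_fset.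
  apply: orth; apply: closure_self; first exact: (test_FM hZ mr r1 w0 NZ fA hg).
  by exists N, g.
have /(FM_L2P mr r1 w0) [mf _ f1 _] := hf.
pose w t := B (circ t) * phi a f t.
have [Lw _] := L2M_bounded (cmeas_bvB hZ) (fun t _ => nc_B t) f1.
have aw : analytic w.
  move=> [//|n] _; have AE : Z `\` Z = [set` (fset0 : {fset R})] by rewrite setDv set_fset0.
  have := test0 Z (fun z => z ^+ n) fset0 (@subset_refl _ Z) AE (hardyooX R n).
  rewrite (inner_test hZ mr r1 rs w0 hf (@subset_refl _ Z) AE (hardyooX R n)) big_seq_fset0 add0r => <-.
  apply: eq_cint => t _.
  have -> : (fun z : C => (z^* ^+ n)^*) = fun z => z ^+ n by apply/funext => z; rewrite conjcX conjcK.
  by rewrite bv_X exprS /w; ring.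
exists (cauchy w); split.
- exact: hardy2_cauchy.
- have := aeS2 (fun t p q => conj p q) (fatou_radial (L2_cintg Lw) aw) (B_T_dual f).
  apply: filterS => t [h1 h2] It; apply/(ctoP (F := (1 : R)^'-)); rewrite (h2 It).
  exact: h1 It.
move=> x Zx; have x1 := zeros_lt1 hZ Zx.
have NZ : Z `\ x `<=` Z by exact: subDsetl.
have AE : Z `\` (Z `\ x) = [set` [fset x]%fset].
  rewrite set_fset1; apply/seteqP; split => [y [Zy /not_andP[//|/contrapT]] //|y /= ->].
  by split => // -[].
have hg := hardyooX R 0.
have g1 : (fun z : C => (z^* ^+ 0)^*) = fun z => z ^+ 0 by apply/funext => z; rewrite conjcX conjcK.
have := test0 (Z `\ x) (fun z => z ^+ 0) [fset x]%fset NZ AE hg.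
rewrite (inner_test hZ mr r1 rs w0 hf NZ AE hg).
rewrite (@circle_residues f _ _ _ w hf NZ AE hg Lw aw); last first.
  by apply: aeW => t _; rewrite g1 bv_X expr0 mul1r.
rewrite !big_seq_fset1 expr0 rmorph1 mulr1 /resid.
rewrite big1_seq ?mulr1; last by move=> y /andP[yx]; rewrite inE (negbTE yx).
move=> E; rewrite duality_real //.
have d0 := dbf_neq0 x1; have Ox := nzO x%:C; rewrite /in_disk ncR in Ox; have {}Ox := Ox x1.
have -> : cauchy w x%:C = - (dbf x * (f x%:C * blaschke (Z `\ x) x%:C * (wgt a x)%:C)).
  apply: (mulfI (invr_neq0 d0)); rewrite mulrN mulKf //; apply/eqP.
  by rewrite -addr_eq0 addrC E.
move: (O x%:C) Ox (dbf x) d0 => o o0 d d0; field.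
exact: o0.
Qed.

(** The residue at x in A is g~(x) G(x) / (b_x'(x) prod_(y in A, y <> x) b_y(x)),
    and B_(Z \ x)(x) = B_N(x) prod_(y in A, y <> x) b_y(x); with the interpolated
    value of G(x) it is the opposite of the term f(x) B_N(x) g~(x) nu(x). *)
Lemma hat_orth f : FM_L2 Z a f -> hatH Z O (dual_data Z O a) (duality Z O a f) ->
  FM_orth Z a (checkH Z a) f.
Proof.
move=> hf [_ [G [hG Gr Gx]]]; have [nzO _] := outer_disk hO.
have GE x : Z x -> G x%:C = - (dbf x * blaschke (Z `\ x) x%:C * (wgt a x)%:C * f x%:C).
  move=> Zx; have x1 := zeros_lt1 hZ Zx.
  have Ox := nzO x%:C; rewrite /in_disk ncR in Ox; have {}Ox := Ox x1.
  have := Gx x Zx; rewrite duality_real // => E.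
  apply: (mulIf (invr_neq0 Ox)); rewrite -E; field; exact: Ox.
apply: (orth_closure mr r1 w0) => //.
  by move=> _ [N [g [NZ fN hg ->]]]; exact: (test_FM hZ mr r1 w0 NZ fN hg).
move=> _ [N [g [NZ fN hg ->]]]; have [A AE] := finite_fsetP.1 fN.
have AZ x : x \in A -> Z x by move=> xA; have [] : (Z `\` N) x by rewrite AE.
have hg' := hardyoo_conj hg.
have [w [Lw aw wC wr]] := hardy2_boundary (hardyooM_hardy2 hg' hG).
have [v [_ _ _ vr]] := hardy2_boundary (hardyoo_hardy2 hg').
have Gr' : {ae mu, forall t, I01 t -> radial G (circ t) @ 1^'- -->
   (B (circ t) * T (circ t) * duality Z O a f (circ t) : C^o)} by exact: Gr.
rewrite -/(test N g) (inner_test hZ mr r1 rs w0 hf NZ AE hg).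
rewrite (@circle_residues f _ _ _ w hf NZ AE hg Lw aw); last first.
  have h1 := aeS2 (fun t p q => conj p q) wr vr.
  have h2 := aeS2 (fun t p q => conj p q) Gr' (B_T_dual f).
  apply: (aeS2 _ h1 h2) => t [p1 p2] [p3 p4] It.
  have c1 := p2 It; have /ctoP c2 := p3 It; rewrite (p4 It) in c2.
  rewrite (bv_cto c1); apply: (cto_unique (p1 It)); exact: ctoM c1 c2.
rewrite -big_split /= big_seq big1 // => x xA.
have Zx := AZ x xA; have x1 := zeros_lt1 hZ Zx.
rewrite -wC ?/in_disk ?ncR // RCJ GE //.
pose A1 := [fset y in A | y != x]%fset.
have NE : N = (Z `\ x) `\` [set` A1].
  apply/seteqP; split => y.
    move=> Ny; split; first split; first exact: NZ.
      move=> /= yx; have [_ nNx] : (Z `\` N) x by rewrite AE.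
      by apply: nNx; rewrite -yx.
    rewrite /= !inE /= => /andP[yA _]; have [_] : (Z `\` N) y by rewrite AE.
    exact.
  move=> [[Zy yx] nA]; apply: contrapT => nN; apply: nA.
  have yA : [set` A] y by rewrite -AE.
  by rewrite /= !inE /=; apply/andP; split => //; apply/eqP.
have hZx : blaschke_zeros (Z `\ x) by apply: zeros_sub hZ _; exact: subDsetl.
have A1Z : [set` A1] `<=` Z `\ x.
  by move=> y; rewrite /= !inE /= => /andP[yA /eqP yx]; split => //; exact: AZ.
have P : \prod_(y <- A | y != x) bf y x%:C = \prod_(y <- A1) bf y x%:C by rewrite big_fset_condE.
have P0 : \prod_(y <- A1) bf y x%:C != 0.
  rewrite prodf_seq_neq0; apply/allP => y; rewrite !inE /= => /andP[yA yx].
  by apply: bf_neq0 => //; apply: (zeros_lt1 hZ); exact: AZ.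
rewrite (blaschke_split hZx A1Z (adm_real x1)) -NE /resid P.
have d0 := dbf_neq0 x1.
move: (\prod_(y <- A1) _) P0 (dbf x) d0 => p p0 d d0.
by field; rewrite p0 d0.
Qed.

End Data.
End Main.

Theorem theorem1p18 (R : realType) (Z : set R) (a : scattering R)
    (O : R[i] -> R[i]) (hZ : blaschke_zeros Z) (ha : A_SB Z a)
    (hO : outer O)
    (hOR : ae_circle (fun tau : R[i] =>
             normc (bv O tau) ^+ 2 + normc (refl a tau) ^+ 2 = 1)) :
  (forall f : R[i] -> R[i], FM_orth Z a (checkH Z a) f ->
     hatH Z O (dual_data Z O a) (duality Z O a f)) /\
  [set f | FM_L2 Z a f /\ hatH Z O (dual_data Z O a) (duality Z O a f)] =
    FM_orth Z a (checkH Z a).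
Proof.
have h1 := orth_hat hZ ha hO hOR; split => //.
apply/seteqP; split => f; first by case; exact: hat_orth.
by move=> hf; split; [case: hf|exact: h1].
Qed.
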